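(* Let $\tau\in\{1,-1\}$, $q\in\mathcal S(\mathbb R,\mathbb C)$ and $\mathbf f\in\mathcal S(\mathbb R,\mathbb C^2)$. Assume that $a(\lambda)\ne0$ and $A(\lambda)\neq 0$ for all $\lambda\in\mathbb R$, that $a$ has finitely many zeros $z_{1,+},\dots,z_{n,+}$ in $\mathbb C^+$, that $A$ has finitely many zeros $z_{1,-},\dots,z_{n,-}$ in $\mathbb C^-$, and that all these zeros are simple. For $\lambda\in\mathbb R$ define $$c_+(\lambda)=\frac{1}{a(\lambda)}\int_{-\infty}^\infty\begin{bmatrix}-m_{1,-}^{(2)}(s;\lambda) & m_{1,-}^{(1)}(s;\lambda)\end{bmatrix}\mathbf f(s)\,\mathrm ds,\qquad c_-(\lambda)=-\frac{1}{A(\lambda)}\int_{-\infty}^\infty\begin{bmatrix}m_{1,+}^{(2)}(s;\lambda) & -m_{1,+}^{(1)}(s;\lambda)\end{bmatrix}\mathbf f(s)\,\mathrm ds ,$$ and for $j=1,\dots,n$ define $$\mathbf w_{j,+}(x)=\frac{1}{a'(z_{j,+})}\mathbf m_{2,+}(x;z_{j,+})\int_{-\infty}^\infty\begin{bmatrix}-m_{1,-}^{(2)}(s;z_{j,+}) & m_{1,-}^{(1)}(s;z_{j,+})\end{bmatrix}\mathbf f(s)\,\mathrm ds,$$ $$\mathbf w_{j,-}(x)=\frac{1}{A'(z_{j,-})}\mathbf m_{2,-}(x;z_{j,-})\int_{-\infty}^\infty\begin{bmatrix}m_{1,+}^{(2)}(s;z_{j,-}) & -m_{1,+}^{(1)}(s;z_{j,-})\end{bmatrix}\mathbf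 f(s)\,\mathrm ds.$$ Then for every $x\in\mathbb R$ $$\mathbf f(x)=-\frac{\sigma_3}{2\pi}\int_{-\infty}^\infty\left(c_+(\lambda)\mathbf m_{2,+}(x;\lambda)+c_-(\lambda)\mathbf m_{2,-}(x;\lambda)\right)\mathrm d\lambda+i\sigma_3\sum_{j=1}^n\mathbf w_{j,+}(x)+i\sigma_3\sum_{j=1}^n\mathbf w_{j,-}(x).$$
   Context: $\mathbb C^\pm$ are the open upper/lower half-planes and $\overline{\mathbb C^\pm}$ their closures. $\mathcal S(\mathbb R,\cdot)$ denotes Schwartz-class functions. Let $\sigma_3=\mathrm{diag}(1,-1)$, $\mathbf e_1=[1,0]^T$, $\mathbf e_2=[0,1]^T$, and $\mathbf Q(x)=\begin{bmatrix}0&q(x)\\ \tau\overline{q(x)}&0\end{bmatrix}$. Jost-like functions: for $\lambda\in\overline{\mathbb C^+}$, $\mathbf r_{1,-}(\cdot;\lambda)$ and $\mathbf r_{2,+}(\cdot;\lambda)$ are the unique bounded solutions $\mathbb R\to\mathbb C^2$ of $$\mathbf r_{1,-}(x;\lambda)=\mathbf e_1+\int_{-\infty}^x\mathrm{diag}(1,e^{2i\lambda(x-s)})\mathbf Q(s)\mathbf r_{1,-}(s;\lambda)\,\mathrm ds,\qquad \mathbf r_{2,+}(x;\lambda)=\mathbf e_2-\int_x^{\infty}\mathrm{diag}(e^{-2i\lambda(x-s)},1)\mathbf Q(s)\mathbf r_{2,+}(s;\lambda)\,\mathrm ds,$$ and for $\lambda\in\overline{\mathbb C^-}$, $\mathbf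 r_{2,-}(\cdot;\lambda)$ and $\mathbf r_{1,+}(\cdot;\lambda)$ are the unique bounded solutions of $$\mathbf r_{2,-}(x;\lambda)=\mathbf e_1-\int_x^{\infty}\mathrm{diag}(1,e^{2i\lambda(x-s)})\mathbf Q(s)\mathbf r_{2,-}(s;\lambda)\,\mathrm ds,\qquad \mathbf r_{1,+}(x;\lambda)=\mathbf e_2+\int_{-\infty}^x\mathrm{diag}(e^{-2i\lambda(x-s)},1)\mathbf Q(s)\mathbf r_{1,+}(s;\lambda)\,\mathrm ds.$$ Set $\mathbf m_{\ell,\pm}(x;\lambda)=e^{\pm i\lambda x}\mathbf r_{\ell,\pm}(x;\lambda)$ for $\ell\in\{1,2\}$; these solve $\mathbf m'=(-i\lambda\sigma_3+\mathbf Q)\mathbf m$. Superscripts $(1),(2)$ denote the two entries of a vector. The scattering coefficients are the ($x$-independent) determinants $a(\lambda)=\det[\mathbf m_{1,-}(x;\lambda)\ \ \mathbf m_{2,+}(x;\lambda)]$ for $\lambda\in\overline{\mathbb C^+}$ and $A(\lambda)=\det[\mathbf m_{2,-}(x;\lambda)\ \ \mathbf m_{1,+}(x;\lambda)]$ for $\lambda\in\overline{\mathbb C^-}$; $a$ is analytic in $\mathbb C^+$ and $A$ in $\mathbb C^-$, and primes on $a,A$ denote derivatives in $\lambda$. *)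

(* Defs.v *)
From HB Require Import structures.
From mathcomp Require Import all_boot all_order all_algebra.
From mathcomp Require Import complex.
From mathcomp Require Import all_classical all_reals all_analysis.

Set Implicit Arguments.
Unset Strict Implicit.
Unset Printing Implicit Defensive.

Import Order.TTheory GRing.Theory Num.Theory.
Import numFieldNormedType.Exports.

Local Open Scope classical_set_scope.
Local Open Scope ring_scope.
Local Open Scope complex_scope.

(** Complex-valued and [C^2]-valued calculus on the real line.  Differentiation
    and Lebesgue integration are done on real and imaginary parts. *)

Definition cexp (R : realType) (z : R[i]) : R[i] :=
  (expR (complex.Re z))%:C * (cos (complex.Im z) +i* sin (complex.Im z)).

Definition schwartzR (R : realType) (g : R -> R) : Prop :=
  (forall (n : nat) (x : R), derivable (derive1n n g) x 1) /\
  (forall k n : nat, exists M : R, forall x : R,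
     `|x ^+ k * derive1n n g x| <= M).

Definition schwartzC (R : realType) (g : R -> R[i]) : Prop :=
  schwartzR (fun x => complex.Re (g x)) /\
  schwartzR (fun x => complex.Im (g x)).

Definition schwartzV (R : realType) (g : R -> 'cV[R[i]]_2) : Prop :=
  forall k : 'I_2, schwartzC (fun x => g x k 0).

Definition cintegrable (R : realType) (D : set R) (g : R -> R[i]) : Prop :=
  lebesgue_measure.-integrable D (fun x => (complex.Re (g x))%:E) /\
  lebesgue_measure.-integrable D (fun x => (complex.Im (g x))%:E).

Definition cintegral (R : realType) (D : set R) (g : R -> R[i]) : R[i] :=
  Rintegral lebesgue_measure D (fun x => complex.Re (g x)) +i*
  Rintegral lebesgue_measure D (fun x => complex.Im (g x)).

Definition vintegrable (R : realType) (D : set R) (g : R -> 'cV[R[i]]_2) :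
    Prop :=
  forall k : 'I_2, cintegrable D (fun x => g x k 0).

Definition vintegral (R : realType) (D : set R) (g : R -> 'cV[R[i]]_2) :
    'cV[R[i]]_2 :=
  \col_k cintegral D (fun x => g x k 0).

Definition row2 (R : realType) (u v : R[i]) : 'rV[R[i]]_2 :=
  \row_k (if k == 0 then u else v).

Definition diag2 (R : realType) (u v : R[i]) : 'M[R[i]]_2 :=
  diag_mx (row2 u v).

Definition e1 (R : realType) : 'cV[R[i]]_2 := (row2 1 0)^T.
Definition e2 (R : realType) : 'cV[R[i]]_2 := (row2 0 1)^T.

Definition sigma3 (R : realType) : 'M[R[i]]_2 := diag2 1 (-1).

Definition Qmx (R : realType) (tau : R) (q : R -> R[i]) (x : R) : 'M[R[i]]_2 :=
  col_mx (row2 0 (q x)) (row2 (tau%:C * (q x)^*%C) 0).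

(** [diag (1, exp (2 i lambda y))] and [diag (exp (- 2 i lambda y), 1)]. *)
Definition ker1 (R : realType) (lam : R[i]) (y : R) : 'M[R[i]]_2 :=
  diag2 1 (cexp (2 * 'i%C * lam * y%:C)).
Definition ker2 (R : realType) (lam : R[i]) (y : R) : 'M[R[i]]_2 :=
  diag2 (cexp (- (2 * 'i%C * lam * y%:C))) 1.

(** Bounded solutions of the Volterra equations normalized at -oo and +oo.
    [Rintegral] is total, so the existence of the integral is required
    explicitly. *)

Definition boundedV (R : realType) (r : R -> 'cV[R[i]]_2) : Prop :=
  exists M : R, forall (x : R) (k : 'I_2), `|r x k 0| <= M%:C.

Definition jost_left (R : realType) (tau : R) (q : R -> R[i])
    (e : 'cV[R[i]]_2) (ker : R -> 'M[R[i]]_2) (r : R -> 'cV[R[i]]_2) : Prop :=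
  boundedV r /\
  forall x : R,
    let F s := ker (x - s) *m Qmx tau q s *m r s in
    vintegrable [set` `]-oo, x]] F /\ r x = e + vintegral [set` `]-oo, x]] F.

Definition jost_right (R : realType) (tau : R) (q : R -> R[i])
    (e : 'cV[R[i]]_2) (ker : R -> 'M[R[i]]_2) (r : R -> 'cV[R[i]]_2) : Prop :=
  boundedV r /\
  forall x : R,
    let F s := ker (x - s) *m Qmx tau q s *m r s in
    vintegrable [set` `[x, +oo[] F /\ r x = e - vintegral [set` `[x, +oo[] F.

(** Definite descriptions: [r1m] and [r2p] are meaningful for [0 <= Im lam],
    [r2m] and [r1p] for [Im lam <= 0]. *)

Definition r1m (R : realType) (tau : R) (q : R -> R[i]) (lam : R[i]) :
    R -> 'cV[R[i]]_2 :=
  xget (fun=> 0) [set r | jost_left tau q (e1 R) (ker1 lam) r].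
Definition r2p (R : realType) (tau : R) (q : R -> R[i]) (lam : R[i]) :
    R -> 'cV[R[i]]_2 :=
  xget (fun=> 0) [set r | jost_right tau q (e2 R) (ker2 lam) r].
Definition r2m (R : realType) (tau : R) (q : R -> R[i]) (lam : R[i]) :
    R -> 'cV[R[i]]_2 :=
  xget (fun=> 0) [set r | jost_right tau q (e1 R) (ker1 lam) r].
Definition r1p (R : realType) (tau : R) (q : R -> R[i]) (lam : R[i]) :
    R -> 'cV[R[i]]_2 :=
  xget (fun=> 0) [set r | jost_left tau q (e2 R) (ker2 lam) r].

Definition m1m (R : realType) (tau : R) (q : R -> R[i]) (x : R) (lam : R[i]) :
    'cV[R[i]]_2 := cexp (- ('i%C * lam * x%:C)) *: r1m tau q lam x.
Definition m2p (R : realType) (tau : R) (q : R -> R[i]) (x : R) (lam : R[i]) :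
    'cV[R[i]]_2 := cexp ('i%C * lam * x%:C) *: r2p tau q lam x.
Definition m2m (R : realType) (tau : R) (q : R -> R[i]) (x : R) (lam : R[i]) :
    'cV[R[i]]_2 := cexp (- ('i%C * lam * x%:C)) *: r2m tau q lam x.
Definition m1p (R : realType) (tau : R) (q : R -> R[i]) (x : R) (lam : R[i]) :
    'cV[R[i]]_2 := cexp ('i%C * lam * x%:C) *: r1p tau q lam x.

Definition det2 (R : realType) (u v : 'cV[R[i]]_2) : R[i] :=
  \det (row_mx u v : 'M[R[i]]_2).

(** The determinants do not depend on the base point (the coefficient matrix of
    the linear system is traceless); they are evaluated at [x = 0]. *)
Definition scat_a (R : realType) (tau : R) (q : R -> R[i]) (lam : R[i]) : R[i] :=
  det2 (m1m tau q 0 lam) (m2p tau q 0 lam).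
Definition scat_A (R : realType) (tau : R) (q : R -> R[i]) (lam : R[i]) : R[i] :=
  det2 (m2m tau q 0 lam) (m1p tau q 0 lam).

Definition cderive (R : realType) (g : R[i] -> R[i]) (z : R[i]) : R[i] :=
  let K : numFieldType := R[i] in derive1 (g : K -> K) z.

(** [z_0, ..., z_(n-1)] are the (pairwise distinct) zeros of [g] in the open
    set [U], and all of them are simple. *)
Definition simple_zeros (R : realType) (U : set R[i]) (g : R[i] -> R[i])
    (n : nat) (z : 'I_n -> R[i]) : Prop :=
  [/\ injective z, [set w | U w /\ g w = 0] = range z &
      forall j, cderive g (z j) != 0].

Definition pair_p (R : realType) (tau : R) (q : R -> R[i])
    (f : R -> 'cV[R[i]]_2) (lam : R[i]) (s : R) : R[i] :=
  (row2 (- m1m tau q s lam 1 0) (m1m tau q s lam 0 0) *m f s) 0 0.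
Definition pair_m (R : realType) (tau : R) (q : R -> R[i])
    (f : R -> 'cV[R[i]]_2) (lam : R[i]) (s : R) : R[i] :=
  (row2 (m1p tau q s lam 1 0) (- m1p tau q s lam 0 0) *m f s) 0 0.

Definition c_p (R : realType) (tau : R) (q : R -> R[i])
    (f : R -> 'cV[R[i]]_2) (lam : R) : R[i] :=
  (scat_a tau q lam%:C)^-1 * cintegral setT (pair_p tau q f lam%:C).
Definition c_m (R : realType) (tau : R) (q : R -> R[i])
    (f : R -> 'cV[R[i]]_2) (lam : R) : R[i] :=
  - (scat_A tau q lam%:C)^-1 * cintegral setT (pair_m tau q f lam%:C).

(** [w_p] and [w_m] are used at zeros of [scat_a] and [scat_A]. *)
Definition w_p (R : realType) (tau : R) (q : R -> R[i])
    (f : R -> 'cV[R[i]]_2) (z : R[i]) (x : R) : 'cV[R[i]]_2 :=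
  ((cderive (scat_a tau q) z)^-1 * cintegral setT (pair_p tau q f z))
    *: m2p tau q x z.
Definition w_m (R : realType) (tau : R) (q : R -> R[i])
    (f : R -> 'cV[R[i]]_2) (z : R[i]) (x : R) : 'cV[R[i]]_2 :=
  ((cderive (scat_A tau q) z)^-1 * cintegral setT (pair_m tau q f z))
    *: m2m tau q x z.

Definition spectral_integrand (R : realType) (tau : R) (q : R -> R[i])
    (f : R -> 'cV[R[i]]_2) (x lam : R) : 'cV[R[i]]_2 :=
  c_p tau q f lam *: m2p tau q x lam%:C + c_m tau q f lam *: m2m tau q x lam%:C.

(* Main.v *)
Require Import Defs.
From HB Require Import structures.
From mathcomp Require Import all_boot all_order all_algebra.
From mathcomp Require Import complex.
From mathcomp Require Import all_classical all_reals all_analysis.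
From mathcomp Require Import measurable_realfun.
From mathcomp Require Import ring lra.

Set Implicit Arguments.
Unset Strict Implicit.
Unset Printing Implicit Defensive.

Import Order.TTheory GRing.Theory Num.Theory.
Import numFieldNormedType.Exports.

Local Open Scope classical_set_scope.
Local Open Scope ring_scope.
Local Open Scope complex_scope.

(** Let L(lam) = d/dx + i lam sigma3 - Q.  For Im lam > 0 the bounded solution r of
    L(lam) r = f is given by variation of constants with the solutions m_(1,-) and
    m_(2,+): it is a numerator ([green_num]) divided by their Wronskian a ([scat]).
    Exchanging the two entries and replacing lam by - lam turns the lower
    half-plane, m_(2,-), m_(1,+) and A into the upper half-plane with the potentials
    q and p = tau conj(q) exchanged, so that only the upper half-plane is studied.
    The expansion of f expresses three properties of this resolvent.

    At infinity, r(x; lam) = - i sigma3 f(x) / lam + O(1 / lam ^ 2), since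
    L(lam) (- i sigma3 f) = lam f + O(1) ([green_num_large]).

    It is analytic in the half-plane and regular up to the real line, except for
    simple poles at the zeros of a.  There m_(1,-) and m_(2,+) are proportional, and
    the residue of r is the function w_(j,+) of the statement ([green_num_zero]).
    After subtraction of the leading term - i sigma3 f(x) / (lam + i), Cauchy's
    theorem gives 2 pi i times the sum of the residues as the integral of r over the
    line ([upper_contribution]).

    On the real line the upper and the lower resolvents differ by
    c_+ m_(2,+) + c_- m_(2,-), because both solve L(lam) r = f ([jump_identity]).

    The two subtracted leading terms together contribute the integral over t of
    - i sigma3 f(x) (1 / (t + i) - 1 / (t - i)), which is - 2 pi sigma3 f(x)
    ([line_integral]).

    The Jost solutions are constructed by Picard iteration in a weighted sup norm
    with constants that do not depend on lam.  Analyticity up to the boundary is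
    replaced throughout by bounds on divided differences of order at most two
    ([dd_bounded]): these are stable under products, quotients and integrals, they
    follow for the Jost solutions from the same a priori bound as uniqueness, and they
    imply complex differentiability with a quadratic remainder, which suffices for
    Cauchy's theorem ([half_plane_cauchy]). *)

(** * Complex modulus and exponential *)

(** The norm of [R[i]] takes values in [R[i]]; estimates use its real part. *)
Definition cabs (R : realType) (z : R[i]) : R := complex.Re `|z|.

Section ComplexModulus.
Context {R : realType}.
Implicit Types z w : R[i].

Lemma cabsE z : `|z| = (cabs z)%:C.
Proof. by rewrite /cabs normc_def. Qed.

Lemma cabs_sqrt z :
  cabs z = Num.sqrt (complex.Re z ^+ 2 + complex.Im z ^+ 2).
Proof. by rewrite /cabs normc_def. Qed.

Lemma cabs_ge0 z : 0 <= cabs z.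
Proof. by rewrite cabs_sqrt sqrtr_ge0. Qed.

Lemma cabs_inj z (x : R) : `|z| = x%:C -> cabs z = x.
Proof. by rewrite cabsE => -[]. Qed.

Lemma cabs0 : cabs (0 : R[i]) = 0.
Proof. by apply: cabs_inj; rewrite normr0. Qed.

Lemma cabs1 : cabs (1 : R[i]) = 1.
Proof. by apply: cabs_inj; rewrite normr1. Qed.

Lemma cabsM z w : cabs (z * w) = cabs z * cabs w.
Proof. by apply: cabs_inj; rewrite normrM !cabsE rmorphM. Qed.

Lemma cabsV z : cabs z^-1 = (cabs z)^-1.
Proof. by apply: cabs_inj; rewrite normfV cabsE fmorphV. Qed.

Lemma cabsN z : cabs (- z) = cabs z.
Proof. by apply: cabs_inj; rewrite normrN cabsE. Qed.

Lemma cabsB z w : cabs (z - w) = cabs (w - z).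
Proof. by rewrite -cabsN opprB. Qed.

Lemma cabs_leD z w : cabs (z + w) <= cabs z + cabs w.
Proof. by have := ler_normD z w; rewrite !cabsE -rmorphD lecR. Qed.

Lemma cabs_leB z w : cabs (z - w) <= cabs z + cabs w.
Proof. by rewrite -(cabsN w) cabs_leD. Qed.

Lemma cabs_geB z w : cabs z - cabs w <= cabs (z - w).
Proof. by rewrite lerBlDr -{1}(subrK w z) cabs_leD. Qed.

Lemma cabs_eq0 z : (cabs z == 0) = (z == 0).
Proof.
by rewrite -(normr_eq0 z) cabsE; apply/eqP/eqP => [->|[]].
Qed.

Lemma cabs_gt0 z : (0 < cabs z) = (z != 0).
Proof. by rewrite lt_def cabs_ge0 andbT cabs_eq0. Qed.

Lemma cabs_real (x : R) : cabs x%:C = `|x|.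
Proof. by rewrite cabs_sqrt /= expr0n /= addr0 sqrtr_sqr. Qed.

Lemma cabs_i : cabs ('i%C : R[i]) = 1.
Proof. by rewrite cabs_sqrt /= expr0n /= add0r expr1n sqrtr1. Qed.

Lemma Re_le_cabs z : `|complex.Re z| <= cabs z.
Proof. by have := normc_ge_Re z; rewrite cabsE lecR. Qed.

Lemma Im_le_cabs z : `|complex.Im z| <= cabs z.
Proof.
by rewrite cabs_sqrt -sqrtr_sqr ler_sqrt ?lerDr ?addr_ge0 ?sqr_ge0.
Qed.

Lemma cabs_le_ReIm z : cabs z <= `|complex.Re z| + `|complex.Im z|.
Proof.
rewrite [z in cabs z]complexE; apply: le_trans (cabs_leD _ _) _.
by rewrite cabsM cabs_i mul1r !cabs_real.
Qed.

Lemma sqr_cabs z : cabs z ^+ 2 = complex.Re z ^+ 2 + complex.Im z ^+ 2.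
Proof. by rewrite cabs_sqrt sqr_sqrtr // addr_ge0 ?sqr_ge0. Qed.

Lemma ReD z w : complex.Re (z + w) = complex.Re z + complex.Re w.
Proof. by case: z; case: w. Qed.
Lemma ImD z w : complex.Im (z + w) = complex.Im z + complex.Im w.
Proof. by case: z; case: w. Qed.
Lemma ReN z : complex.Re (- z) = - complex.Re z.
Proof. by case: z. Qed.
Lemma ImN z : complex.Im (- z) = - complex.Im z.
Proof. by case: z. Qed.
Lemma ReM z w : complex.Re (z * w) =
  complex.Re z * complex.Re w - complex.Im z * complex.Im w.
Proof. by case: z; case: w. Qed.
Lemma ImM z w : complex.Im (z * w) =
  complex.Re z * complex.Im w + complex.Im z * complex.Re w.
Proof. by case: z => a b; case: w. Qed.
Definition ReImE := (ReD, ImD, ReN, ImN, ReM, ImM).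

Lemma complex_eq z w :
  complex.Re z = complex.Re w -> complex.Im z = complex.Im w -> z = w.
Proof. by case: z => a b; case: w => c d /= -> ->. Qed.

Lemma cexpD z w : cexp (z + w) = cexp z * cexp w.
Proof.
rewrite /cexp ReD ImD expRD cosD sinD; apply: complex_eq; rewrite !ReImE /=;
ring.
Qed.

Lemma cexp0 : cexp (0 : R[i]) = 1.
Proof.
by rewrite /cexp /= expR0 cos0 sin0; apply: complex_eq; rewrite !ReImE /=; ring.
Qed.

Lemma cabs_cexp z : cabs (cexp z) = expR (complex.Re z).
Proof.
rewrite /cexp cabsM cabs_real ger0_norm ?expR_ge0 // cabs_sqrt /=.
by rewrite cos2Dsin2 sqrtr1 mulr1.
Qed.

Lemma cexp_neq0 z : cexp z != 0.
Proof. by rewrite -cabs_gt0 cabs_cexp expR_gt0. Qed.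

Lemma Re_imul (lam : R[i]) (t : R) :
  complex.Re ('i%C * lam * t%:C) = - complex.Im lam * t.
Proof. by case: lam => a b /=; ring. Qed.

End ComplexModulus.

(** * Continuity and differentiation of complex functions of a real variable *)

Section RealVariable.
Context {R : realType}.
Implicit Types f g : R -> R[i].

Definition ccont f : Prop :=
  continuous (fun x => complex.Re (f x)) /\
  continuous (fun x => complex.Im (f x)).

Definition cder f (x : R) (d : R[i]) : Prop :=
  is_derive x 1 (fun y => complex.Re (f y)) (complex.Re d) /\
  is_derive x 1 (fun y => complex.Im (f y)) (complex.Im d).

Lemma ccont_cst (c : R[i]) : ccont (fun=> c).
Proof. by split => x; exact: cvg_cst. Qed.

Lemma ccontD f g : ccont f -> ccont g -> ccont (fun x => f x + g x).
Proof.
move=> [f1 f2] [g1 g2]; split => x.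
  rewrite (_ : (fun _ => _) = (fun x => complex.Re (f x)) \+ (fun x => complex.Re (g x))); last first.
    by apply/funext => y /=; rewrite ReImE.
  by apply: cvgD; [exact: f1|exact: g1].
rewrite (_ : (fun _ => _) = (fun x => complex.Im (f x)) \+ (fun x => complex.Im (g x))); last first.
  by apply/funext => y /=; rewrite ReImE.
by apply: cvgD; [exact: f2|exact: g2].
Qed.

Lemma ccontM f g : ccont f -> ccont g -> ccont (fun x => f x * g x).
Proof.
move=> [f1 f2] [g1 g2]; split => x.
  rewrite (_ : (fun _ => _) = (fun x => complex.Re (f x) * complex.Re (g x) - complex.Im (f x) * complex.Im (g x))); last first.
    by apply/funext => y /=; rewrite ReImE.
  by apply: cvgB; apply: cvgM; [exact: f1|exact: g1|exact: f2|exact: g2].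
rewrite (_ : (fun _ => _) = (fun x => complex.Re (f x) * complex.Im (g x) + complex.Im (f x) * complex.Re (g x))); last first.
  by apply/funext => y /=; rewrite ReImE.
by apply: cvgD; apply: cvgM; [exact: f1|exact: g2|exact: f2|exact: g1].
Qed.

Lemma ccontN f : ccont f -> ccont (fun x => - f x).
Proof.
move=> hf; rewrite (_ : (fun _ => _) = (fun x => (-1) * f x)); last first.
  by apply/funext => x; rewrite mulN1r.
by apply: ccontM => //; exact: ccont_cst.
Qed.

Lemma ccontB f g : ccont f -> ccont g -> ccont (fun x => f x - g x).
Proof. by move=> hf hg; apply: ccontD => //; exact: ccontN. Qed.

Lemma ccont_comp f (h : R -> R) :
  ccont f -> continuous h -> ccont (fun x => f (h x)).
Proof.
move=> [f1 f2] ch; split => x.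
  by apply: (@continuous_comp _ _ _ h (fun x => complex.Re (f x))); [exact: ch|exact: f1].
by apply: (@continuous_comp _ _ _ h (fun x => complex.Im (f x))); [exact: ch|exact: f2].
Qed.

Lemma ccontP f : ccont f <-> forall x (e : R), 0 < e ->
  exists2 d : R, 0 < d & forall y, `|y - x| < d -> cabs (f y - f x) < e.
Proof.
split=> [[f1 f2] x e e0|H].
  have e2 : 0 < e / 2 by lra.
  have /cvgrPdist_lt /(_ _ e2) [d1 /= d10 H1] := f1 x.
  have /cvgrPdist_lt /(_ _ e2) [d2 /= d20 H2] := f2 x.
  exists (Num.min d1 d2); first by rewrite lt_min d10 d20.
  move=> y; rewrite lt_min distrC => /andP[y1 y2].
  have := H1 y y1; have := H2 y y2.
  have := cabs_le_ReIm (f y - f x); rewrite !ReImE.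
  rewrite distrC (distrC (complex.Im (f y))).
  by move=> ? ? ?; lra.
split=> x; apply/cvgrPdist_lt => e e0; have [d d0 Hd] := H x _ e0;
  exists d => //= y /=; rewrite distrC => /(Hd y); apply: le_lt_trans.
  by have := Re_le_cabs (f y - f x); rewrite !ReImE distrC.
by have := Im_le_cabs (f y - f x); rewrite !ReImE distrC.
Qed.

Lemma cder_cst (c : R[i]) x : cder (fun=> c) x 0.
Proof. by split; exact: is_derive_cst. Qed.

Lemma cderD f g x df dg :
  cder f x df -> cder g x dg -> cder (fun y => f y + g y) x (df + dg).
Proof.
move=> [f1 f2] [g1 g2]; split; rewrite ReImE.
  rewrite (_ : (fun _ => _) = (fun x => complex.Re (f x)) + (fun x => complex.Re (g x))); last first.
    by apply/funext => y /=; rewrite ReImE.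
  exact: is_deriveD.
rewrite (_ : (fun _ => _) = (fun x => complex.Im (f x)) + (fun x => complex.Im (g x))); last first.
  by apply/funext => y /=; rewrite ReImE.
exact: is_deriveD.
Qed.

Lemma cderM f g x df dg :
  cder f x df -> cder g x dg -> cder (fun y => f y * g y) x (df * g x + f x * dg).
Proof.
move=> [f1 f2] [g1 g2]; split.
  rewrite (_ : (fun _ => _) = (fun x => complex.Re (f x)) * (fun x => complex.Re (g x)) - (fun x => complex.Im (f x)) * (fun x => complex.Im (g x))); last first.
    by apply/funext => y /=; rewrite ReImE.
  apply: is_derive_eq (is_deriveB (is_deriveM f1 g1) (is_deriveM f2 g2)) _.
  by rewrite !ReImE /GRing.scale /=; ring.
rewrite (_ : (fun _ => _) = (fun x => complex.Re (f x)) * (fun x => complex.Im (g x)) + (fun x => complex.Im (f x)) * (fun x => complex.Re (g x))); last first.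
  by apply/funext => y /=; rewrite ReImE.
apply: is_derive_eq (is_deriveD (is_deriveM f1 g2) (is_deriveM f2 g1)) _.
by rewrite !ReImE /GRing.scale /=; ring.
Qed.

Lemma cder_eq f x d d' : cder f x d -> d = d' -> cder f x d'.
Proof. by move=> h <-. Qed.

Lemma cderN f x d : cder f x d -> cder (fun y => - f y) x (- d).
Proof.
move=> h; rewrite (_ : (fun _ => _) = (fun y => (-1) * f y)); last first.
  by apply/funext => y; rewrite mulN1r.
by apply: cder_eq (cderM (cder_cst (-1) x) h) _; ring.
Qed.

Lemma cderB f g x df dg :
  cder f x df -> cder g x dg -> cder (fun y => f y - g y) x (df - dg).
Proof. by move=> hf hg; apply: cderD => //; exact: cderN. Qed.

Lemma cder_comp_real f (h : R -> R) (x dh : R) d :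
  is_derive x 1 h dh -> cder f (h x) d -> cder (fun y => f (h y)) x (dh%:C * d).
Proof.
move=> hh [f1 f2]; split.
  apply: is_derive_eq (is_derive1_comp f1 hh) _.
  by rewrite ReImE /=; ring.
apply: is_derive_eq (is_derive1_comp f2 hh) _.
by rewrite ReImE /=; ring.
Qed.

Lemma cder_cont f df : (forall x, cder f x (df x)) -> ccont f.
Proof.
move=> h; split=> x; apply: differentiable_continuous;
  apply/derivable1_diffP; have [f1 f2] := h x.
  exact: (@ex_derive _ _ _ _ _ _ _ f1).
exact: (@ex_derive _ _ _ _ _ _ _ f2).
Qed.

Lemma cder_real (h : R -> R) (x d : R) :
  is_derive x 1 h d -> cder (fun y => (h y)%:C) x d%:C.
Proof. by move=> hh; split => //=; exact: is_derive_cst. Qed.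

Lemma cder_cexp f x d : cder f x d -> cder (fun y => cexp (f y)) x (d * cexp (f x)).
Proof.
move=> [f1 f2]; pose E y : R[i] := (expR (complex.Re (f y)))%:C.
pose T y : R[i] := cos (complex.Im (f y)) +i* sin (complex.Im (f y)).
have dE : cder E x ((complex.Re d * expR (complex.Re (f x)))%:C).
  apply: cder_real; apply: is_derive_eq (is_derive1_comp (is_derive_expR _) f1) _.
  by rewrite mulrC.
have dT : cder T x ('i%C * (complex.Im d)%:C * T x).
  split; rewrite /T /=.
    apply: is_derive_eq (is_derive1_comp (is_derive_cos _) f2) _.
    by rewrite /=; ring.
  apply: is_derive_eq (is_derive1_comp (is_derive_sin _) f2) _.
  by rewrite /=; ring.
apply: cder_eq; first exact: (cderM dE dT).
rewrite /cexp -/(E x) -/(T x) {3}[d]complexE rmorphM /= -/(E x); ring.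
Qed.

Lemma cder0_cst f : (forall x, cder f x 0) -> forall x y, f x = f y.
Proof.
move=> h x y; apply: complex_eq.
  apply: (is_derive_0_is_cst (f := fun x => complex.Re (f x))) => z.
  by have [] := h z.
apply: (is_derive_0_is_cst (f := fun x => complex.Im (f x))) => z.
by have [] := h z.
Qed.

Lemma cder_id x : cder (fun y : R => y%:C) x 1.
Proof. exact: (@cder_real id x 1 (is_derive_id _ _)). Qed.

Lemma cder_cexp_lin (c : R[i]) x :
  cder (fun t => cexp (c * t%:C)) x (c * cexp (c * x%:C)).
Proof.
apply: cder_eq (cder_cexp (cderM (cder_cst c x) (cder_id x))) _.
by rewrite mul0r add0r mulr1.
Qed.

Lemma ccont_cexp_lin (c : R[i]) : ccont (fun t => cexp (c * t%:C)).
Proof. by apply: cder_cont => x; exact: cder_cexp_lin. Qed.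

Lemma ccont_real (h : R -> R) : continuous h -> ccont (fun x => (h x)%:C).
Proof. by move=> ch; split => x /=; [exact: ch|exact: cvg_cst]. Qed.

Lemma le_pow2 (y a b : R) : (forall n : nat, y <= a + b / 2 ^+ n) -> y <= a.
Proof.
move=> H; apply/ler_addgt0Pr => e e0.
have [b0|b0] := leP b 0.
  by apply: le_trans (H 0%N) _; rewrite expr0 divr1; lra.
have be : 0 < b / e by rewrite divr_gt0.
have hn := truncnS_gt (b / e); set n := (Num.truncn (b / e)).+1 in hn.
have n2 : n%:R <= 2 ^+ n :> R by rewrite -natrX ler_nat ltnW // ltn_expl.
apply: le_trans (H n) _; rewrite lerD2l ler_pdivrMr ?exprn_gt0 //.
by rewrite mulrC -ler_pdivrMr // (le_trans (ltW hn)).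
Qed.

Lemma geometric_cvg (a : nat -> R) (B : R) : 0 <= B ->
  (forall n, `|a n.+1 - a n| <= B / 2 ^+ n) ->
  exists l, forall n, `|a n - l| <= 2 * B / 2 ^+ n.
Proof.
move=> B0 H; pose b n := a n - 2 * B / 2 ^+ n; pose c n := a n + 2 * B / 2 ^+ n.
have half n : B / 2 ^+ n = 2 * (B / 2 ^+ n.+1).
  by rewrite exprS; field; rewrite expf_neq0.
have nb n : b n <= b n.+1.
  have := H n; rewrite ler_norml => /andP[h _]; rewrite /b -!mulrA.
  have := half n; lra.
have nc n : c n.+1 <= c n.
  have := H n; rewrite ler_norml => /andP[_ h]; rewrite /c -!mulrA.
  have := half n; lra.
have bc n : b n <= c n.
  rewrite /b /c; have : 0 <= 2 * B / 2 ^+ n by rewrite divr_ge0 ?exprn_ge0 ?mulr_ge0.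
  lra.
have mb := homo_leq (r := fun x y : R => x <= y) (@lexx _ _) (@le_trans _ _) nb.
have mc : {homo c : m n / (m <= n)%N >-> n <= m}.
  by apply: homo_leq => [//|x y z h1 h2|//]; exact: le_trans h2 h1.
have bcmn m n : b m <= c n.
  apply: (le_trans (mb _ _ (leq_maxl m n))); apply: (le_trans (bc _)).
  exact: mc (leq_maxr m n).
exists (sup (range b)) => n; rewrite ler_norml.
have h1 : b n <= sup (range b).
  apply: ub_le_sup; last by exists n.
  by exists (c 0%N) => _ [m _ <-]; exact: bcmn.
have h2 : sup (range b) <= c n.
  by apply: ge_sup; [exists (b 0%N); exists 0%N|move=> _ [m _ <-]; exact: bcmn].
by move: h1 h2; rewrite /b /c => h1 h2; apply/andP; split; lra.
Qed.

(** The rate is explicit, hence uniform in any parameter of the sequence. *)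
Lemma cgeometric_cvg (z : nat -> R[i]) (B : R) : 0 <= B ->
  (forall n, cabs (z n.+1 - z n) <= B / 2 ^+ n) ->
  exists l, forall n, cabs (z n - l) <= 4 * B / 2 ^+ n.
Proof.
move=> B0 H.
have [|a ha] := @geometric_cvg (fun n => complex.Re (z n)) B B0.
  by move=> n; apply: le_trans (H n); rewrite -ReN -ReD; exact: Re_le_cabs.
have [|b hb] := @geometric_cvg (fun n => complex.Im (z n)) B B0.
  by move=> n; apply: le_trans (H n); rewrite -ImN -ImD; exact: Im_le_cabs.
exists (Complex a b) => n; apply: le_trans (cabs_le_ReIm _) _.
rewrite !ReImE /=; have := ha n; have := hb n.
have -> : 4 * B / 2 ^+ n = 2 * B / 2 ^+ n + 2 * B / 2 ^+ n by ring.
by move=> h1 h2; exact: lerD.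
Qed.

End RealVariable.

(** * Lebesgue integrals of complex functions on the line *)

Section ComplexIntegral.
Context {R : realType}.
Notation mu := (@lebesgue_measure R).
Implicit Types (D : set (measurableTypeR R)) (F G : R -> R[i]).

Lemma eq_integrable_on D (f g : R -> \bar R) : measurable D ->
  mu.-integrable D f -> (forall x, D x -> f x = g x) -> mu.-integrable D g.
Proof.
by move=> mD ih fg; apply: eq_integrable ih => // x /set_mem; exact: fg.
Qed.

Lemma eq_cintegral D F G : (forall x, D x -> F x = G x) ->
  cintegral D F = cintegral D G.
Proof.
by move=> FG; congr Complex; apply: eq_Rintegral => x /set_mem Dx; rewrite FG.
Qed.

Lemma eq_cintegrable D F G : measurable D -> (forall x, D x -> F x = G x) ->
  cintegrable D F -> cintegrable D G.
Proof.
move=> mD FG [h1 h2]; split.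
  by apply: eq_integrable_on mD h1 _ => // x Dx; rewrite FG.
by apply: eq_integrable_on mD h2 _ => // x Dx; rewrite FG.
Qed.

Lemma cintegrableD D F G : measurable D -> cintegrable D F -> cintegrable D G ->
  cintegrable D (fun x => F x + G x).
Proof.
move=> mD [f1 f2] [g1 g2]; split.
  apply: eq_integrable_on mD (integrableD mD f1 g1) _ => // x _.
  by rewrite /= ReImE EFinD.
apply: eq_integrable_on mD (integrableD mD f2 g2) _ => // x _.
by rewrite /= ReImE EFinD.
Qed.

Lemma cintegralD D F G : measurable D -> cintegrable D F -> cintegrable D G ->
  cintegral D (fun x => F x + G x) = cintegral D F + cintegral D G.
Proof.
move=> mD [f1 f2] [g1 g2]; apply: complex_eq; rewrite ReImE /=.
  rewrite -RintegralD //; apply: eq_Rintegral => x _; by rewrite ReImE.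
rewrite -RintegralD //; apply: eq_Rintegral => x _; by rewrite ReImE.
Qed.

Lemma integrableZl_EFin D (k : R) (h : R -> R) : measurable D ->
  mu.-integrable D (fun x => (h x)%:E) ->
  mu.-integrable D (fun x => (k * h x)%:E).
Proof.
move=> mD hh; apply: eq_integrable_on mD (integrableZl mD k hh) _ => // x _.
Qed.

Lemma cintegrableZ D (c : R[i]) F : measurable D -> cintegrable D F ->
  cintegrable D (fun x => c * F x).
Proof.
move=> mD [f1 f2]; split.
  have h1 := integrableZl_EFin (complex.Re c) mD f1.
  have h2 := integrableZl_EFin (complex.Im c) mD f2.
  apply: eq_integrable_on mD (integrableB mD h1 h2) _ => // x _.
  by rewrite /= ReImE EFinB.
have h1 := integrableZl_EFin (complex.Re c) mD f2.
have h2 := integrableZl_EFin (complex.Im c) mD f1.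
apply: eq_integrable_on mD (integrableD mD h1 h2) _ => // x _.
by rewrite /= ReImE EFinD.
Qed.

Lemma cintegralZ D (c : R[i]) F : measurable D -> cintegrable D F ->
  cintegral D (fun x => c * F x) = c * cintegral D F.
Proof.
move=> mD [f1 f2]; apply: complex_eq; rewrite ReImE /=.
  under eq_Rintegral do rewrite ReImE.
  rewrite RintegralB //; try exact: integrableZl_EFin.
  by rewrite !RintegralZl.
under eq_Rintegral do rewrite ReImE.
rewrite RintegralD //; try exact: integrableZl_EFin.
by rewrite !RintegralZl.
Qed.

Lemma cintegrableN D F : measurable D -> cintegrable D F ->
  cintegrable D (fun x => - F x).
Proof.
move=> mD /(cintegrableZ (-1) mD); apply: eq_cintegrable => // x _.
by rewrite mulN1r.
Qed.

Lemma cintegralN D F : measurable D -> cintegrable D F ->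
  cintegral D (fun x => - F x) = - cintegral D F.
Proof.
move=> mD hF; rewrite -mulN1r -cintegralZ //.
by apply: eq_cintegral => x _; rewrite mulN1r.
Qed.

Lemma cintegrableB D F G : measurable D -> cintegrable D F -> cintegrable D G ->
  cintegrable D (fun x => F x - G x).
Proof. by move=> mD hF hG; apply: cintegrableD => //; exact: cintegrableN. Qed.

Lemma cintegralB D F G : measurable D -> cintegrable D F -> cintegrable D G ->
  cintegral D (fun x => F x - G x) = cintegral D F - cintegral D G.
Proof.
by move=> mD hF hG; rewrite cintegralD ?cintegralN //; exact: cintegrableN.
Qed.

Lemma cintegrable0 D : cintegrable D (fun=> 0 : R[i]).
Proof. by split; exact: integrable0. Qed.

Lemma cintegral0 D : cintegral D (fun=> 0 : R[i]) = 0.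
Proof. by rewrite /cintegral /Rintegral /= integral0. Qed.

Lemma cintegrable_sum D (n : nat) (F : 'I_n -> R -> R[i]) : measurable D ->
  (forall j, cintegrable D (F j)) ->
  cintegrable D (fun x => \sum_(j < n) F j x).
Proof.
move=> mD; elim: n F => [|n IH] F hF.
  by apply: eq_cintegrable (cintegrable0 D) => // x _; rewrite big_ord0.
have := cintegrableD mD (IH _ (fun j => hF (widen_ord (leqnSn n) j))) (hF ord_max).
by apply: eq_cintegrable => // x _; rewrite big_ord_recr.
Qed.

Lemma cintegral_sum D (n : nat) (F : 'I_n -> R -> R[i]) : measurable D ->
  (forall j, cintegrable D (F j)) ->
  cintegral D (fun x => \sum_(j < n) F j x) = \sum_(j < n) cintegral D (F j).
Proof.
move=> mD; elim: n F => [|n IH] F hF.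
  rewrite big_ord0 -[RHS](cintegral0 D).
  by apply: eq_cintegral => x _; rewrite big_ord0.
rewrite big_ord_recr /= -IH // -cintegralD //; last exact: cintegrable_sum.
by apply: eq_cintegral => x _; rewrite big_ord_recr.
Qed.

Lemma cintegrableS (E D : set (measurableTypeR R)) F : measurable E -> measurable D ->
  D `<=` E -> cintegrable E F -> cintegrable D F.
Proof.
by move=> mE mD DE [h1 h2]; split; [exact: integrableS h1|exact: integrableS h2].
Qed.

Definition cmeasurable D F : Prop :=
  measurable_fun D (fun x => complex.Re (F x)) /\
  measurable_fun D (fun x => complex.Im (F x)).

Lemma ccont_cmeasurable D F : measurable D -> ccont F -> cmeasurable D F.
Proof.
move=> mD [f1 f2]; split; apply: measurable_funTS;
  exact: continuous_measurable_fun.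
Qed.

Lemma cintegrable_dom D F (phi : R -> R) : measurable D -> cmeasurable D F ->
  mu.-integrable D (EFin \o phi) -> (forall x, D x -> cabs (F x) <= phi x) ->
  cintegrable D F.
Proof.
move=> mD [f1 f2] hphi H; split; apply: le_integrable hphi => //.
- exact/measurable_EFinP.
- move=> x Dx /=; rewrite lee_fin; apply: le_trans (ler_norm _).
  exact: le_trans (Re_le_cabs _) (H x Dx).
- exact/measurable_EFinP.
- move=> x Dx /=; rewrite lee_fin; apply: le_trans (ler_norm _).
  exact: le_trans (Im_le_cabs _) (H x Dx).
Qed.

(** The factor 2 comes from estimating real and imaginary parts separately. *)
Lemma cabs_cintegral_le D F (phi : R -> R) : measurable D -> cintegrable D F ->
  mu.-integrable D (EFin \o phi) -> (forall x, D x -> cabs (F x) <= phi x) ->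
  cabs (cintegral D F) <= 2 * \int[mu]_(x in D) phi x.
Proof.
move=> mD [f1 f2] hphi H; apply: le_trans (cabs_le_ReIm _) _ => /=.
have aux (h : R -> R) : mu.-integrable D (EFin \o h) ->
    (forall x, D x -> `|h x| <= phi x) ->
    `|\int[mu]_(x in D) h x| <= \int[mu]_(x in D) phi x.
  move=> ih Hh; apply: le_trans (le_normr_Rintegral mD ih) _.
  by apply: le_Rintegral => //; exact: integrable_norm.
have := aux _ f1 (fun x Dx => le_trans (Re_le_cabs _) (H x Dx)).
have := aux _ f2 (fun x Dx => le_trans (Im_le_cabs _) (H x Dx)).
by move=> h2 h1; rewrite mulr_natl mulr2n; exact: lerD.
Qed.

Definition Ny (x : R) : set (measurableTypeR R) := [set` `]-oo, x]].
Definition cy (x : R) : set (measurableTypeR R) := [set` `[x, +oo[].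

Lemma measurable_Ny x : measurable (Ny x). Proof. exact: measurable_itv. Qed.
Lemma measurable_cy x : measurable (cy x). Proof. exact: measurable_itv. Qed.
Hint Resolve measurable_Ny measurable_cy : core.

Lemma NyE x s : Ny x s <-> s <= x.
Proof. by rewrite /Ny /= in_itv. Qed.

Lemma cyE x s : cy x s <-> x <= s.
Proof. by rewrite /cy /= in_itv /= andbT. Qed.

Lemma Rintegral_split (h : R -> R) x : mu.-integrable setT (EFin \o h) ->
  \int[mu]_s h s = \int[mu]_(s in Ny x) h s + \int[mu]_(s in cy x) h s.
Proof.
move=> ih.
have iNy : mu.-integrable (Ny x) (EFin \o h) by apply: integrableS ih.
rewrite (_ : setT = [set` `]-oo, x[] `|` cy x); last first.
  apply/esym/seteqP; split => // s _; have [sx|xs] := ltP s x.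
    by left; rewrite /= in_itv.
  by right; apply/cyE.
rewrite Rintegral_setU //.
- by rewrite Rintegral_itv_bndo_bndc //; apply: integrableS ih.
- by apply: integrableS ih => //; apply: measurableU.
- apply/disj_setPS => s []; rewrite /= in_itv /= => sx /cyE xs.
  by move: (lt_le_trans sx xs); rewrite ltxx.
Qed.

Lemma cintegral_split F x : cintegrable setT F ->
  cintegral setT F = cintegral (Ny x) F + cintegral (cy x) F.
Proof.
move=> [f1 f2]; apply: complex_eq; rewrite ReImE /=; exact: Rintegral_split.
Qed.

Lemma opp_preimage_cy x : (-%R : R -> R) @^-1` (cy x) = Ny (- x).
Proof.
apply/seteqP; split => s /=.
  by move=> /cyE h; apply/NyE; rewrite lerNr.
by move=> /NyE h; apply/cyE; rewrite lerNr.
Qed.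

Section Reflection.
Variables (D D' : set (measurableTypeR R)).
Hypotheses (mD : measurable D) (mD' : measurable D').
Hypothesis DD' : (-%R : R -> R) @^-1` D = D'.

Let DN x : D' x <-> D (- x).
Proof. by rewrite -DD'. Qed.

Lemma integrable_reflect (h : R -> R) :
  mu.-integrable D (EFin \o h) -> mu.-integrable D' (EFin \o (fun x => h (- x))).
Proof.
move=> /integrableP [mh ih]; apply/integrableP; split.
  apply/measurable_EFinP.
  apply: (measurable_comp (F := D)) => //.
  - by move=> _ [s /DN hs <-].
  - by have /measurable_EFinP := mh.
move: ih; congr (_ < _)%E.
rewrite (_ : (\int[mu]_(x in D) `|(EFin \o h) x|)%E =
  (\int[pushforward mu (-%R : R -> measurableTypeR R)]_(x in D) `|(EFin \o h) x|)%E); last first.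
  by apply: eq_measure_integral => A mA _; exact/esym/lebesgue_measureN.
rewrite ge0_integral_pushforward ?DD' //.
by apply: measurableT_comp.
Qed.

Lemma Rintegral_reflect (h : R -> R) : mu.-integrable D (EFin \o h) ->
  \int[mu]_(x in D') h (- x) = \int[mu]_(x in D) h x.
Proof.
move=> ih; have ih' := integrable_reflect ih.
rewrite [RHS]Rintegral_mkcond /Rintegral; congr fine.
rewrite (_ : (\int[mu]_x (patch (fun=> 0) D h x)%:E)%E =
  (\int[pushforward mu (-%R : R -> measurableTypeR R)]_x (patch (fun=> 0) D h x)%:E)%E); last first.
  by apply: eq_measure_integral => A mA _; exact/esym/lebesgue_measureN.
have ihD : mu.-integrable setT (fun x => (patch (fun=> 0) D h x)%:E).
  have /integrable_mkcond : mu.-integrable D (EFin \o h) by [].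
  move=> /(_ mD); congr (mu.-integrable _ _); apply/funext => x.
  by rewrite restrict_EFin.
have mhD : measurable_fun setT (fun x => (patch (fun=> 0) D h x)%:E).
  exact: measurable_int ihD.
rewrite integral_pushforward //.
  rewrite preimage_setT [LHS]integral_mkcond; apply: eq_integral => x _.
  rewrite /= !patchE; case: ifPn => xD; case: ifPn => // xD'.
    by move: xD'; rewrite notin_setE; case; apply/DN/set_mem.
  by move: xD; rewrite notin_setE; case; apply/DN/set_mem.
rewrite preimage_setT.
have : mu.-integrable setT (((EFin \o (fun x => h (- x))) \_ D')).
  by apply/(integrable_mkcond _ mD').
congr (mu.-integrable _ _); apply/funext => x /=.
rewrite !patchE; case: ifPn => xD; case: ifPn => // xD'.
  by move: xD'; rewrite notin_setE; case; apply/DN/set_mem.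
by move: xD; rewrite notin_setE; case; apply/DN/set_mem.
Qed.

Lemma cintegrable_reflect F :
  cintegrable D F -> cintegrable D' (fun x => F (- x)).
Proof.
move=> [f1 f2]; split.
  exact: (integrable_reflect (h := fun x => complex.Re (F x))).
exact: (integrable_reflect (h := fun x => complex.Im (F x))).
Qed.

Lemma cintegral_reflect F : cintegrable D F ->
  cintegral D' (fun x => F (- x)) = cintegral D F.
Proof.
move=> [f1 f2]; apply: complex_eq => /=.
  exact: (Rintegral_reflect (h := fun x => complex.Re (F x))).
exact: (Rintegral_reflect (h := fun x => complex.Im (F x))).
Qed.

End Reflection.

Lemma opp_preimage_Ny x : (-%R : R -> R) @^-1` (Ny x) = cy (- x).
Proof.
apply/seteqP; split => s /=.
  by move=> /NyE h; apply/cyE; rewrite lerNl.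
by move=> /cyE h; apply/NyE; rewrite lerNl.
Qed.

Lemma is_derive_Rintegral_Ny (h : R -> R) (x : R) : continuous h ->
  (forall x, mu.-integrable (Ny x) (EFin \o h)) ->
  is_derive x 1 (fun y => \int[mu]_(s in Ny y) h s) (h x).
Proof.
move=> ch H; have xu : x < x + 1 by rewrite ltrDl.
have [d1 d2] := continuous_FTC1 xu (H (x + 1)) (ltNyr _) (ch x).
by apply: DeriveDef; [exact: d1|rewrite -derive1E; exact: d2].
Qed.

Lemma cder_cintegral_Ny F : ccont F -> (forall x, cintegrable (Ny x) F) ->
  forall x, cder (fun y => cintegral (Ny y) F) x (F x).
Proof.
move=> [f1 f2] H x; split => /=.
  by apply: is_derive_Rintegral_Ny => // y; have [] := H y.
by apply: is_derive_Rintegral_Ny => // y; have [] := H y.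
Qed.

(** An integrable weight with an explicit primitive, a multiple of which
    dominates the integrands met on half-lines. *)
Definition w (x : R) : R := (1 + x ^+ 2)^-1.

Lemma w_gt0 x : 0 < w x.
Proof. by rewrite /w invr_gt0; nra. Qed.

Lemma w_le1 x : w x <= 1.
Proof. by rewrite /w invf_le1; nra. Qed.

Lemma w_opp x : w (- x) = w x.
Proof. by rewrite /w sqrrN. Qed.

Lemma continuous_w : continuous w.
Proof. exact: continuous_oneDsqrV. Qed.

Lemma integrable_w : mu.-integrable setT (EFin \o w).
Proof.
apply/integrableP; split.
  by apply/measurable_EFinP; apply: continuous_measurable_fun; exact: continuous_w.
under eq_integral => x _ do rewrite /= ger0_norm ?(ltW (w_gt0 x)) //.
rewrite ge0_symfun_integralT //; last first.
- by move=> x /=; rewrite w_opp.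
- exact: continuous_w.
- by move=> x; exact/ltW/w_gt0.
by rewrite -set_itvcy integral0y_oneDsqr -EFinM ltry.
Qed.

Lemma integrable_Kw D (K : R) : measurable D ->
  mu.-integrable D (EFin \o (fun x => K * w x)).
Proof.
move=> mD; apply: integrableZl_EFin => //; exact: integrableS integrable_w.
Qed.

Lemma Rintegral_w_Ny x : \int[mu]_(s in Ny x) w s = atan x + pi / 2.
Proof.
have iw : mu.-integrable (cy (- x)) (EFin \o w) by exact: integrableS integrable_w.
have := Rintegral_reflect (measurable_cy _) (measurable_Ny _) (opp_preimage_cy _) iw.
rewrite opprK; under eq_Rintegral do rewrite w_opp.
move=> ->; rewrite /Rintegral (ge0_continuous_FTC2y _ _ (@cvgy_atan R)) /=.
- by rewrite atanN opprK addrC.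
- by move=> y _; exact/ltW/w_gt0.
- by apply: continuous_subspaceT; exact: continuous_w.
- by move=> y _; exact: derivable_atan.
- by apply: cvg_at_right_filter; exact: continuous_atan.
- by move=> y _; rewrite derive1_atan.
Qed.

Lemma atan_add_ge0 x : 0 <= atan x + pi / 2 :> R.
Proof. by have := atan_gtNpi2 x; lra. Qed.

Lemma atan_add_lepi x : atan x + pi / 2 <= pi :> R.
Proof. by have := atan_ltpi2 x; lra. Qed.

Lemma atan_add_small (e : R) : 0 < e ->
  exists X, forall x, x <= X -> atan x + pi / 2 < e.
Proof.
move=> e0; have /cvgrPdist_lt /(_ _ e0) [X [_ HX]] := @cvgy_atan R.
exists (- (X + 1)) => x hx; have := HX (- x).
have -> : X < - x by lra.
rewrite atanN opprK => /(_ isT); apply: le_lt_trans; rewrite addrC; exact: ler_norm.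
Qed.

Lemma cintegrable_w D F (K : R) : measurable D -> cmeasurable D F ->
  (forall x, D x -> cabs (F x) <= K * w x) -> cintegrable D F.
Proof.
by move=> mD mF H; apply: cintegrable_dom mF _ H => //; exact: integrable_Kw.
Qed.

Lemma cabs_cintegral_Ny F (K : R) x : cintegrable (Ny x) F ->
  (forall s, s <= x -> cabs (F s) <= K * w s) ->
  cabs (cintegral (Ny x) F) <= 2 * K * (atan x + pi / 2).
Proof.
move=> iF H; have := cabs_cintegral_le (measurable_Ny x) iF (integrable_Kw K (measurable_Ny x)).
rewrite RintegralZl ?Rintegral_w_Ny ?mulrA //; last exact: integrableS integrable_w.
by apply=> s /NyE; exact: H.
Qed.

Lemma cabs_cintegral_Ny_pi F (K : R) x : cintegrable (Ny x) F -> 0 <= K ->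
  (forall s, s <= x -> cabs (F s) <= K * w s) ->
  cabs (cintegral (Ny x) F) <= 2 * K * pi.
Proof.
move=> iF K0 H; apply: le_trans (cabs_cintegral_Ny iF H) _.
by rewrite ler_wpM2l ?mulr_ge0 // atan_add_lepi.
Qed.

(** Fundamental theorem on a half-line, for a primitive vanishing at -oo. *)
Lemma cintegral_Ny_cder (G G' : R -> R[i]) :
  (forall x, cder G x (G' x)) -> ccont G' ->
  (forall x, cintegrable (Ny x) G') ->
  (forall x, exists2 K', 0 <= K' & forall s, s <= x -> cabs (G' s) <= K' * w s) ->
  (forall e : R, 0 < e -> exists X, forall x, x <= X -> cabs (G x) <= e) ->
  forall x, cintegral (Ny x) G' = G x.
Proof.
move=> dG cG' iG' bG' lG x; apply/eqP; rewrite -subr_eq0 -cabs_eq0.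
pose H y := cintegral (Ny y) G' - G y.
have Hc y : H x = H y.
  apply: cder0_cst => z.
  by apply: cder_eq (cderB (cder_cintegral_Ny cG' iG' z) (dG z)) (subrr _).
rewrite -/(H x) eq_le cabs_ge0 andbT; apply/ler_addgt0Pr => e e0; rewrite add0r.
have [K' K0 HK] := bG' x.
have e2 : 0 < e / 2 by lra.
have d0 : 0 < e / 2 / (2 * K' + 1) by rewrite divr_gt0 //; lra.
have [X HX] := lG _ e2; have [Y HY] := atan_add_small d0.
pose z := Num.min x (Num.min X Y).
have zx : z <= x by rewrite ge_min lexx.
have zX : z <= X by rewrite !ge_min lexx orbT.
have zY : z <= Y by rewrite !ge_min lexx !orbT.
rewrite (Hc z); apply: le_trans (cabs_leB _ _) _.
have h1 := HX z zX.
have h2 : cabs (cintegral (Ny z) G') <= 2 * K' * (atan z + pi / 2).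
  by apply: cabs_cintegral_Ny => // s sz; apply: HK; exact: le_trans sz zx.
have h3 := HY z zY; have h4 := atan_add_ge0 z.
have : 2 * K' * (atan z + pi / 2) <= e / 2.
  apply: (@le_trans _ _ ((2 * K' + 1) * (e / 2 / (2 * K' + 1)))).
    by apply: ler_pM => //; [lra|lra|exact: ltW].
  by rewrite mulrC divfK //; lra.
by move=> ?; lra.
Qed.

End ComplexIntegral.
#[global] Hint Resolve measurable_Ny measurable_cy : core.

(** * Functions with bounded divided differences up to order two *)

Section DividedDifferences.
Context {R : realType}.
Implicit Types (Om : set R[i]) (F G : R[i] -> R[i]).

(** [dd2 F l m n] is the second divided difference multiplied by
    (m - l)(n - l)(m - n), which is a polynomial expression in the values. *)
Definition dd2 F (l m n : R[i]) : R[i] :=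
  (F m - F l) * (n - l) - (F n - F l) * (m - l).

(** The regularity class used for all functions of the spectral parameter.  It
    is stable under products, quotients and integrals depending on a parameter,
    passes to the closed half-plane, and yields complex differentiability with
    a quadratic remainder. *)
Definition dd_bounded Om (c : R) F : Prop :=
  [/\ forall l, Om l -> cabs (F l) <= c,
      forall l m, Om l -> Om m -> cabs (F m - F l) <= c * cabs (m - l) &
      forall l m n, Om l -> Om m -> Om n ->
        cabs (dd2 F l m n) <= c * (cabs (m - l) * cabs (n - l) * cabs (m - n))].

Lemma prod3_ge0 (x y z : R[i]) : 0 <= cabs x * cabs y * cabs z.
Proof. by rewrite !mulr_ge0 ?cabs_ge0. Qed.

Lemma dd_bounded_le Om c c' F : c <= c' -> dd_bounded Om c F -> dd_bounded Om c' F.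
Proof.
move=> cc [h0 h1 h2]; split=> [l hl|l m hl hm|l m n hl hm hn].
- exact: le_trans (h0 _ hl) cc.
- by apply: le_trans (h1 _ _ hl hm) _; rewrite ler_wpM2r ?cabs_ge0.
- by apply: le_trans (h2 _ _ _ hl hm hn) _; rewrite ler_wpM2r ?prod3_ge0.
Qed.

Lemma dd_boundedS Om Om' c F : Om' `<=` Om -> dd_bounded Om c F -> dd_bounded Om' c F.
Proof.
by move=> s [h0 h1 h2]; split=> [l /s|l m /s hl /s|l m n /s hl /s hm /s];
  [exact: h0|exact: h1|exact: h2].
Qed.

Lemma dd_bounded_cst Om (a : R[i]) : dd_bounded Om (cabs a) (fun=> a).
Proof.
split=> [l _|l m _ _|l m n _ _ _] //.
  by rewrite subrr cabs0 mulr_ge0 ?cabs_ge0.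
by rewrite /dd2 subrr !mul0r subrr cabs0 mulr_ge0 ?cabs_ge0 ?prod3_ge0.
Qed.

Lemma dd_boundedD Om c d F G : dd_bounded Om c F -> dd_bounded Om d G ->
  dd_bounded Om (c + d) (fun l => F l + G l).
Proof.
move=> [f0 f1 f2] [g0 g1 g2]; split=> [l hl|l m hl hm|l m n hl hm hn].
- by apply: le_trans (cabs_leD _ _) _; rewrite lerD ?f0 ?g0.
- rewrite (_ : _ - _ = (F m - F l) + (G m - G l)); last by ring.
  by apply: le_trans (cabs_leD _ _) _; rewrite mulrDl lerD ?f1 ?g1.
- rewrite (_ : dd2 _ _ _ _ = dd2 F l m n + dd2 G l m n); last by rewrite /dd2; ring.
  by apply: le_trans (cabs_leD _ _) _; rewrite mulrDl lerD ?f2 ?g2.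
Qed.

Lemma dd_boundedM Om c d F G : dd_bounded Om c F -> dd_bounded Om d G ->
  dd_bounded Om (3 * (c * d)) (fun l => F l * G l).
Proof.
move=> [f0 f1 f2] [g0 g1 g2].
have c0 l : Om l -> 0 <= c by move=> /f0; apply: le_trans; exact: cabs_ge0.
have d0 l : Om l -> 0 <= d by move=> /g0; apply: le_trans; exact: cabs_ge0.
split=> [l hl|l m hl hm|l m n hl hm hn].
- rewrite cabsM; have := ler_pM (cabs_ge0 _) (cabs_ge0 _) (f0 l hl) (g0 l hl).
  have := mulr_ge0 (c0 _ hl) (d0 _ hl); lra.
- rewrite (_ : _ - _ = (F m - F l) * G m + F l * (G m - G l)); last by ring.
  apply: le_trans (cabs_leD _ _) _; rewrite !cabsM.
  have := ler_pM (cabs_ge0 _) (cabs_ge0 _) (f1 _ _ hl hm) (g0 _ hm).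
  have := ler_pM (cabs_ge0 _) (cabs_ge0 _) (f0 _ hl) (g1 _ _ hl hm).
  have := mulr_ge0 (mulr_ge0 (c0 _ hl) (d0 _ hl)) (cabs_ge0 (m - l)); nra.
- rewrite (_ : dd2 _ _ _ _ = G l * dd2 F l m n + F n * dd2 G l m n
    + (F m - F n) * ((G m - G l) * (n - l))); last by rewrite /dd2; ring.
  apply: le_trans (cabs_leD _ _) _; apply: le_trans (lerD (cabs_leD _ _) (lexx _)) _.
  rewrite !cabsM; set P := _ * _ * cabs (m - n).
  have h1 := ler_pM (cabs_ge0 _) (cabs_ge0 _) (g0 _ hl) (f2 _ _ _ hl hm hn).
  have h2 := ler_pM (cabs_ge0 _) (cabs_ge0 _) (f0 _ hn) (g2 _ _ _ hl hm hn).
  have h3 := ler_pM (cabs_ge0 _) (mulr_ge0 (cabs_ge0 _) (cabs_ge0 (n - l)))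
    (f1 _ _ hn hm) (ler_wpM2r (cabs_ge0 (n - l)) (g1 _ _ hl hm)).
  have -> : 3 * (c * d) * P = d * (c * P) + c * (d * P) +
      c * cabs (m - n) * (d * cabs (m - l) * cabs (n - l)) by rewrite /P; ring.
  by apply: lerD h3; apply: lerD.
Qed.

Lemma dd_boundedN Om c F : dd_bounded Om c F -> dd_bounded Om c (fun l => - F l).
Proof.
move=> [f0 f1 f2]; split=> [l hl|l m hl hm|l m n hl hm hn].
- by rewrite cabsN f0.
- by rewrite -opprD cabsN f1.
- rewrite (_ : dd2 _ _ _ _ = - dd2 F l m n); last by rewrite /dd2; ring.
  by rewrite cabsN f2.
Qed.

Lemma dd_boundedB Om c d F G : dd_bounded Om c F -> dd_bounded Om d G ->
  dd_bounded Om (c + d) (fun l => F l - G l).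
Proof. by move=> hF hG; apply: dd_boundedD => //; exact: dd_boundedN. Qed.

(** The second divided difference of 1 / F is a polynomial in the differences of
    F divided by the product of three values of F, whence the power of e. *)
Lemma dd_boundedV Om c (e : R) F : 0 < e -> e <= 1 -> 1 <= c ->
  (forall l, Om l -> e <= cabs (F l)) -> dd_bounded Om c F ->
  dd_bounded Om (2 * c ^+ 2 / e ^+ 3) (fun l => (F l)^-1).
Proof.
move=> e0 e1 c1 He [f0 f1 f2].
have Fn l : Om l -> F l != 0.
  by move=> /He h; rewrite -cabs_gt0; exact: lt_le_trans h.
have Vb l : Om l -> cabs (F l)^-1 <= e^-1.
  by move=> hl; rewrite cabsV lef_pV2 ?posrE ?He // cabs_gt0 Fn.
have ei : 1 <= e^-1 by rewrite invf_ge1.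
have ei0 : 0 <= e^-1 by lra.
rewrite -exprVn; set k := e^-1 in Vb ei ei0 *.
have k2 : k <= k ^+ 2 by rewrite expr2; nra.
have k3 : k ^+ 2 <= k ^+ 3 by rewrite exprS; nra.
have cc : c <= c ^+ 2 by rewrite expr2; nra.
have k30 : 0 <= k ^+ 3 by rewrite exprn_ge0.
have k31 : 1 <= k ^+ 3 by lra.
split=> [l hl|l m hl hm|l m n hl hm hn].
- by apply: le_trans (Vb l hl) _; nra.
- rewrite (_ : _ - _ = - ((F l)^-1 * (F m)^-1 * (F m - F l))); last first.
    by field; rewrite !Fn.
  rewrite cabsN !cabsM.
  apply: le_trans (ler_pM _ (cabs_ge0 _) (ler_pM (cabs_ge0 _) (cabs_ge0 _) (Vb _ hl) (Vb _ hm)) (f1 _ _ hl hm)) _.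
    by rewrite mulr_ge0 ?cabs_ge0.
  rewrite mulrA ler_wpM2r ?cabs_ge0 // -expr2.
  have : k ^+ 2 * c <= k ^+ 3 * c by rewrite ler_wpM2r //; lra.
  nra.
- rewrite (_ : dd2 _ _ _ _ = - ((F l)^-1 * (F m)^-1 * (F n)^-1 *
     (F n * dd2 F l m n + (F n - F l) * (m - l) * (F n - F m)))); last first.
    by rewrite /dd2; field; rewrite !Fn.
  rewrite cabsN cabsM; set P := _ * _ * cabs (m - n).
  have P0 : 0 <= P by exact: prod3_ge0.
  have h1 : cabs ((F l)^-1 * (F m)^-1 * (F n)^-1) <= k ^+ 3.
    rewrite !cabsM !exprS expr0 mulr1 mulrA.
    by rewrite !ler_pM ?mulr_ge0 ?cabs_ge0 ?Vb.
  have h2 : cabs (F n * dd2 F l m n + (F n - F l) * (m - l) * (F n - F m))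
      <= 2 * c ^+ 2 * P.
    apply: le_trans (cabs_leD _ _) _; rewrite !cabsM.
    have h3 := ler_pM (cabs_ge0 _) (cabs_ge0 _) (f0 _ hn) (f2 _ _ _ hl hm hn).
    have h4 := ler_pM (mulr_ge0 (cabs_ge0 _) (cabs_ge0 (m - l))) (cabs_ge0 _)
      (ler_wpM2r (cabs_ge0 (m - l)) (f1 _ _ hl hn)) (f1 _ _ hm hn).
    rewrite (_ : 2 * c ^+ 2 * P = c * (c * P) +
      c * cabs (n - l) * cabs (m - l) * (c * cabs (n - m))).
      exact: lerD.
    by rewrite (cabsB n m) /P; ring.
  apply: le_trans (ler_pM (cabs_ge0 _) (cabs_ge0 _) h1 h2) _.
  by rewrite le_eqVlt; apply/orP; left; apply/eqP; ring.
Qed.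

(** Divided differences commute with the integral, so that no differentiation
    under the integral sign is needed. *)
Lemma dd_bounded_cintegral Om (K x : R) (F : R -> R[i] -> R[i]) : 0 <= K ->
  (forall l, Om l -> cintegrable (Ny x) (F ^~ l)) ->
  (forall s, s <= x -> dd_bounded Om (K * w s) (F s)) ->
  dd_bounded Om (2 * K * pi) (fun l => cintegral (Ny x) (F ^~ l)).
Proof.
move=> K0 iF H; split=> [l hl|l m hl hm|l m n hl hm hn].
- apply: cabs_cintegral_Ny_pi => //; first exact: iF.
  by move=> s /H [h _ _]; exact: h.
- rewrite -cintegralB //; [|exact: iF..].
  rewrite -mulrA mulrAC mulrA; apply: (le_trans (cabs_cintegral_Ny_pi (K := K * cabs (m - l)) _ _ _)) => //.
  + by apply: cintegrableB => //; exact: iF.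
  + by rewrite mulr_ge0 ?cabs_ge0.
  + move=> s /H [_ h _]; apply: le_trans (h _ _ hl hm) _.
    by rewrite mulrAC.
  + by rewrite le_eqVlt; apply/orP; left; apply/eqP; ring.
- set P := _ * _ * cabs (m - n).
  have e (F1 F2 : R -> R[i]) : cintegrable (Ny x) F1 -> cintegrable (Ny x) F2 ->
    (cintegral (Ny x) F1 - cintegral (Ny x) F2) = cintegral (Ny x) (fun s => F1 s - F2 s).
    by move=> ? ?; rewrite cintegralB.
  have im := cintegrableB (measurable_Ny x) (iF m hm) (iF l hl).
  have jn := cintegrableB (measurable_Ny x) (iF n hn) (iF l hl).
  have -> : dd2 (fun l => cintegral (Ny x) (F ^~ l)) l m n =
     cintegral (Ny x) (fun s => dd2 (F s) l m n).
    rewrite /dd2 !e //; try exact: iF.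
    rewrite mulrC -cintegralZ // [X in _ - X]mulrC -cintegralZ // e //; try exact: cintegrableZ.
    by apply: eq_cintegral => s _; ring.
  apply: (le_trans (cabs_cintegral_Ny_pi (K := K * P) _ _ _)) => //.
  + have := cintegrableB (measurable_Ny x) (cintegrableZ (n - l) (measurable_Ny x) im)
      (cintegrableZ (m - l) (measurable_Ny x) jn).
    by apply: eq_cintegrable => // s _; rewrite /dd2; ring.
  + by rewrite mulr_ge0 ?prod3_ge0.
  + move=> s /H [_ _ h]; apply: le_trans (h _ _ _ hl hm hn) _.
    by rewrite mulrAC.
  + by rewrite le_eqVlt; apply/orP; left; apply/eqP; ring.
Qed.

End DividedDifferences.

Definition upper (R : realType) : set R[i] := [set z | 0 <= complex.Im z].
Arguments upper R : clear implicits.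

(** The only exponential of the theory, bounded by 1 for t >= 0 and lam in the
    closed upper half-plane; it is opaque, and used through its exponential law. *)
HB.lock Definition osc (R : realType) (t : R) (lam : R[i]) : R[i] :=
  cexp ('i%C * lam * t%:C).

Section Exponential.
Context {R : realType}.
Implicit Types lam : R[i].

(** The mean value inequality, applied to real and imaginary parts. *)
Lemma cabs_mean_value (f df : R -> R[i]) (B : R) :
  (forall t, cder f t (df t)) ->
  (forall t, 0 <= t <= 1 -> cabs (df t) <= B) -> cabs (f 1 - f 0) <= 2 * B.
Proof.
move=> H Hb; apply: le_trans (cabs_le_ReIm _) _; rewrite !ReImE.
have [c1 c2] := cder_cont H.
have aux (h dh : R -> R) : (forall t : R, is_derive t 1 h (dh t)) -> continuous h ->
    (forall t, 0 <= t <= 1 -> `|dh t| <= B) -> `|h 1 - h 0| <= B.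
  move=> d ch b; have [|c cI ->] := @MVT _ h dh 0 1 ltr01 (fun t _ => d t).
    exact: continuous_subspaceT.
  by rewrite subr0 mulr1; apply: b; move: cI; rewrite in_itv /= => /andP[/ltW -> /ltW].
have := aux _ _ (fun t => proj1 (H t)) c1 (fun t ht => le_trans (Re_le_cabs _) (Hb t ht)).
have := aux _ _ (fun t => proj2 (H t)) c2 (fun t ht => le_trans (Im_le_cabs _) (Hb t ht)).
by move=> h2 h1; rewrite mulr_natl mulr2n; exact: lerD.
Qed.

Lemma oscE (t : R) lam : osc t lam = cexp ('i%C * lam * t%:C).
Proof. by rewrite osc.unlock. Qed.

Lemma cabs_osc (t : R) lam : 0 <= t -> upper R lam -> cabs (osc t lam) <= 1.
Proof.
move=> t0 hl; rewrite !oscE cabs_cexp Re_imul -expR0 ler_expR.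
by rewrite mulNr oppr_le0 mulr_ge0.
Qed.

Lemma osc_real (t x : R) : cabs (osc t x%:C) = 1.
Proof. by rewrite !oscE cabs_cexp Re_imul /= oppr0 mul0r expR0. Qed.

Lemma oscD (s t : R) lam : osc (s + t) lam = osc s lam * osc t lam.
Proof. by rewrite !oscE -cexpD rmorphD /= mulrDr. Qed.

Lemma osc0 lam : osc 0 lam = 1.
Proof. by rewrite !oscE mulr0 cexp0. Qed.

Lemma osc_neq0 (t : R) lam : osc t lam != 0. Proof. by rewrite oscE cexp_neq0. Qed.

Lemma cder_osc_segment (t s : R) (l z : R[i]) :
  cder (fun r : R => osc t (l + r%:C * z)) s ('i%C * z * t%:C * osc t (l + s%:C * z)).
Proof.
rewrite oscE (_ : (fun r : R => _) = fun r : R => cexp ('i%C * (l + r%:C * z) * t%:C)); last first.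
  by apply/funext => r; rewrite oscE.
apply: cder_eq.
  apply: cder_cexp; apply: cderM (cder_cst _ _).
  apply: cderM (cder_cst _ _) _; apply: cderD (cder_cst _ _) _.
  exact: cderM (cder_id _) (cder_cst _ _).
by rewrite /=; ring.
Qed.

Lemma upper_segment (l m : R[i]) (s : R) : 0 <= s <= 1 ->
  upper R l -> upper R m -> upper R (l + s%:C * (m - l)).
Proof.
rewrite /upper /= => /andP[s0 s1] hl hm; rewrite !ReImE /=; nra.
Qed.

(** The second derivative in lam is of size t ^ 2, and the closed half-plane is
    convex: the mean value inequality along segments bounds both differences. *)
Lemma dd_bounded_osc (t : R) : 0 <= t -> dd_bounded (upper R) (4 * (1 + t ^+ 2)) (osc t).
Proof.
move=> t0.
have L l m : upper R l -> upper R m -> cabs (osc t m - osc t l) <= 2 * t * cabs (m - l).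
  move=> hl hm.
  have := @cabs_mean_value _ _ (t * cabs (m - l))
    (fun s => cder_osc_segment t s l (m - l)).
  rewrite mul1r mul0r addr0 subrKC mulrA; apply=> s hs.
  rewrite !cabsM cabs_i mul1r cabs_real (ger0_norm t0).
  rewrite [leRHS]mulrC -[leRHS]mulr1 ler_wpM2l ?mulr_ge0 ?cabs_ge0 //.
  exact: (cabs_osc t0 (upper_segment hs hl hm)).
split=> [l hl|l m hl hm|l m n hl hm hn].
- by apply: le_trans (cabs_osc t0 hl) _; nra.
- apply: le_trans (L _ _ hl hm) _; rewrite ler_wpM2r ?cabs_ge0 //; nra.
- pose psi s := osc t (l + s%:C * (m - l)) * (n - l) - osc t (l + s%:C * (n - l)) * (m - l).
  set P := _ * _ * cabs (m - n).
  have -> : dd2 (osc t) l m n = psi 1 - psi 0.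
    by rewrite /psi /dd2 !mul1r !mul0r !addr0 !subrKC; ring.
  have dpsi s : cder psi s ('i%C * t%:C * (m - l) * (n - l) *
      (osc t (l + s%:C * (m - l)) - osc t (l + s%:C * (n - l)))).
    apply: cder_eq (cderB (cderM (cder_osc_segment _ _ _ _) (cder_cst _ _))
      (cderM (cder_osc_segment _ _ _ _) (cder_cst _ _))) _.
    by ring.
  apply: le_trans (@cabs_mean_value _ _ (2 * t ^+ 2 * P) dpsi _) _; last first.
    rewrite mulrA ler_wpM2r ?prod3_ge0 //; nra.
  move=> s hs; rewrite !cabsM cabs_i mul1r cabs_real (ger0_norm t0).
  have h1 := L _ _ (upper_segment hs hl hn) (upper_segment hs hl hm).
  have e1 : l + s%:C * (m - l) - (l + s%:C * (n - l)) = s%:C * (m - n) by ring.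
  move: h1; rewrite e1 cabsM cabs_real => h1.
  have h2 : `|s| * cabs (m - n) <= cabs (m - n).
    case/andP: hs => s0 s1; rewrite ger0_norm //.
    by rewrite -[leRHS]mul1r ler_wpM2r ?cabs_ge0.
  have h3 := le_trans h1 (ler_wpM2l (mulr_ge0 (ler0n R 2) t0) h2).
  have := ler_wpM2l (mulr_ge0 (mulr_ge0 t0 (cabs_ge0 (m - l))) (cabs_ge0 (n - l))) h3.
  move/le_trans; apply.
  by rewrite le_eqVlt; apply/orP; left; apply/eqP; rewrite /P; ring.
Qed.

End Exponential.

(** * The Volterra system of the left Jost solution *)

Section Volterra.
Context {R : realType}.
Notation mu := (@lebesgue_measure R).
Implicit Types (lam : R[i]) (u v : R -> R[i]).

(** Two powers of the weight: one makes the integrals converge, the other absorbs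
    the quadratic growth in s of the divided differences of the exponentials. *)
Definition decays (g : R -> R[i]) (M : R) : Prop :=
  forall s, cabs (g s) <= M * w s ^+ 2.

(** The system u' = q v, v' = 2 i lam v + p u integrated from -oo, with forcing
    terms h1 and h2; constant forcing terms 1 and 0 give the Jost solution. *)
Definition volterra_at (q p : R -> R[i]) lam (h1 h2 : R -> R[i]) u v (x : R) : Prop :=
  [/\ cintegrable (Ny x) (fun s => q s * v s),
      cintegrable (Ny x) (fun s => p s * (osc (2 * (x - s)) lam * u s)),
      u x = h1 x + cintegral (Ny x) (fun s => q s * v s) &
      v x = h2 x + cintegral (Ny x) (fun s => p s * (osc (2 * (x - s)) lam * u s))].

Definition left_jost (q p : R -> R[i]) lam u v : Prop :=
  (exists B : R, forall x, cabs (u x) <= B /\ cabs (v x) <= B) /\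
  forall x, volterra_at q p lam (fun=> 1) (fun=> 0) u v x.

Variables (q p : R -> R[i]) (M : R).
Hypotheses (cq : ccont q) (cp : ccont p) (dq : decays q M) (dp : decays p M).

Lemma decays_ge0 g N : decays g N -> 0 <= N.
Proof.
by move=> /(_ 0) h; move: (le_trans (cabs_ge0 _) h); rewrite pmulr_lge0 // exprn_gt0 ?w_gt0.
Qed.

Let M0 : 0 <= M. Proof. exact: decays_ge0 dq. Qed.

Lemma decays_w g N s : decays g N -> cabs (g s) <= N * w s.
Proof.
move=> dg; apply: le_trans (dg s) _; rewrite ler_wpM2l ?(decays_ge0 dg) //.
have := w_gt0 s; have := w_le1 s; rewrite expr2; nra.
Qed.

(** The exponential weight for which the Volterra operator is a contraction
    with factor 1/2, uniformly in the spectral parameter. *)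
Definition theta (x : R) : R := expR (4 * M * atan x).
Let tM : R := expR (2 * M * pi).

Lemma tM_ge1 : 1 <= tM.
Proof. by rewrite -expR0 ler_expR !mulr_ge0 ?pi_ge0. Qed.

Lemma theta_gt0 x : 0 < theta x. Proof. exact: expR_gt0. Qed.

Lemma theta_le x : theta x <= tM.
Proof. rewrite ler_expR; have := atan_ltpi2 x; have := M0; nra. Qed.

Lemma theta_ge x : tM^-1 <= theta x.
Proof. rewrite -expRN ler_expR; have := atan_gtNpi2 x; have := M0; nra. Qed.

Lemma theta_ge1 x : 1 <= tM * theta x.
Proof. by rewrite -ler_pdivrMl ?(lt_le_trans ltr01 tM_ge1) // mulr1 theta_ge. Qed.

Lemma is_derive_theta (x : R) : is_derive x 1 theta (4 * M * w x * theta x).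
Proof.
have da : is_derive x 1 (@atan R) (w x).
  by apply: DeriveDef; [exact: derivable_atan|rewrite -derive1E derive1_atan].
have := is_derive1_comp (f := expR) (g := (4 * M) \*: (@atan R))
  (is_derive_expR _) (is_deriveZ (4 * M) da).
by move=> h; apply: is_derive_eq h _; rewrite /GRing.scale /= mulrC.
Qed.

Lemma continuous_theta : continuous theta.
Proof.
move=> x; apply: differentiable_continuous; apply/derivable1_diffP.
exact: (@ex_derive _ _ _ _ _ _ _ (is_derive_theta x)).
Qed.

Lemma weight_integral x : \int[mu]_(s in Ny x) (4 * M * w s * theta s) <= theta x.
Proof.
pose G y : R[i] := (theta y - tM^-1)%:C.
pose G' y : R[i] := (4 * M * w y * theta y)%:C.
have cG' : ccont G'.
  apply: ccont_real => y; apply: cvgM; last exact: continuous_theta.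
  by apply: cvgM; [exact: cvg_cst|exact: continuous_w].
have bG' s : cabs (G' s) <= 4 * M * tM * w s.
  have w0 := ltW (w_gt0 s); have h0 := ltW (theta_gt0 s).
  rewrite cabs_real ger0_norm ?(mulr_ge0, w0, h0) //.
  by rewrite [leRHS]mulrAC ler_wpM2l ?theta_le // ?(mulr_ge0, w0).
have iG' y : cintegrable (Ny y) G'.
  by apply: (cintegrable_w (K := 4 * M * tM)) => //; exact: ccont_cmeasurable.
have : cintegral (Ny x) G' = G x; last first.
  move=> /(congr1 (@complex.Re R)) /= ->; rewrite gerBl invr_ge0.
  exact: expR_ge0.
apply: (cintegral_Ny_cder (G := G) _ cG' iG').
- move=> y; apply: cder_real.
  rewrite -[X in is_derive _ _ _ X]subr0.
  by apply: is_deriveB (is_derive_theta y) (is_derive_cst _ _ _).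
- move=> y; exists (4 * M * tM); last by move=> s _; exact: bG'.
  by rewrite !mulr_ge0 // (le_trans ler01 tM_ge1).
- have m0 : 0 <= M by exact: M0.
  move=> e e0.
  have /cvgrPdist_lt /(_ _ e0) [d /= d0 Hd] := @continuous_expR R (- (2 * M * pi)).
  have dd : 0 < d / (4 * M + 1) by rewrite divr_gt0 //; lra.
  have [X HX] := atan_add_small dd.
  exists X => y yX; rewrite cabs_real -expRN distrC; apply/ltW/Hd => /=.
  have h := HX y yX; have h0 := atan_add_ge0 y.
  rewrite (_ : _ - _ = - (4 * M * (atan y + pi / 2))); last by field.
  rewrite normrN ger0_norm ?mulr_ge0 //.
  move: h; rewrite ltr_pdivlMr; last lra.
  by move=> h; nra.
Qed.

Lemma cabs_cintegral_theta F (B x : R) : cintegrable (Ny x) F -> 0 <= B ->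
  (forall s, s <= x -> cabs (F s) <= M * w s * (B * theta s)) ->
  cabs (cintegral (Ny x) F) <= B / 2 * theta x.
Proof.
move=> iF B0 H.
have it : mu.-integrable (Ny x) (EFin \o (fun s => 4 * M * w s * theta s)).
  apply: le_integrable (integrable_Kw (4 * M * tM) (measurable_Ny x)) => //.
  - apply/measurable_EFinP; apply: measurable_funTS.
    apply: continuous_measurable_fun => y; apply: cvgM; last exact: continuous_theta.
    by apply: cvgM; [exact: cvg_cst|exact: continuous_w].
  - move=> s _ /=; have w0 := ltW (w_gt0 s); have h0 := ltW (theta_gt0 s).
    have t0 : 0 <= tM := le_trans ler01 tM_ge1.
    rewrite lee_fin !ger0_norm ?(mulr_ge0, w0, h0) //.
    by rewrite [leRHS]mulrAC ler_wpM2l ?theta_le // ?(mulr_ge0, w0).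
have := cabs_cintegral_le (measurable_Ny x) iF
  (phi := fun s => B / 4 * (4 * M * w s * theta s)).
have := weight_integral x; rewrite RintegralZl // => hw h.
apply: (le_trans (h _ _)).
- exact: integrableZl_EFin.
- move=> s /NyE /H /le_trans; apply.
  by rewrite le_eqVlt; apply/orP; left; apply/eqP; field.
- nra.
Qed.

Let C0 : R := 2 * tM ^+ 2.

(** The a priori bound of the Volterra system.  The constant depends neither on
    the spectral parameter nor on the previously known bound B of the solution,
    whose effect is halved at each iteration. *)
Lemma volterra_apriori lam (X : R) (h1 h2 : R -> R[i]) u v (H B : R) : upper R lam ->
  (forall x, x <= X -> volterra_at q p lam h1 h2 u v x) ->
  (forall x, x <= X -> cabs (u x) <= B /\ cabs (v x) <= B) ->
  (forall x, x <= X -> cabs (h1 x) <= H /\ cabs (h2 x) <= H) ->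
  forall x, x <= X -> cabs (u x) <= C0 * H /\ cabs (v x) <= C0 * H.
Proof.
move=> hl V bB bH.
have t1 := tM_ge1; have t0 : 0 < tM by lra.
pose H' := H * tM; pose B' := B * tM.
have H0 x : x <= X -> 0 <= H by move=> /bH [h _]; exact: le_trans (cabs_ge0 _) h.
have B0 x : x <= X -> 0 <= B by move=> /bB [h _]; exact: le_trans (cabs_ge0 _) h.
have claim n x : x <= X -> cabs (u x) <= (2 * H' + B' / 2 ^+ n) * theta x /\
    cabs (v x) <= (2 * H' + B' / 2 ^+ n) * theta x.
  elim: n x => [|n IH] x xX.
    have Hp := H0 _ xX; have Bp := B0 _ xX; have [h3 h4] := bB _ xX.
    have ht := theta_ge1 x.
    have : B <= (2 * H' + B' / 2 ^+ 0) * theta x.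
      rewrite expr0 divr1 /H' /B' mulrDl.
      have hth := ltW (theta_gt0 x); have t00 := ltW t0.
      have : 0 <= 2 * (H * tM) * theta x by rewrite !mulr_ge0.
      by have := ler_wpM2l Bp ht; rewrite mulr1 mulrA; lra.
    by move=> h; split; [exact: le_trans h3 h|exact: le_trans h4 h].
  have Hp := H0 _ xX; have Bp := B0 _ xX.
  have K0 : 0 <= 2 * H' + B' / 2 ^+ n.
    by rewrite addr_ge0 // ?divr_ge0 ?exprn_ge0 ?mulr_ge0 // ltW.
  have [i1 i2 e1 e2] := V x xX; have [g1 g2] := bH x xX.
  have Ht : H <= H' * theta x.
    by rewrite /H' -mulrA -[leLHS]mulr1 ler_wpM2l // theta_ge1.
  have split2 : (2 * H' + B' / 2 ^+ n.+1) * theta x =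
      H' * theta x + (2 * H' + B' / 2 ^+ n) / 2 * theta x.
    by rewrite exprS; field; rewrite expf_neq0.
  rewrite split2; split.
  - rewrite e1; apply: le_trans (cabs_leD _ _) _; apply: lerD; first exact: le_trans g1 Ht.
    apply: cabs_cintegral_theta => // s sx; rewrite cabsM.
    apply: ler_pM (cabs_ge0 _) (cabs_ge0 _) (decays_w s dq) _.
    by have [] := IH s (le_trans sx xX).
  - rewrite e2; apply: le_trans (cabs_leD _ _) _; apply: lerD; first exact: le_trans g2 Ht.
    apply: cabs_cintegral_theta => // s sx; rewrite cabsM.
    apply: ler_pM (cabs_ge0 _) (cabs_ge0 _) (decays_w s dp) _.
    rewrite cabsM; have [h _] := IH s (le_trans sx xX); apply: le_trans h.
    rewrite -[leRHS]mul1r ler_wpM2r ?cabs_ge0 // cabs_osc //.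
    by rewrite mulr_ge0 // subr_ge0.
move=> x xX; have Hp := H0 _ xX.
have fin (y : R) : (forall n : nat, y <= (2 * H' + B' / 2 ^+ n) * theta x) -> y <= C0 * H.
  move=> h; apply: (@le_trans _ _ (2 * H' * theta x)).
    apply: (@le_pow2 _ _ _ (B' * theta x)) => n; apply: le_trans (h n) _.
    by rewrite mulrDl lerD2l mulrAC.
  rewrite /C0 /H' expr2 (_ : 2 * (tM * tM) * H = 2 * (H * tM) * tM); last by ring.
  by rewrite ler_wpM2l ?theta_le // !mulr_ge0 // ltW.
by split; apply: fin => n; have [] := claim n x xX.
Qed.

Lemma ccont_osc lam (x : R) : ccont (fun s => osc (2 * (x - s)) lam).
Proof.
rewrite (_ : (fun s => _) = fun s => osc (2 * x) lam * cexp (- (2 * 'i%C * lam) * s%:C)); last first.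
  apply/funext => s; rewrite !oscE -cexpD; congr cexp.
  by rewrite !(rmorphM, rmorphB) /= rmorph_nat; ring.
by apply: ccontM (ccont_cst _) (ccont_cexp_lin _).
Qed.

Definition kern (X : R) : R := M * (9 + 8 * X ^+ 2).

Lemma kern_ge0 X : 0 <= kern X.
Proof. by rewrite /kern mulr_ge0 // addr_ge0 // mulr_ge0 // sqr_ge0. Qed.

(** One power of the weight absorbs the quadratic growth, in the elapsed time
    x - s, of the divided differences of the oscillating factor. *)
Lemma kern_bound g (X x s : R) : decays g M -> s <= x -> x <= X ->
  cabs (g s) * (1 + (2 * (x - s)) ^+ 2) <= kern X * w s.
Proof.
move=> dg sx xX.
have h1 : (1 + (2 * (x - s)) ^+ 2) <= (9 + 8 * X ^+ 2) * (w s)^-1.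
  rewrite /w invrK; have : (x - s) ^+ 2 <= (X - s) ^+ 2.
    by rewrite lerXn2r ?nnegrE ?subr_ge0 //; lra.
  have := sqr_ge0 (X + s); have := sqr_ge0 X; have := sqr_ge0 s; nra.
apply: le_trans (ler_pM (cabs_ge0 _) _ (dg s) h1) _.
  by rewrite addr_ge0 // sqr_ge0.
rewrite le_eqVlt; apply/orP; left; apply/eqP; rewrite /kern; field.
exact/lt0r_neq0/w_gt0.
Qed.

Lemma kern_integral g (X x B : R) F : ccont g -> decays g M -> x <= X -> 0 <= B -> ccont F ->
  (forall s, s <= x -> cabs (F s) <= B * (1 + (2 * (x - s)) ^+ 2)) ->
  cintegrable (Ny x) (fun s => g s * F s) /\
  cabs (cintegral (Ny x) (fun s => g s * F s)) <= 2 * (B * kern X) * pi.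
Proof.
move=> cg dg xX B0 cF H.
have bd s : s <= x -> cabs (g s * F s) <= B * kern X * w s.
  move=> sx; rewrite cabsM; apply: le_trans (ler_wpM2l (cabs_ge0 _) (H s sx)) _.
  by rewrite mulrCA -mulrA ler_wpM2l // kern_bound.
have i : cintegrable (Ny x) (fun s => g s * F s).
  apply: (@cintegrable_w _ _ _ (B * kern X)) => //.
  by apply: ccont_cmeasurable => //; exact: ccontM.
split => //; apply: cabs_cintegral_Ny_pi => //.
by rewrite mulr_ge0 ?kern_ge0.
Qed.

Lemma osc_kern lam (x s : R) : upper R lam -> s <= x ->
  cabs (osc (2 * (x - s)) lam) <= 1.
Proof. by move=> hl sx; rewrite cabs_osc // mulr_ge0 // subr_ge0. Qed.

Lemma one_le_kern (x s : R) : 1 <= 1 + (2 * (x - s)) ^+ 2.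
Proof. by rewrite lerDl sqr_ge0. Qed.

Section Step.
Variables (lam : R[i]) (u v : R -> R[i]) (B : R).
Hypotheses (hl : upper R lam) (cu : ccont u) (cv : ccont v).
Hypothesis bB : forall x, cabs (u x) <= B /\ cabs (v x) <= B.

Let B0 : 0 <= B. Proof. by have [h _] := bB 0; exact: le_trans (cabs_ge0 _) h. Qed.

Lemma step_integrable1 x : cintegrable (Ny x) (fun s => q s * v s).
Proof.
apply: (@cintegrable_w _ _ _ (M * B)) => //.
  by apply: ccont_cmeasurable => //; exact: ccontM.
move=> s _; rewrite cabsM mulrAC; have [_ h] := bB s.
by apply: ler_pM (cabs_ge0 _) (cabs_ge0 _) (decays_w s dq) h.
Qed.

Lemma step_integrable2 x :
  cintegrable (Ny x) (fun s => p s * (osc (2 * (x - s)) lam * u s)).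
Proof.
have [] := @kern_integral p x x B (fun s => osc (2 * (x - s)) lam * u s) cp dp (lexx x) B0.
- by apply: ccontM => //; exact: ccont_osc.
- move=> s sx; rewrite cabsM; have [h _] := bB s.
  apply: le_trans (ler_pM (cabs_ge0 _) (cabs_ge0 _) (osc_kern hl sx) h) _.
  by rewrite mul1r ler_peMr // one_le_kern.
- by [].
Qed.

Lemma step_cder1 x :
  cder (fun y => cintegral (Ny y) (fun s => q s * v s)) x (q x * v x).
Proof.
apply: (cder_cintegral_Ny (F := fun s => q s * v s)); first exact: ccontM.
exact: step_integrable1.
Qed.

Lemma osc_factor x s : osc (2 * (x - s)) lam =
  cexp (2 * 'i%C * lam * x%:C) * cexp (- (2 * 'i%C * lam) * s%:C).
Proof.
rewrite oscE -cexpD; congr cexp.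
by rewrite !(rmorphM, rmorphB) /= rmorph_nat; ring.
Qed.

Lemma step_cder2 x :
  cder (fun y => cintegral (Ny y) (fun s => p s * (osc (2 * (y - s)) lam * u s))) x
    (2 * 'i%C * lam * cintegral (Ny x) (fun s => p s * (osc (2 * (x - s)) lam * u s))
     + p x * u x).
Proof.
pose F s := p s * (cexp (- (2 * 'i%C * lam) * s%:C) * u s).
pose E x := cexp (2 * 'i%C * lam * x%:C).
have fac y s : p s * (osc (2 * (y - s)) lam * u s) = E y * F s.
  by rewrite osc_factor /E /F; ring.
have iF y : cintegrable (Ny y) F.
  have := cintegrableZ (E y)^-1 (measurable_Ny y) (step_integrable2 y).
  apply: eq_cintegrable => // s _; rewrite fac mulrA mulVf ?mul1r //.
  exact: cexp_neq0.
have eqF y : cintegral (Ny y) (fun s => p s * (osc (2 * (y - s)) lam * u s)) =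
    E y * cintegral (Ny y) F.
  by rewrite -cintegralZ //; apply: eq_cintegral => s _; exact: fac.
rewrite (_ : (fun y => _) = fun y => E y * cintegral (Ny y) F); last exact/funext.
rewrite eqF; apply: cder_eq.
  apply: cderM (cder_cexp_lin _ _) (cder_cintegral_Ny _ iF x).
  by apply: ccontM => //; apply: ccontM => //; exact: ccont_cexp_lin.
have EE : E x * cexp (- (2 * 'i%C * lam) * x%:C) = 1.
  by rewrite /E -cexpD mulNr subrr cexp0.
set I := cintegral _ F; rewrite -/(E x) -[p x * u x]mul1r -EE.
rewrite (_ : F x = p x * (cexp (- (2 * 'i%C * lam) * x%:C) * u x)) //=; ring.
Qed.

End Step.

Section Existence.
Variable lam : R[i].
Hypothesis hl : upper R lam.

Let step (r : (R -> R[i]) * (R -> R[i])) : (R -> R[i]) * (R -> R[i]) :=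
  (fun x => 1 + cintegral (Ny x) (fun s => q s * r.2 s),
   fun x => 0 + cintegral (Ny x) (fun s => p s * (osc (2 * (x - s)) lam * r.1 s))).

Let picard n := iter n step (fun=> 0, fun=> 0).

Let good (r : (R -> R[i]) * (R -> R[i])) : Prop :=
  [/\ ccont r.1, ccont r.2 &
      exists B, forall x, cabs (r.1 x) <= B /\ cabs (r.2 x) <= B].

Let good_step r : good r -> good (step r).
Proof.
move=> [c1 c2 [B bB]]; split => /=.
- apply: cder_cont => x; apply: cderD (cder_cst _ _) _.
  exact: (step_cder1 c2 bB).
- apply: cder_cont => x; apply: cderD (cder_cst _ _) _.
  exact: (step_cder2 hl c1 bB).
- have B0 : 0 <= B by have [h _] := bB 0; exact: le_trans (cabs_ge0 _) h.
  exists (1 + 2 * (M * B) * pi) => x; split.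
    apply: le_trans (cabs_leD _ _) _; rewrite cabs1 lerD2l.
    apply: cabs_cintegral_Ny_pi; [exact: (step_integrable1 c2 bB)|exact: mulr_ge0|].
    move=> s _; rewrite cabsM mulrAC; have [_ h] := bB s.
    by apply: ler_pM (cabs_ge0 _) (cabs_ge0 _) (decays_w s dq) h.
  rewrite add0r; apply: ler_wpDl => //.
  apply: cabs_cintegral_Ny_pi; [exact: (step_integrable2 hl c1 bB)|exact: mulr_ge0|].
  move=> s sx; rewrite cabsM mulrAC; have [h _] := bB s.
  apply: ler_pM (cabs_ge0 _) (cabs_ge0 _) (decays_w s dp) _; rewrite cabsM.
  by rewrite -[leRHS]mul1r; apply: ler_pM => //; rewrite ?cabs_ge0 // osc_kern.
Qed.

Let good_picard n : good (picard n).
Proof.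
elim: n => [|n IH]; last exact: good_step.
by split; [exact: ccont_cst..|exists 0 => x; rewrite /= cabs0].
Qed.

Let picard_diff n x :
  cabs ((picard n.+1).1 x - (picard n).1 x) <= tM / 2 ^+ n * theta x /\
  cabs ((picard n.+1).2 x - (picard n).2 x) <= tM / 2 ^+ n * theta x.
Proof.
have t1 := tM_ge1.
elim: n x => [|n IH] x.
  rewrite expr0 divr1 /= !subr0.
  under eq_cintegral do rewrite mulr0.
  under [X in _ /\ cabs (_ + X) <= _]eq_cintegral do rewrite !mulr0.
  rewrite cintegral0 !addr0 cabs1 cabs0 theta_ge1; split => //.
  exact: le_trans (theta_ge1 x).
have K0 : 0 <= tM / 2 ^+ n by rewrite divr_ge0 ?exprn_ge0 //; lra.
have eK : tM / 2 ^+ n.+1 = tM / 2 ^+ n / 2 by rewrite exprS; field; rewrite expf_neq0.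
have [c1 c2 [B bB]] := good_picard n.
have [d1 d2 [B' bB']] := good_picard n.+1.
rewrite eK; split.
- rewrite [(picard n.+2).1 x]/= [(picard n.+1).1 x]/= -/(picard n.+1) -/(picard n).
  rewrite opprD addrACA subrr add0r -cintegralB //;
    try exact: (step_integrable1 _ bB); try exact: (step_integrable1 _ bB').
  apply: cabs_cintegral_theta => //.
    by apply: cintegrableB => //; [exact: (step_integrable1 _ bB')|exact: (step_integrable1 _ bB)].
  move=> s sx; rewrite -mulrBr cabsM.
  by apply: ler_pM (cabs_ge0 _) (cabs_ge0 _) (decays_w s dq) _; have [] := IH s.
- rewrite [(picard n.+2).2 x]/= [(picard n.+1).2 x]/= -/(picard n.+1) -/(picard n).
  rewrite opprD addrACA subrr add0r -cintegralB //;
    try exact: (step_integrable2 _ _ bB); try exact: (step_integrable2 _ _ bB').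
  apply: cabs_cintegral_theta => //.
    by apply: cintegrableB => //; [exact: (step_integrable2 _ _ bB')|exact: (step_integrable2 _ _ bB)].
  move=> s sx; rewrite -mulrBr -mulrBr cabsM.
  apply: ler_pM (cabs_ge0 _) (cabs_ge0 _) (decays_w s dp) _; rewrite cabsM.
  have [h _] := IH s; apply: le_trans h.
  by rewrite -[leRHS]mul1r ler_wpM2r ?cabs_ge0 // osc_kern.
Qed.

Let uniform_ccont (f : nat -> R -> R[i]) (g : R -> R[i]) (K : R) :
  (forall n, ccont (f n)) -> (forall n x, cabs (f n x - g x) <= K / 2 ^+ n) ->
  ccont g.
Proof.
move=> cf H; apply/ccontP => x e e0.
have [n hn] : exists n : nat, K / 2 ^+ n < e / 3.
  apply/not_existsP => h.
  have : e / 3 <= 0.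
    apply: (@le_pow2 _ _ _ K) => n; rewrite add0r leNgt; apply/negP; exact: h n.
  lra.
have /ccontP /(_ x (e / 3)) [|d d0 Hd] := cf n; first lra.
exists d => // y /Hd h.
have -> : g y - g x = (f n y - f n x) - (f n y - g y) + (f n x - g x) by ring.
apply: le_lt_trans (cabs_leD _ _) _.
have := cabs_leB (f n y - f n x) (f n y - g y).
have := H n x; have := H n y; lra.
Qed.

(** Picard iteration: successive differences decrease by the factor 1/2 in the
    norm weighted by [theta]. *)
Lemma left_jost_exists : exists u v, [/\ left_jost q p lam u v, ccont u & ccont v].
Proof.
have t1 := tM_ge1; have t0 : 0 <= tM by lra.
pose K := tM * tM; have K0 : 0 <= K by exact: mulr_ge0.
have le_K n x : tM / 2 ^+ n * theta x <= K / 2 ^+ n.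
  by rewrite mulrAC ler_wpM2r ?invr_ge0 ?exprn_ge0 // ler_wpM2l ?theta_le.
have /choice [u hu] x : exists z, forall n, cabs ((picard n).1 x - z) <= 4 * K / 2 ^+ n.
  by apply: cgeometric_cvg => // n; apply: le_trans (le_K n x); have [] := picard_diff n x.
have /choice [v hv] x : exists z, forall n, cabs ((picard n).2 x - z) <= 4 * K / 2 ^+ n.
  by apply: cgeometric_cvg => // n; apply: le_trans (le_K n x); have [] := picard_diff n x.
have cu : ccont u.
  apply: (@uniform_ccont (fun n => (picard n).1) _ (4 * K)) => [n|n x]; last exact: hu.
  by have [] := good_picard n.
have cv : ccont v.
  apply: (@uniform_ccont (fun n => (picard n).2) _ (4 * K)) => [n|n x]; last exact: hv.
  by have [] := good_picard n.
have bB x : cabs (u x) <= 4 * K /\ cabs (v x) <= 4 * K.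
  have := hu x 0%N; have := hv x 0%N.
  by rewrite expr0 divr1 /= !sub0r !cabsN.
have B0 : 0 <= 4 * K by rewrite mulr_ge0.
have zero (z : R[i]) (k : R) : (forall n, cabs z <= k / 2 ^+ n) -> z = 0.
  move=> h; apply/eqP; rewrite -cabs_eq0 eq_le cabs_ge0 andbT.
  by apply: (@le_pow2 _ _ _ k) => n; rewrite add0r; exact: h.
exists u, v; split => //; split; first by exists (4 * K).
move=> x; have i1 := step_integrable1 cv bB x; have i2 := step_integrable2 hl cu bB x.
split => //.
- apply/eqP; rewrite -subr_eq0; apply/eqP.
  apply: (zero _ (4 * K + 2 * (M * (4 * K)) * pi)) => n.
  have [c1 c2 [B bBn]] := good_picard n.
  rewrite (_ : u x - _ = ((picard n.+1).1 x -
    (1 + cintegral (Ny x) (fun s => q s * v s))) - ((picard n.+1).1 x - u x)); last by ring.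
  apply: le_trans (cabs_leB _ _) _.
  rewrite mulrDl [X in _ <= X]addrC; apply: lerD; last first.
    apply: le_trans (hu x n.+1) _; rewrite ler_wpM2l // lef_pV2 ?posrE ?exprn_gt0 //.
    by rewrite ler_eXn2l // ltr1n.
  rewrite [(picard n.+1).1 x]/= -/(picard n) opprD addrACA subrr add0r.
  rewrite -cintegralB //; last exact: (step_integrable1 _ bBn).
  have -> : 2 * (M * (4 * K)) * pi / 2 ^+ n = 2 * (M * (4 * K / 2 ^+ n)) * pi by ring.
  apply: cabs_cintegral_Ny_pi.
  + by apply: cintegrableB => //; exact: (step_integrable1 _ bBn).
  + by rewrite mulr_ge0 // divr_ge0 // exprn_ge0.
  + move=> s _; rewrite -mulrBr cabsM mulrAC.
    by apply: ler_pM (cabs_ge0 _) (cabs_ge0 _) (decays_w s dq) (hv s n).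
- apply/eqP; rewrite -subr_eq0; apply/eqP.
  apply: (zero _ (4 * K + 2 * (M * (4 * K)) * pi)) => n.
  have [c1 c2 [B bBn]] := good_picard n.
  rewrite (_ : v x - _ = ((picard n.+1).2 x -
    (0 + cintegral (Ny x) (fun s => p s * (osc (2 * (x - s)) lam * u s)))) -
    ((picard n.+1).2 x - v x)); last by ring.
  apply: le_trans (cabs_leB _ _) _.
  rewrite mulrDl [X in _ <= X]addrC; apply: lerD; last first.
    apply: le_trans (hv x n.+1) _; rewrite ler_wpM2l // lef_pV2 ?posrE ?exprn_gt0 //.
    by rewrite ler_eXn2l // ltr1n.
  rewrite [(picard n.+1).2 x]/= -/(picard n) opprD addrACA subrr add0r.
  rewrite -cintegralB //; last exact: (step_integrable2 hl c1 bBn).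
  have -> : 2 * (M * (4 * K)) * pi / 2 ^+ n = 2 * (M * (4 * K / 2 ^+ n)) * pi by ring.
  apply: cabs_cintegral_Ny_pi.
  + by apply: cintegrableB => //; exact: (step_integrable2 hl c1 bBn).
  + by rewrite mulr_ge0 // divr_ge0 // exprn_ge0.
  + move=> s sx; rewrite -mulrBr -mulrBr cabsM mulrAC.
    apply: ler_pM (cabs_ge0 _) (cabs_ge0 _) (decays_w s dp) _; rewrite cabsM.
    apply: le_trans (hu s n).
    by rewrite -[leRHS]mul1r ler_wpM2r ?cabs_ge0 // osc_kern.
Qed.

End Existence.

(** The difference of two solutions satisfies the system without forcing terms,
    where the a priori bound is 0. *)
Lemma left_jost_unique lam u v u' v' : upper R lam ->
  left_jost q p lam u v -> left_jost q p lam u' v' -> u = u' /\ v = v'.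
Proof.
move=> hl [[B bB] V] [[B' bB'] V'].
have H x : cabs (u x - u' x) <= C0 * 0 /\ cabs (v x - v' x) <= C0 * 0.
  apply: (@volterra_apriori lam x (fun=> 0) (fun=> 0) (fun x => u x - u' x)
    (fun x => v x - v' x) 0 (B + B')) => //.
  - move=> y _; have [i1 i2 e1 e2] := V y; have [i1' i2' e1' e2'] := V' y.
    split.
    + apply: eq_cintegrable (cintegrableB _ i1 i1') => // s _; exact/esym/mulrBr.
    + by apply: eq_cintegrable (cintegrableB _ i2 i2') => // s _; rewrite !mulrBr.
    + rewrite e1 e1' opprD addrACA subrr -cintegralB //; congr (_ + _).
      by apply: eq_cintegral => s _; exact/esym/mulrBr.
    + rewrite e2 e2' opprD addrACA subrr -cintegralB //; congr (_ + _).
      by apply: eq_cintegral => s _; rewrite !mulrBr.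
  - move=> y _; have [h1 h2] := bB y; have [h3 h4] := bB' y.
    by split; apply: le_trans (cabs_leB _ _) _; apply: lerD.
  - by move=> y _; rewrite cabs0.
split; apply/funext => x; have [h1 h2] := H x; apply/eqP; rewrite -subr_eq0 -cabs_eq0;
  by rewrite eq_le cabs_ge0 andbT -(mulr0 C0).
Qed.

Section SpectralDependence.
Variables (U V : R[i] -> R -> R[i]).
Hypothesis J : forall lam, upper R lam ->
  [/\ left_jost q p lam (U lam) (V lam), ccont (U lam) & ccont (V lam)].

Lemma jost_bound lam x : upper R lam ->
  cabs (U lam x) <= C0 /\ cabs (V lam x) <= C0.
Proof.
move=> hl; have [[[B bB] V1] _ _] := J hl; rewrite -[C0]mulr1.
apply: (volterra_apriori hl (fun x _ => V1 x) (fun x _ => bB x) _ (lexx x)).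
by move=> y _; rewrite cabs1 cabs0.
Qed.

Let C00 : 0 <= C0. Proof. by rewrite mulr_ge0 // sqr_ge0. Qed.

(** The first and second differences of the solutions satisfy the Volterra
    system with a forcing term produced by the differences of the oscillating
    factor, so that the a priori bound applies to them. *)
Lemma jost_dd_bounded X : exists2 c : R, 0 <= c & forall s, s <= X ->
  dd_bounded (upper R) c (U ^~ s) /\ dd_bounded (upper R) c (V ^~ s).
Proof.
pose c1 := C0 * (2 * (4 * C0 * kern X) * pi).
pose c2 := C0 * (2 * ((4 * C0 + 4 * c1) * kern X) * pi).
have k0 := kern_ge0 X; have pi0 := pi_ge0 R.
have c10 : 0 <= c1.
  exact: mulr_ge0 C00 (mulr_ge0 (mulr_ge0 (ler0n R 2) (mulr_ge0 (mulr_ge0 (ler0n R 4) C00) k0)) pi0).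
have c30 : 0 <= 4 * C0 + 4 * c1.
  exact: addr_ge0 (mulr_ge0 (ler0n R 4) C00) (mulr_ge0 (ler0n R 4) c10).
have c20 : 0 <= c2.
  exact: mulr_ge0 C00 (mulr_ge0 (mulr_ge0 (ler0n R 2) (mulr_ge0 c30 k0)) pi0).
have D1 l m : upper R l -> upper R m -> forall x, x <= X ->
    cabs (U m x - U l x) <= c1 * cabs (m - l) /\ cabs (V m x - V l x) <= c1 * cabs (m - l).
  move=> hl hm.
  have [[_ Vl] cUl cVl] := J hl; have [[_ Vm] cUm cVm] := J hm.
  (* The forcing term, which is O(m - l) by the a priori bound on U m. *)
  pose F x s := (osc (2 * (x - s)) m - osc (2 * (x - s)) l) * U m s.
  have FP x : x <= X -> cintegrable (Ny x) (fun s => p s * F x s) /\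
      cabs (cintegral (Ny x) (fun s => p s * F x s)) <= 2 * (4 * cabs (m - l) * C0 * kern X) * pi.
    move=> xX; apply: kern_integral => //; first exact: mulr_ge0 (mulr_ge0 (ler0n R 4) (cabs_ge0 _)) C00.
      by apply: ccontM => //; apply: ccontB; exact: ccont_osc.
    move=> s sx; rewrite cabsM.
    have t0 : 0 <= 2 * (x - s) by rewrite mulr_ge0 // subr_ge0.
    have [_ h1 _] := dd_bounded_osc t0; have [h2 _] := jost_bound s hm.
    apply: le_trans (ler_pM (cabs_ge0 _) (cabs_ge0 _) (h1 _ _ hl hm) h2) _.
    by rewrite le_eqVlt; apply/orP; left; apply/eqP; ring.
  move=> x xX.
  have -> : c1 * cabs (m - l) = C0 * (2 * (4 * cabs (m - l) * C0 * kern X) * pi).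
    by rewrite /c1; ring.
  apply: (@volterra_apriori l X (fun=> 0) (fun x => cintegral (Ny x) (fun s => p s * F x s))
    (fun x => U m x - U l x) (fun x => V m x - V l x) _ (C0 + C0)) => //.
  - move=> y yX; have [i1 i2 e1 e2] := Vl y; have [i1' i2' e1' e2'] := Vm y.
    have [iF _] := FP y yX.
    have i3 : cintegrable (Ny y) (fun s => p s * (osc (2 * (y - s)) l * (U m s - U l s))).
      apply: eq_cintegrable (cintegrableB _ (cintegrableB _ i2' i2) iF) => // s _.
      by rewrite /F; ring.
    split.
    + apply: eq_cintegrable (cintegrableB _ i1' i1) => // s _; exact/esym/mulrBr.
    + exact: i3.
    + rewrite e1 e1' opprD addrACA subrr -cintegralB //; congr (_ + _).
      by apply: eq_cintegral => s _; exact/esym/mulrBr.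
    + rewrite e2 e2' !add0r -cintegralB // -cintegralD //.
      by apply: eq_cintegral => s _; rewrite /F; ring.
  - move=> y _; have [h1 h2] := jost_bound y hl; have [h3 h4] := jost_bound y hm.
    by split; apply: le_trans (cabs_leB _ _) _; apply: lerD.
  - move=> y yX; have [_ h] := FP y yX; split => //.
    by rewrite cabs0; exact: le_trans (cabs_ge0 _) h.
have D2 l m n : upper R l -> upper R m -> upper R n -> forall x, x <= X ->
    cabs (dd2 (U ^~ x) l m n) <= c2 * (cabs (m - l) * cabs (n - l) * cabs (m - n)) /\
    cabs (dd2 (V ^~ x) l m n) <= c2 * (cabs (m - l) * cabs (n - l) * cabs (m - n)).
  move=> hl hm hn; set P := _ * _ * cabs (m - n).
  have P0 : 0 <= P by exact: prod3_ge0.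
  have [[_ Vl] cUl cVl] := J hl; have [[_ Vm] cUm cVm] := J hm.
  have [[_ Vn] cUn cVn] := J hn.
  (* The discrete Leibniz rule for dd2 of the product of osc and U, without the
     term where dd2 falls on U. *)
  pose F x s := U n s * dd2 (osc (2 * (x - s))) l m n +
    (U m s - U n s) * ((osc (2 * (x - s)) m - osc (2 * (x - s)) l) * (n - l)).
  have FP x : x <= X -> cintegrable (Ny x) (fun s => p s * F x s) /\
      cabs (cintegral (Ny x) (fun s => p s * F x s)) <= 2 * ((4 * C0 + 4 * c1) * P * kern X) * pi.
    move=> xX; apply: kern_integral => //; first exact: mulr_ge0.
      have co z := ccont_osc z x.
      have cd z z' (c : R[i]) : ccont (fun s => (osc (2 * (x - s)) z - osc (2 * (x - s)) z') * c).
        by apply: ccontM (ccont_cst _); apply: ccontB; exact: co.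
      apply: ccontD; apply: ccontM; [exact: cUn|apply: ccontB|exact: ccontB|];
        exact: cd.
    move=> s sx; apply: le_trans (cabs_leD _ _) _; rewrite !cabsM.
    have t0 : 0 <= 2 * (x - s) by rewrite mulr_ge0 // subr_ge0.
    have [_ h1 h1'] := dd_bounded_osc t0; have [h2 _] := jost_bound s hn.
    have [h3 _] := D1 _ _ hn hm s (le_trans sx xX).
    have h4 := ler_pM (cabs_ge0 _) (cabs_ge0 _) h2 (h1' _ _ _ hl hm hn).
    have h5 := ler_pM (cabs_ge0 _) (mulr_ge0 (cabs_ge0 _) (cabs_ge0 (n - l))) h3
      (ler_wpM2r (cabs_ge0 (n - l)) (h1 _ _ hl hm)).
    apply: le_trans (lerD h4 h5) _.
    by rewrite le_eqVlt; apply/orP; left; apply/eqP; rewrite /P; ring.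
  move=> x xX.
  have -> : c2 * P = C0 * (2 * ((4 * C0 + 4 * c1) * P * kern X) * pi).
    by rewrite /c2; ring.
  apply: (@volterra_apriori l X (fun=> 0) (fun x => cintegral (Ny x) (fun s => p s * F x s))
    (fun x => dd2 (U ^~ x) l m n) (fun x => dd2 (V ^~ x) l m n) _
    ((C0 + C0) * cabs (n - l) + (C0 + C0) * cabs (m - l))) => //.
  - move=> y yX; have [i1 i2 e1 e2] := Vl y; have [i1' i2' e1' e2'] := Vm y.
    have [i1'' i2'' e1'' e2''] := Vn y.
    have [iF _] := FP y yX.
    have j1 := cintegrableB (measurable_Ny y) (cintegrableZ (n - l) (measurable_Ny y) (cintegrableB (measurable_Ny y) i1' i1))
      (cintegrableZ (m - l) (measurable_Ny y) (cintegrableB (measurable_Ny y) i1'' i1)).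
    have j2 := cintegrableB (measurable_Ny y) (cintegrableZ (n - l) (measurable_Ny y) (cintegrableB (measurable_Ny y) i2' i2))
      (cintegrableZ (m - l) (measurable_Ny y) (cintegrableB (measurable_Ny y) i2'' i2)).
    have k1 : cintegrable (Ny y) (fun s => q s * dd2 (V ^~ s) l m n).
      by apply: eq_cintegrable j1 => // s _; rewrite /dd2; ring.
    have k2 : cintegrable (Ny y) (fun s => p s * (osc (2 * (y - s)) l * dd2 (U ^~ s) l m n)).
      apply: eq_cintegrable (cintegrableB _ j2 iF) => // s _.
      by rewrite /F /dd2; ring.
    have lin (h : R[i]) (A B C : R -> R[i]) : cintegrable (Ny y) A -> cintegrable (Ny y) B ->
        cintegrable (Ny y) C ->
        ((h + cintegral (Ny y) B) - (h + cintegral (Ny y) A)) * (n - l) -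
        ((h + cintegral (Ny y) C) - (h + cintegral (Ny y) A)) * (m - l) =
        cintegral (Ny y) (fun s => (n - l) * (B s - A s) - (m - l) * (C s - A s)).
      move=> iA iB iC.
      have iBA := cintegrableB (measurable_Ny y) iB iA.
      have iCA := cintegrableB (measurable_Ny y) iC iA.
      rewrite cintegralB //; try exact: cintegrableZ.
      by rewrite !cintegralZ // !cintegralB //; ring.
    split => //.
    + rewrite add0r /dd2 e1 e1' e1'' lin //.
      by apply: eq_cintegral => s _; rewrite /dd2; ring.
    + rewrite {1}/dd2 e2 e2' e2'' lin // -cintegralD //.
      by apply: eq_cintegral => s _; rewrite /F /dd2; ring.
  - move=> y _; have [h1 h2] := jost_bound y hl; have [h3 h4] := jost_bound y hm.
    have [h5 h6] := jost_bound y hn.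
    by split; apply: le_trans (cabs_leB _ _) _; rewrite !cabsM; apply: lerD;
      rewrite ler_wpM2r ?cabs_ge0 //; apply: le_trans (cabs_leB _ _) _; apply: lerD.
  - move=> y yX; have [_ h] := FP y yX; split => //.
    by rewrite cabs0; exact: le_trans (cabs_ge0 _) h.
have le1 : C0 <= C0 + c1 + c2 by rewrite -addrA lerDl addr_ge0.
have le2 : c1 <= C0 + c1 + c2 by rewrite addrAC lerDr addr_ge0.
have le3 : c2 <= C0 + c1 + c2 by rewrite lerDr addr_ge0.
exists (C0 + c1 + c2); first exact: addr_ge0 (addr_ge0 C00 c10) c20.
move=> s sX; split; split=> [l hl|l m hl hm|l m n hl hm hn].
- have [h _] := jost_bound s hl; exact: le_trans h le1.
- have [h _] := D1 _ _ hl hm s sX; apply: le_trans h _.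
  exact: ler_wpM2r (cabs_ge0 _) _ _ le2.
- have [h _] := D2 _ _ _ hl hm hn s sX; apply: le_trans h _.
  exact: ler_wpM2r (prod3_ge0 _ _ _) _ _ le3.
- have [_ h] := jost_bound s hl; exact: le_trans h le1.
- have [_ h] := D1 _ _ hl hm s sX; apply: le_trans h _.
  exact: ler_wpM2r (cabs_ge0 _) _ _ le2.
- have [_ h] := D2 _ _ _ hl hm hn s sX; apply: le_trans h _.
  exact: ler_wpM2r (prod3_ge0 _ _ _) _ _ le3.
Qed.

End SpectralDependence.

End Volterra.

(** * Jost solutions and their asymptotics in the spectral parameter *)

Section Jost.
Context {R : realType}.
Implicit Types lam : R[i].

(** A continuously differentiable function which, with its derivative, is
    dominated by the square of the weight. *)
Definition c1_decays (g g' : R -> R[i]) : Prop :=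
  [/\ forall x, cder g x (g' x), ccont g',
      exists M, decays g M & exists M, decays g' M].

Lemma c1_decays_cont g g' : c1_decays g g' -> ccont g.
Proof. by move=> [h _ _ _]; exact: cder_cont h. Qed.

Lemma decaysD (f g : R -> R[i]) M N : decays f M -> decays g N ->
  decays (fun x => f x + g x) (M + N).
Proof.
by move=> hf hg s; apply: le_trans (cabs_leD _ _) _; rewrite mulrDl lerD ?hf ?hg.
Qed.

Lemma decaysMl (b f : R -> R[i]) B M : (forall x, cabs (b x) <= B) -> decays f M ->
  decays (fun x => b x * f x) (B * M).
Proof.
move=> hb hf s; rewrite cabsM -mulrA.
by apply: ler_pM (hb s) (hf s); exact: cabs_ge0.
Qed.

Lemma decays_le (f : R -> R[i]) M N : M <= N -> decays f M -> decays f N.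
Proof.
move=> MN hf s; apply: le_trans (hf s) _.
by rewrite ler_wpM2r // exprn_ge0 // ltW // w_gt0.
Qed.

Lemma decays_bounded (f : R -> R[i]) M : decays f M -> forall x, cabs (f x) <= M.
Proof.
move=> hf x; apply: le_trans (hf x) _; rewrite -[leRHS]mulr1.
by apply: ler_wpM2l (decays_ge0 hf) _ _ _; rewrite exprn_ile1 ?w_le1 ?ltW ?w_gt0.
Qed.

Lemma c1_decaysD f f' g g' : c1_decays f f' -> c1_decays g g' ->
  c1_decays (fun x => f x + g x) (fun x => f' x + g' x).
Proof.
move=> [f1 f2 [M f3] [N f4]] [g1 g2 [M' g3] [N' g4]]; split.
- by move=> x; apply: cderD.
- exact: ccontD.
- by exists (M + M'); exact: decaysD.
- by exists (N + N'); exact: decaysD.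
Qed.

Lemma c1_decaysZ (c : R[i]) f f' : c1_decays f f' ->
  c1_decays (fun x => c * f x) (fun x => c * f' x).
Proof.
move=> [f1 f2 [M f3] [N f4]]; split.
- by move=> x; apply: cder_eq (cderM (cder_cst c x) (f1 x)) _; ring.
- by apply: ccontM => //; exact: ccont_cst.
- by exists (cabs c * M); exact: decaysMl.
- by exists (cabs c * N); exact: decaysMl.
Qed.

Lemma c1_decaysM f f' g g' : c1_decays f f' -> c1_decays g g' ->
  c1_decays (fun x => f x * g x) (fun x => f' x * g x + f x * g' x).
Proof.
move=> hf hg; have cf := c1_decays_cont hf; have cg := c1_decays_cont hg.
case: hf hg => [f1 f2 [M f3] [N f4]] [g1 g2 [M' g3] [N' g4]]; split.
- by move=> x; exact: cderM.
- by apply: ccontD; exact: ccontM.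
- by exists (M * M'); apply: decaysMl => //; exact: decays_bounded.
- exists (N * M' + M * N'); apply: decaysD; apply: decaysMl => //; exact: decays_bounded.
Qed.

Lemma c1_decays_reflect f f' : c1_decays f f' ->
  c1_decays (fun x => f (- x)) (fun x => - f' (- x)).
Proof.
move=> [f1 f2 [M f3] [N f4]]; split.
- move=> x; have := cder_comp_real (is_deriveN (is_derive_id x (1 : R))) (f1 (- x)).
  by move=> h; apply: cder_eq h _; rewrite rmorphN /= rmorph1 mulN1r.
- apply: ccontN; apply: ccont_comp f2 _ => x.
  by apply: cvgN; exact: cvg_id.
- by exists M => s; rewrite -w_opp; exact: f3.
- by exists N => s; rewrite cabsN -w_opp; exact: f4.
Qed.

Lemma w_small (K e : R) : 0 < e -> exists X : R, forall x, x <= X -> K * w x <= e.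
Proof.
move=> e0; exists (- (`|K| / e + 1)) => x hx.
have k0 : 0 <= `|K| / e by rewrite divr_ge0 // ltW.
have w0 := ltW (w_gt0 x).
apply: (@le_trans _ _ (`|K| * w x)); first by rewrite ler_wpM2r // ler_norm.
rewrite /w ler_pdivrMr; last by have := sqr_ge0 x; lra.
rewrite mulrC -ler_pdivrMr //; nra.
Qed.

Definition jost (q p : R -> R[i]) lam : (R -> R[i]) * (R -> R[i]) :=
  xget (fun=> 0, fun=> 0) [set r | left_jost q p lam r.1 r.2].

Section OnePotential.
Variables q q' p p' : R -> R[i].
Hypotheses (hq : c1_decays q q') (hp : c1_decays p p').

Let u lam := (jost q p lam).1.
Let v lam := (jost q p lam).2.

Let cq : ccont q. Proof. exact: c1_decays_cont hq. Qed.
Let cp : ccont p. Proof. exact: c1_decays_cont hp. Qed.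

Let pot : exists M, decays q M /\ decays p M.
Proof.
have [_ _ [M hM] _] := hq; have [_ _ [N hN] _] := hp; exists (M + N).
have := decays_ge0 hM; have := decays_ge0 hN => ? ?.
by split; [apply: decays_le hM; rewrite lerDl|apply: decays_le hN; rewrite lerDr].
Qed.

Lemma jost_unique lam f g : upper R lam -> left_jost q p lam f g ->
  jost q p lam = (f, g).
Proof.
move=> hl J; have [M [dq dp]] := pot.
have := xgetPex (fun=> 0, fun=> 0) (P := [set r | left_jost q p lam r.1 r.2])
  (ex_intro _ (f, g) J).
rewrite -/(jost q p lam) /= => J'.
have [-> ->] := left_jost_unique dq dp hl J J'.
by rewrite -surjective_pairing.
Qed.

Lemma jostP lam : upper R lam ->
  [/\ left_jost q p lam (u lam) (v lam), ccont (u lam) & ccont (v lam)].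
Proof.
move=> hl; have [M [dq dp]] := pot.
have [f [g [J cf cg]]] := left_jost_exists cq cp dq dp hl.
by rewrite /u /v (jost_unique hl J).
Qed.

Lemma jost_bounded : exists2 B, 0 <= B & forall lam, upper R lam ->
  forall x, cabs (u lam x) <= B /\ cabs (v lam x) <= B.
Proof.
have [M [dq dp]] := pot; eexists; last first.
  by move=> lam hl x; exact: (jost_bound dq dp jostP x hl).
by rewrite mulr_ge0 // sqr_ge0.
Qed.

Lemma jost_dd X : exists2 c : R, 0 <= c & forall s, s <= X ->
  dd_bounded (upper R) c (u ^~ s) /\ dd_bounded (upper R) c (v ^~ s).
Proof. have [M [dq dp]] := pot; exact: (jost_dd_bounded cp dq dp jostP X). Qed.

Lemma jost_cder lam x : upper R lam ->
  cder (u lam) x (q x * v lam x) /\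
  cder (v lam) x (2 * 'i%C * lam * v lam x + p x * u lam x).
Proof.
move=> hl; have [M [dq dp]] := pot; have [[[B bB] V] cu cv] := jostP hl.
have e1 : u lam = fun y => 1 + cintegral (Ny y) (fun s => q s * v lam s).
  by apply/funext => y; have [] := V y.
have e2 : v lam = fun y => 0 + cintegral (Ny y) (fun s => p s * (osc (2 * (y - s)) lam * u lam s)).
  by apply/funext => y; have [] := V y.
split.
  rewrite {1}e1; apply: cder_eq (cderD (cder_cst _ _) (step_cder1 cq dq cv bB x)) _.
  exact: add0r.
rewrite {1}e2.
apply: cder_eq (cderD (cder_cst _ _) (step_cder2 cp dq dp hl cu bB x)) _.
by have [_ _ _ e3] := V x; rewrite add0r [v lam x]e3 add0r.
Qed.

(** The quantity atan x + pi / 2 is the mass of the weight on ]-oo, x], hence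
    tends to 0 at -oo. *)
Lemma jost_limit : exists K, forall lam, upper R lam -> forall x,
  cabs (u lam x - 1) <= K * (atan x + pi / 2) /\ cabs (v lam x) <= K * (atan x + pi / 2).
Proof.
have [M [dq dp]] := pot; have [B B0 hB] := jost_bounded.
exists (2 * (M * B)) => lam hl x; have [[_ V] _ _] := jostP hl.
have [i1 i2 e1 e2] := V x; split.
  rewrite e1 addrC addKr; apply: cabs_cintegral_Ny i1 _ => s _.
  rewrite cabsM mulrAC; have [_ h] := hB _ hl s.
  by apply: ler_pM (cabs_ge0 _) (cabs_ge0 _) (decays_w s dq) h.
rewrite e2 add0r; apply: cabs_cintegral_Ny i2 _ => s sx.
rewrite cabsM mulrAC; have [h _] := hB _ hl s.
apply: ler_pM (cabs_ge0 _) (cabs_ge0 _) (decays_w s dp) _.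
rewrite cabsM -[leRHS]mul1r; apply: ler_pM => //; try exact: cabs_ge0.
exact: osc_kern.
Qed.

Lemma cder_osc (c x : R) lam (s : R) :
  cder (fun s => osc (c * (x - s)) lam) s (- (c%:C * 'i%C * lam) * osc (c * (x - s)) lam).
Proof.
rewrite (_ : (fun s => _) = fun s : R => osc (c * x) lam * cexp (- (c%:C * 'i%C * lam) * s%:C)); last first.
  apply/funext => r; rewrite !oscE -cexpD; congr cexp.
  by rewrite !(rmorphM, rmorphB) /=; ring.
apply: cder_eq (cderM (cder_cst _ _) (cder_cexp_lin _ _)) _.
rewrite (_ : osc (c * (x - s)) lam = osc (c * x) lam * cexp (- (c%:C * 'i%C * lam) * s%:C)); last first.
  by rewrite !oscE -cexpD; congr cexp; rewrite !(rmorphM, rmorphB) /=; ring.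
by ring.
Qed.

Lemma ccont_osc1 lam (x : R) : ccont (fun s => osc (x - s) lam).
Proof.
rewrite (_ : (fun s => _) = fun s => osc (1 * (x - s)) lam); last first.
  by apply/funext => s; rewrite mul1r.
exact: cder_cont (cder_osc 1 x lam).
Qed.

(** The fundamental theorem for s |-> osc (c (x - s)) lam * D s, whose value at
    s = x is D x. *)
Lemma osc_integral (c : R) lam (D D' : R -> R[i]) (K x : R) : 0 <= c ->
  upper R lam ->
  (forall s, cder D s (D' s)) -> ccont D' ->
  (forall s, cabs (D s) <= K * w s) -> (forall s, cabs (D' s) <= K * w s) ->
  cintegrable (Ny x) (fun s => osc (c * (x - s)) lam * (D' s - c%:C * 'i%C * lam * D s)) /\
  cintegral (Ny x) (fun s => osc (c * (x - s)) lam * (D' s - c%:C * 'i%C * lam * D s)) = D x.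
Proof.
move=> c0 hl dD cD' bD bD'; have cD := cder_cont dD.
have K0 : 0 <= K.
  by have := le_trans (cabs_ge0 _) (bD 0); rewrite pmulr_lge0 // w_gt0.
pose G s := osc (c * (x - s)) lam * D s.
pose G' s := osc (c * (x - s)) lam * (D' s - c%:C * 'i%C * lam * D s).
have dG s : cder G s (G' s).
  by apply: cder_eq (cderM (cder_osc c x lam s) (dD s)) _; rewrite /G'; ring.
have co : ccont (fun s => osc (c * (x - s)) lam) by exact: cder_cont (cder_osc c x lam).
have cG' : ccont G'.
  apply: ccontM => //; apply: ccontB => //; apply: ccontM => //; exact: ccont_cst.
have bo y s : s <= y -> cabs (osc (c * (x - s)) lam) <= cabs (osc (c * (x - y)) lam).
  move=> sy; rewrite (_ : c * (x - s) = c * (x - y) + c * (y - s)); last by ring.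
  rewrite oscD cabsM -[leRHS]mulr1 ler_wpM2l ?cabs_ge0 // cabs_osc //.
  by rewrite mulr_ge0 // subr_ge0.
pose K' y := cabs (osc (c * (x - y)) lam) * (K + cabs (c%:C * 'i%C * lam) * K).
have bG' y s : s <= y -> cabs (G' s) <= K' y * w s.
  move=> sy; rewrite cabsM /K' -[leRHS]mulrA; apply: ler_pM; rewrite ?cabs_ge0 ?bo //.
  rewrite mulrDl; apply: le_trans (cabs_leB _ _) _; rewrite lerD ?bD' //.
  by rewrite cabsM -[leRHS]mulrA ler_wpM2l ?cabs_ge0.
have iG' y : cintegrable (Ny y) G'.
  apply: (cintegrable_w (K := K' y)) => //; first exact: ccont_cmeasurable.
  by move=> s /NyE; exact: bG'.
split; first exact: iG'.
have := cintegral_Ny_cder dG cG' iG' _ _ x.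
rewrite /G subrr mulr0 osc0 mul1r; apply.
- move=> y; exists (K' y); last by move=> s; exact: bG'.
  by rewrite mulr_ge0 ?cabs_ge0 // addr_ge0 // mulr_ge0 // cabs_ge0.
- move=> e e0; have [X HX] := w_small K e0; exists (Num.min x X) => y.
  rewrite le_min => /andP[yx yX]; apply: le_trans (HX y yX).
  rewrite cabsM -[leRHS]mul1r; apply: ler_pM; rewrite ?cabs_ge0 //.
  by rewrite cabs_osc // mulr_ge0 // subr_ge0.
Qed.

(** Integrating by parts against the oscillating factor gains one power of the
    spectral parameter. *)
Lemma jost_large : exists K, forall lam, upper R lam -> forall x,
  cabs lam * cabs (v lam x) <= K /\ cabs lam * cabs (u lam x - 1) <= K.
Proof.
have [M [dq dp]] := pot; have [B B0 hB] := jost_bounded.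
have [hp1 hp2 _ [N hN]] := hp; have M0 := decays_ge0 dq; have N0 := decays_ge0 hN.
have pi0 := pi_ge0 R.
pose K := N * B + M * (M * B) + M * B.
have h1 : 0 <= N * B by exact: mulr_ge0.
have h2 : 0 <= M * B by exact: mulr_ge0.
have h3 : 0 <= M * (M * B) by exact: mulr_ge0.
have K0 : 0 <= K by rewrite !addr_ge0.
pose K1 := K + 2 * K * pi; have K10 : 0 <= K1 by rewrite addr_ge0 // !mulr_ge0.
have Hv lam : upper R lam -> forall x, cabs lam * cabs (v lam x) <= K1.
  move=> hl x; have [[_ V] cu cv] := jostP hl; have [_ i2 _ e2] := V x.
  pose D s := p s * u lam s.
  pose D' s := p' s * u lam s + p s * (q s * v lam s).
  have dD s : cder D s (D' s) by apply: cderM => //; have [] := jost_cder s hl.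
  have cD' : ccont D' by apply: ccontD; apply: ccontM => //; exact: ccontM.
  have bD s : cabs (D s) <= K * w s.
    have [hu hv] := hB _ hl s; have ws := ltW (w_gt0 s).
    apply: (@le_trans _ _ (M * B * w s)); last by rewrite ler_wpM2r // /K; lra.
    by rewrite cabsM mulrAC ler_pM ?cabs_ge0 ?(decays_w s dp).
  have bD' s : cabs (D' s) <= K * w s.
    have [hu hv] := hB _ hl s; have ws := ltW (w_gt0 s).
    apply: (@le_trans _ _ ((N * B + M * (M * B)) * w s)); last by rewrite ler_wpM2r // /K; lra.
    apply: le_trans (cabs_leD _ _) _; rewrite !cabsM mulrDl; apply: lerD.
      by rewrite mulrAC ler_pM ?cabs_ge0 ?(decays_w s hN).
    rewrite mulrAC ler_pM ?cabs_ge0 ?(decays_w s dp) ?mulr_ge0 ?cabs_ge0 //.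
    by rewrite ler_pM ?cabs_ge0 ?(decays_bounded dq).
  have [j1 j2] := osc_integral x (ler0n R 2) hl dD cD' bD bD'.
  have i3 : cintegrable (Ny x) (fun s => osc (2 * (x - s)) lam * D' s).
    have := cintegrableD (measurable_Ny x) j1 (cintegrableZ (2 * 'i%C * lam) (measurable_Ny x) i2).
    apply: eq_cintegrable => // s _; rewrite /D rmorph_nat; ring.
  have e3 : 2 * 'i%C * lam * v lam x = cintegral (Ny x) (fun s => osc (2 * (x - s)) lam * D' s) - D x.
    rewrite -j2 e2 add0r -cintegralB // -cintegralZ //.
    by apply: eq_cintegral => s _; rewrite /D rmorph_nat; ring.
  have : cabs (2 * 'i%C * lam * v lam x) <= K1.
    rewrite e3; apply: le_trans (cabs_leB _ _) _; rewrite /K1 addrC; apply: lerD.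
      apply: le_trans (bD x) _; rewrite -[leRHS]mulr1 ler_wpM2l ?w_le1 //.
    apply: cabs_cintegral_Ny_pi => // s sx; apply: le_trans (bD' s).
    by rewrite cabsM -[leRHS]mul1r ler_wpM2r ?cabs_ge0 // osc_kern.
  rewrite !cabsM cabs_i mulr1 -(rmorph_nat (real_complex R)) cabs_real normr_nat.
  have := mulr_ge0 (cabs_ge0 lam) (cabs_ge0 (v lam x)); lra.
exists (K1 + 2 * (M * K1) * pi) => lam hl x; split.
  by apply: le_trans (Hv _ hl x) _; rewrite lerDl !mulr_ge0.
have [[_ V] cu cv] := jostP hl; have [i1 _ e1 _] := V x.
apply: (@le_trans _ _ (2 * (M * K1) * pi)); last by rewrite lerDr.
rewrite -cabsM e1 [1 + _]addrC addrK -cintegralZ //.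
apply: cabs_cintegral_Ny_pi; [exact: cintegrableZ|exact: mulr_ge0|].
move=> s _; rewrite mulrCA cabsM mulrAC cabsM.
by apply: ler_pM (cabs_ge0 _) _ (decays_w s dq) (Hv _ hl s); rewrite mulr_ge0 ?cabs_ge0.
Qed.

(** The factor osc (x - s) lam, instead of osc (- s) lam, keeps the integral
    bounded uniformly over the closed upper half-plane. *)
Definition green_left (f1 f2 : R -> R[i]) (x : R) lam : R[i] :=
  cintegral (Ny x) (fun s => osc (x - s) lam * (u lam s * f2 s - v lam s * f1 s)).

Definition source (f : R -> R[i]) : Prop := ccont f /\ exists M, decays f M.

Lemma c1_decays_source f f' : c1_decays f f' -> source f /\ source f'.
Proof. by move=> h; have := c1_decays_cont h; case: h. Qed.

Lemma green_left_integrable f1 f2 x lam : upper R lam -> source f1 -> source f2 ->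
  cintegrable (Ny x) (fun s => osc (x - s) lam * (u lam s * f2 s - v lam s * f1 s)).
Proof.
move=> hl [cf1 [M1 d1]] [cf2 [M2 d2]].
have [B B0 hB] := jost_bounded; have [_ cu cv] := jostP hl.
apply: (@cintegrable_w _ _ _ (B * M2 + B * M1)) => //.
  apply: ccont_cmeasurable => //; apply: ccontM; first exact: ccont_osc1.
  by apply: ccontB; exact: ccontM.
move=> s /NyE sx; have [hu hv] := hB _ hl s.
rewrite cabsM -[leRHS]mul1r; apply: ler_pM; rewrite ?cabs_ge0 ?cabs_osc ?subr_ge0 //.
apply: le_trans (cabs_leB _ _) _; rewrite !cabsM mulrDl -!mulrA.
by apply: lerD; apply: ler_pM; rewrite ?cabs_ge0 // decays_w.
Qed.

Lemma green_left_dd f1 f2 x : source f1 -> source f2 ->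
  exists c, dd_bounded (upper R) c (green_left f1 f2 x).
Proof.
move=> s1 s2; have [cf1 [M1 d1]] := s1; have [cf2 [M2 d2]] := s2.
have [c c0 hc] := jost_dd x.
pose K := 36 * c * (M2 * (9 + 8 * x ^+ 2) + M1 * (9 + 8 * x ^+ 2)).
have M10 := decays_ge0 d1; have M20 := decays_ge0 d2.
have y0 : 0 <= 9 + 8 * x ^+ 2 by have := sqr_ge0 x; lra.
have K0 : 0 <= K by rewrite !mulr_ge0 // addr_ge0 // mulr_ge0.
exists (2 * K * pi); apply: (dd_bounded_cintegral (F := fun s lam => osc (x - s) lam * (u lam s * f2 s - v lam s * f1 s))) => //.
  by move=> l hl; exact: green_left_integrable.
move=> s sx; have t0 : 0 <= x - s by rewrite subr_ge0.
have [du dv] := hc s sx.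
have := dd_boundedM (dd_bounded_osc t0)
  (dd_boundedB (dd_boundedM du (dd_bounded_cst _ (f2 s))) (dd_boundedM dv (dd_bounded_cst _ (f1 s)))).
apply: dd_bounded_le.
have b1 := kern_bound d1 sx (lexx x).
have b2 := kern_bound d2 sx (lexx x).
have h : 1 + (x - s) ^+ 2 <= 1 + (2 * (x - s)) ^+ 2 by rewrite exprMn; have := sqr_ge0 (x - s); lra.
have e1 := le_trans (ler_wpM2l (cabs_ge0 (f1 s)) h) b1.
have e2 := le_trans (ler_wpM2l (cabs_ge0 (f2 s)) h) b2.
rewrite /K (_ : 3 * _ = 36 * c * (cabs (f2 s) * (1 + (x - s) ^+ 2) + cabs (f1 s) * (1 + (x - s) ^+ 2))); last by ring.
by rewrite -[leRHS]mulrA ler_wpM2l ?mulr_ge0 // mulrDl lerD.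
Qed.

Lemma green_left_lin (c : R[i]) f1 f2 g1 g2 x lam : upper R lam ->
  source f1 -> source f2 -> source g1 -> source g2 ->
  green_left (fun s => c * f1 s - g1 s) (fun s => c * f2 s - g2 s) x lam =
  c * green_left f1 f2 x lam - green_left g1 g2 x lam.
Proof.
move=> hl sf1 sf2 sg1 sg2.
have i1 := green_left_integrable x hl sf1 sf2.
have i2 := green_left_integrable x hl sg1 sg2.
rewrite /green_left -cintegralZ // -cintegralB //; last exact: cintegrableZ.
by apply: eq_cintegral => s _; ring.
Qed.

(** The pairing with (d/dx + i lam sigma3 - Q) h is a total derivative, since
    the coefficient matrix is traceless. *)
Lemma green_left_parts g1 g1' g2 g2' x lam : upper R lam ->
  c1_decays g1 g1' -> c1_decays g2 g2' ->
  green_left (fun s => g1' s + 'i%C * lam * g1 s - q s * g2 s)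
             (fun s => g2' s - 'i%C * lam * g2 s - p s * g1 s) x lam =
  u lam x * g2 x - v lam x * g1 x.
Proof.
move=> hl h1 h2; have [M [dq dp]] := pot; have [_ cu cv] := jostP hl.
have c1 := c1_decays_cont h1; have c2 := c1_decays_cont h2.
have [d1 c1' [M1 b1] [N1 b1']] := h1; have [d2 c2' [M2 b2] [N2 b2']] := h2.
have [B B0 hB] := jost_bounded.
have M0 := decays_ge0 dq; have M10 := decays_ge0 b1; have M20 := decays_ge0 b2.
have N10 := decays_ge0 b1'; have N20 := decays_ge0 b2'.
pose D s := u lam s * g2 s - v lam s * g1 s.
pose D' s := q s * v lam s * g2 s + u lam s * g2' s -
  ((2 * 'i%C * lam * v lam s + p s * u lam s) * g1 s + v lam s * g1' s).
have dD s : cder D s (D' s).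
  by have [e1 e2] := jost_cder s hl; apply: cderB; exact: cderM.
have cD' : ccont D'.
  apply: ccontB; apply: ccontD; apply: ccontM => //; first exact: ccontM.
  by apply: ccontD; apply: ccontM => //; apply: ccont_cst.
pose L := cabs (2 * 'i%C * lam).
pose K := B * M2 + B * M1 + (M * B * M2 + B * N2 + ((L * B + M * B) * M1 + B * N1)).
have L0 : 0 <= L by exact: cabs_ge0.
have P1 : 0 <= B * M2 + B * M1 by rewrite addr_ge0 // mulr_ge0.
have P2 : 0 <= M * B * M2 + B * N2 + ((L * B + M * B) * M1 + B * N1).
  by rewrite !addr_ge0 // !mulr_ge0 // addr_ge0 // mulr_ge0.
have bD s : cabs (D s) <= K * w s.
  have [hu hv] := hB _ hl s; have ws := ltW (w_gt0 s).
  apply: (@le_trans _ _ ((B * M2 + B * M1) * w s)); last by rewrite ler_wpM2r // /K lerDl.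
  apply: le_trans (cabs_leB _ _) _; rewrite !cabsM mulrDl -!mulrA.
  by apply: lerD; apply: ler_pM; rewrite ?cabs_ge0 // decays_w.
have bD' s : cabs (D' s) <= K * w s.
  have [hu hv] := hB _ hl s; have ws := ltW (w_gt0 s).
  apply: (@le_trans _ _ ((M * B * M2 + B * N2 + ((L * B + M * B) * M1 + B * N1)) * w s));
    last by rewrite ler_wpM2r // /K lerDr.
  have qs := decays_bounded dq s; have ps := decays_bounded dp s.
  have m1 : cabs (q s * v lam s) <= M * B by rewrite cabsM ler_pM ?cabs_ge0.
  have m2 : cabs (2 * 'i%C * lam * v lam s + p s * u lam s) <= L * B + M * B.
    apply: le_trans (cabs_leD _ _) _; rewrite cabsM [cabs (p s * _)]cabsM.
    by apply: lerD; apply: ler_pM; rewrite ?cabs_ge0.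
  apply: le_trans (cabs_leB _ _) _; rewrite [leRHS]mulrDl; apply: lerD;
    apply: le_trans (cabs_leD _ _) _; rewrite [leRHS]mulrDl; apply: lerD;
    rewrite cabsM -[leRHS]mulrA; apply: ler_pM; rewrite ?cabs_ge0 // decays_w //.
have [_ E] := osc_integral x ler01 hl dD cD' bD bD'; rewrite -[RHS]/(D x) -E.
apply: eq_cintegral => s _; rewrite mul1r rmorph1 /D' /D; ring.
Qed.

End OnePotential.
End Jost.

(** * A Cauchy theorem for the upper half-plane *)

Section QuadraticRemainder.
Context {R : realType}.

Lemma is_derive_quadratic (h : R -> R) (y d c e : R) : 0 < e ->
  (forall z, `|z - y| < e -> `|h z - h y - (z - y) * d| <= c * (z - y) ^+ 2) ->
  is_derive y 1 h d.
Proof.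
move=> e0 H.
have L : (fun t : R => t^-1 *: (h (t *: 1 + y) - h y)) @ 0^' --> d.
  apply/cvgrPdist_le => eps eps0.
  have c0 : 0 < `|c| + 1 by have := normr_ge0 c; lra.
  near=> t.
  have tn0 : t != 0 by near: t; exact: nbhs_dnbhs_neq.
  have te : `|t| < e by near: t; exact: dnbhs0_lt.
  have tc : `|t| < eps / (`|c| + 1) by near: t; apply: dnbhs0_lt; exact: divr_gt0.
  have := H (t + y); rewrite addrK => /(_ te) hh.
  rewrite /GRing.scale /= mulr1 distrC.
  rewrite (_ : _ - d = t^-1 * (h (t + y) - h y - t * d)); last first.
    by rewrite [RHS]mulrBr mulKf.
  rewrite normrM normfV ler_pdivrMl ?normr_gt0 //.
  apply: le_trans hh _; rewrite -(real_normK (num_real t)).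
  have t0 := normr_ge0 t; have := ler_norm c.
  move: tc; rewrite ltr_pdivlMr // => tc cn.
  have : c * `|t| <= eps by nra.
  by rewrite expr2 => h1; nra.
apply: DeriveDef; first by apply/cvg_ex; exists d; exact: L.
by rewrite /derive; apply: cvg_lim.
Unshelve. all: by end_near. Qed.

Lemma cder_quadratic (f : R -> R[i]) (y c e : R) (d : R[i]) : 0 < e ->
  (forall z, `|z - y| < e -> cabs (f z - f y - (z - y)%:C * d) <= c * (z - y) ^+ 2) ->
  cder f y d.
Proof.
move=> e0 H; split; apply: (is_derive_quadratic (c := c) e0) => z /H; apply: le_trans.
  by have := Re_le_cabs (f z - f y - (z - y)%:C * d); rewrite !ReImE /= mul0r subr0.
by have := Im_le_cabs (f z - f y - (z - y)%:C * d); rewrite !ReImE /= mul0r addr0.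
Qed.

(** A bounded second divided difference makes the difference quotients along
    the imaginary direction converge geometrically, and gives a quadratic
    remainder. *)
Lemma dd_bounded_derivative (Om : set R[i]) (c : R) (F : R[i] -> R[i]) (l : R[i]) (N : nat) :
  dd_bounded Om c F -> Om l -> (forall k, Om (l + 'i%C * (2^-1 ^+ (k + N))%:C)) ->
  exists d, forall m, Om m -> cabs (F m - F l - d * (m - l)) <= c * cabs (m - l) ^+ 2.
Proof.
move=> [h0 h1 h2] hl hk.
have c0 : 0 <= c by exact: le_trans (cabs_ge0 _) (h0 _ hl).
pose t (k : nat) : R := 2^-1 ^+ (k + N).
have t0 k : 0 < t k by rewrite exprn_gt0 // invr_gt0.
have tS k : t k = 2 * t k.+1 by rewrite /t addSn exprS mulrA divff // mul1r.
have tle k : t k <= 2^-1 ^+ k.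
  by rewrite /t exprD -[leRHS]mulr1 ler_wpM2l ?exprn_ge0 ?invr_ge0 // exprn_ile1 ?invr_ge0 // invf_le1 // ler1n.
pose h k : R[i] := 'i%C * (t k)%:C.
have hn k : h k != 0 by rewrite -cabs_gt0 cabsM cabs_i mul1r cabs_real gtr0_norm.
have ch k : cabs (h k) = t k by rewrite cabsM cabs_i mul1r cabs_real gtr0_norm.
pose z k := (F (l + h k) - F l) / h k.
have dz m k : Om m -> cabs ((F m - F l) - z k * (m - l)) <= c * cabs (m - l) * cabs (m - (l + h k)).
  move=> hm; have := h2 _ _ _ hl hm (hk k).
  rewrite -/(h k) /dd2 addrAC subrr add0r ch => H.
  rewrite (_ : _ - _ * _ = ((F m - F l) * h k - (F (l + h k) - F l) * (m - l)) / h k); last first.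
    by rewrite /z; field.
  rewrite cabsM cabsV ch ler_pdivrMr //; apply: le_trans H _.
  by rewrite le_eqVlt; apply/orP; left; apply/eqP; ring.
have [|d hd] := @cgeometric_cvg _ z c c0.
  move=> k; have := dz _ k (hk k.+1); rewrite -/(h k.+1).
  have e1 : l + h k.+1 - l = h k.+1 by ring.
  have e2 : l + h k.+1 - (l + h k) = - h k.+1.
    by rewrite /h (tS k) rmorphM rmorph_nat /=; ring.
  rewrite e1 e2.
  rewrite (_ : F _ - F l - _ = (z k.+1 - z k) * h k.+1); last by rewrite /z; field; rewrite !hn.
  rewrite cabsM cabsN !ch => H.
  have : cabs (z k.+1 - z k) <= c * t k.+1 by rewrite -(ler_pM2r (t0 k.+1)).
  move/le_trans; apply; rewrite -exprVn ler_wpM2l //.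
  by apply: le_trans (tle k); rewrite (tS k); have := t0 k.+1; lra.
exists d => m hm; set x := cabs (m - l).
have x0 : 0 <= x by exact: cabs_ge0.
apply: (@le_pow2 _ _ _ (c * x + 4 * c * x)) => k.
rewrite (_ : _ - _ * _ = ((F m - F l) - z k * (m - l)) + (z k - d) * (m - l)); last by ring.
apply: le_trans (cabs_leD _ _) _; rewrite cabsM -/x.
have a1 := dz m k hm; have a2 := hd k.
have a3 : cabs (m - (l + h k)) <= x + t k.
  by rewrite opprD addrA -ch; exact: cabs_leB.
have a4 := ler_wpM2l (mulr_ge0 c0 x0) a3.
have a5 := ler_wpM2r x0 a2.
have a6 := ler_wpM2l (mulr_ge0 c0 x0) (tle k).
rewrite mulrDl -exprVn.
have -> : c * x * 2^-1 ^+ k + 4 * c * x * 2^-1 ^+ k = c * x * 2^-1 ^+ k + 4 * c / 2 ^+ k * x.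
  by rewrite -exprVn; ring.
rewrite -/x in a1; rewrite expr2; nra.
Qed.

Lemma pow_half_small (e : R) : 0 < e -> exists N : nat, forall k, 2^-1 ^+ (k + N) < e.
Proof.
move=> e0; have hn := truncnS_gt e^-1; set n := (Num.truncn e^-1).+1 in hn.
exists n => k; apply: (@le_lt_trans _ _ (2^-1 ^+ n)).
  rewrite exprD -[leRHS]mul1r ler_wpM2r ?exprn_ge0 ?invr_ge0 //.
  by rewrite exprn_ile1 ?invr_ge0 // invf_le1 // ler1n.
rewrite exprVn -[e]invrK ltf_pV2 ?posrE ?exprn_gt0 ?invr_gt0 //.
apply: lt_le_trans hn _; rewrite -natrX ler_nat; exact: ltnW (ltn_expl _ _).
Qed.

(** Complex differentiability relative to the closed upper half-plane, with a
    quadratic remainder. *)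
Definition has_der (g : R[i] -> R[i]) (l d : R[i]) : Prop :=
  exists2 e : R, 0 < e & exists c : R, forall m, upper R m -> cabs (m - l) < e ->
    cabs (g m - g l - d * (m - l)) <= c * cabs (m - l) ^+ 2.

Definition near_upper (l : R[i]) (e : R) : set R[i] :=
  [set z | upper R z /\ cabs (z - l) < e].

Lemma upper_addi (l : R[i]) (t : R) : upper R l -> 0 <= t -> upper R (l + 'i%C * t%:C).
Proof. by move=> hl t0; rewrite /upper /= ReImE /= !mul0r !add0r mul1r addr_ge0. Qed.

Lemma dd_bounded_has_der g (l0 : R[i]) (e c : R) : dd_bounded (near_upper l0 e) c g ->
  forall l, near_upper l0 e l -> exists2 d, has_der g l d &
    forall m, near_upper l0 e m -> cabs (g m - g l - d * (m - l)) <= c * cabs (m - l) ^+ 2.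
Proof.
move=> hg l [hl1 hl2].
have e0 : 0 < e - cabs (l - l0) by lra.
have [N hN] := pow_half_small e0.
have [||d hd] := dd_bounded_derivative (l := l) (N := N) hg; first by split.
  move=> k; split; first by apply: upper_addi; rewrite ?exprn_ge0 ?invr_ge0.
  rewrite addrAC; apply: le_lt_trans (cabs_leD _ _) _.
  rewrite cabsM cabs_i mul1r cabs_real ger0_norm ?exprn_ge0 ?invr_ge0 //.
  by have := hN k; lra.
exists d => //; exists (e - cabs (l - l0)) => //; exists c => m hm ml; apply: hd; split => //.
rewrite (_ : m - l0 = (m - l) + (l - l0)); last by ring.
by apply: le_lt_trans (cabs_leD _ _) _; lra.
Qed.

Lemma has_der_unique g l d d' : upper R l -> has_der g l d -> has_der g l d' -> d = d'.
Proof.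
move=> hl [e e0 [c hc]] [e' e0' [c' hc']].
have [N hN] := pow_half_small e0; have [N' hN'] := pow_half_small e0'.
apply/eqP; rewrite -subr_eq0 -cabs_eq0 eq_le cabs_ge0 andbT.
apply: (@le_pow2 _ _ _ (`|c| + `|c'|)) => k; rewrite add0r.
pose t : R := 2^-1 ^+ (k + N + N').
have t0 : 0 < t by rewrite exprn_gt0 // invr_gt0.
have tk : t <= 2^-1 ^+ k.
  rewrite /t -addnA exprD -[leRHS]mulr1 ler_wpM2l ?exprn_ge0 ?invr_ge0 //.
  by rewrite exprn_ile1 ?invr_ge0 // invf_le1 // ler1n.
pose h : R[i] := 'i%C * t%:C.
have ch : cabs h = t by rewrite cabsM cabs_i mul1r cabs_real gtr0_norm.
have hm : upper R (l + h) by apply: upper_addi => //; exact: ltW.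
have mh : l + h - l = h by rewrite addrAC subrr add0r.
have te : t < e by rewrite /t addnAC; exact: hN.
have te' : t < e' by exact: hN'.
have := hc _ hm; rewrite mh ch => /(_ te) h1.
have := hc' _ hm; rewrite mh ch => /(_ te') h2.
have h3 : cabs ((d - d') * h) <= (`|c| + `|c'|) * t ^+ 2.
  rewrite (_ : _ * h = (g (l + h) - g l - d' * h) - (g (l + h) - g l - d * h)); last by ring.
  apply: le_trans (cabs_leB _ _) _.
  have := ler_norm c; have := ler_norm c'; have := sqr_ge0 t; nra.
move: h3; rewrite cabsM ch expr2 mulrA ler_pM2r // => h3.
by apply: le_trans h3 _; rewrite -exprVn ler_wpM2l.
Qed.

End QuadraticRemainder.

Section RealTools.
Context {R : realType}.
Notation mu := (@lebesgue_measure R).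

(** Continuity bridges the finitely many exceptional points. *)
Lemma mean_value_except (h : R -> R) (K a b : R) (E : seq R) : continuous h ->
  (forall y : R, a < y < b -> y \notin E -> exists2 d : R, is_derive y 1 h d & `|d| <= K) ->
  a <= b -> `|h b - h a| <= K * (b - a).
Proof.
move=> ch; elim: E a b => [|e E IH] a b H ab.
  move: ab; rewrite le_eqVlt => /orP[/eqP ->|ab]; first by rewrite !subrr normr0 mulr0.
  have H' y : y \in `]a, b[ -> is_derive y 1 h (derive1 h y) /\ `|derive1 h y| <= K.
    rewrite in_itv /= => /H [] // d hd dK.
    have -> : derive1 h y = d by rewrite derive1E; exact: derive_val.
    by [].
  have [c cI ->] := MVT ab (fun y yI => proj1 (H' y yI)) (continuous_subspaceT (fun x => ch x)).
  rewrite normrM (ger0_norm (x := b - a)); last by rewrite subr_ge0 ltW.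
  by rewrite ler_wpM2r ?subr_ge0 ?(ltW ab) //; have [] := H' c cI.
have [/andP[ae eb]|he] := boolP (a < e < b).
  have h1 : `|h e - h a| <= K * (e - a).
    apply: IH; last exact: ltW.
    move=> y /andP[ay ye] yE; apply: H; first by rewrite ay (lt_trans ye).
    by rewrite inE negb_or yE andbT lt_eqF.
  have h2 : `|h b - h e| <= K * (b - e).
    apply: IH; last exact: ltW.
    move=> y /andP[ey yb] yE; apply: H; first by rewrite yb (lt_trans ae).
    by rewrite inE negb_or yE andbT gt_eqF.
  rewrite (_ : h b - h a = (h b - h e) + (h e - h a)); last by ring.
  by apply: le_trans (ler_normD _ _) _; lra.
apply: IH => // y yI yE; apply: H => //; rewrite inE negb_or yE andbT.
by apply: contraNneq he => <-.
Qed.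

Lemma measurable_seq (s : seq R) :
  measurable ([set` s] : set R) /\ forall h : R -> R, measurable_fun [set` s] h.
Proof.
elim: s => [|x s [IH1 IH2]].
  by rewrite classical_sets.set_nil; split => // h; exact: measurable_fun_set0.
have -> : [set` x :: s] = [set x] `|` [set` s] :> set R.
  apply/seteqP; split => y /=; rewrite inE; first by case/orP => [/eqP|]; [left|right].
  by case=> [->|->]; rewrite ?eqxx ?orbT.
split; first by apply: measurableU.
by move=> h; apply/measurable_funU => //; split => //; exact: measurable_fun_set1.
Qed.

Lemma cmeasurable_except (F : R -> R[i]) (s : seq R) :
  (forall x, x \notin s -> {for x, continuous (fun y => complex.Re (F y))} /\
      {for x, continuous (fun y => complex.Im (F y))}) ->
  cmeasurable setT F.
Proof.
move=> H; have [m1 m2] := measurable_seq s.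
have aux (h : R -> R) : (forall x, x \notin s -> {for x, continuous h}) -> measurable_fun setT h.
  move=> ch; rewrite -(setUv [set` s]); apply/measurable_funU => //.
    exact: measurableC.
  split=> //; apply: open_continuous_measurable_fun.
    apply: closed_openC.
    have /accessible_finite_set_closed := hausdorff_accessible (@Rhausdorff R).
    by apply; exact: finite_seq.
  by move=> x; rewrite inE /= => xs; apply: ch; apply/negP.
by split; apply: aux => x /H [].
Qed.

(** Uniformity over a compact interval of a local property which improves as
    its real parameter decreases. *)
Lemma tube (Q : R -> R -> Prop) (a b : R) :
  (forall e e' x, 0 < e' -> e' <= e -> Q e x -> Q e' x) ->
  (forall x, a <= x <= b -> exists2 e : R, 0 < e & forall y, `|y - x| < e -> Q e y) ->
  exists2 e : R, 0 < e & forall x, a <= x <= b -> Q e x.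
Proof.
move=> mono loc.
have /compact_near_coveringP cov := @segment_compact R a b.
have H : \forall e \near (0 : R)^'+, `[a, b]%classic `<=` Q e.
  apply: cov => x; rewrite /= in_itv /= => /loc [e e0 He].
  exists (ball x e, [set e' | 0 < e' /\ e' <= e]) => /=.
    split; first exact: nbhsx_ballx.
    exact: filterI (nbhs_right_gt 0) (nbhs_right_le e0).
  case=> x' e' [/= h1 [h2 h3]]; apply: (mono e) => //.
  by apply: He; rewrite distrC.
have H2 : \forall e \near (0 : R)^'+, `[a, b]%classic `<=` Q e /\ 0 < e.
  by apply: filterI => //; exact: nbhs_right_gt.
have /filter_ex : (at_right (0 : R)) (fun e => `[a, b]%classic `<=` Q e /\ 0 < e) by exact: H2.
case=> e [He e0].
by exists e => // x xI; apply: He; rewrite /= in_itv.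
Qed.

End RealTools.
Section CompactInterval.
Context {R : realType}.
Notation mu := (@lebesgue_measure R).

Definition segm (r : R) : set (measurableTypeR R) := [set` `[- r, r]].

Lemma measurable_segm r : measurable (segm r).
Proof. exact: measurable_itv. Qed.
Hint Resolve measurable_segm : core.

Lemma segmE r x : segm r x <-> - r <= x <= r.
Proof. by rewrite /segm /= in_itv. Qed.

Lemma integrable_cst_segm (r K : R) : mu.-integrable (segm r) (EFin \o cst K).
Proof.
apply/integrableP; split; first by apply/measurable_EFinP; exact: measurable_cst.
rewrite /= integral_cst //= lebesgue_measure_itv /=.
by case: ifP => _; rewrite ?mule0 ?ltry // -EFinB -EFinM ltry.
Qed.

Lemma cabs_cintegral_segm (F : R -> R[i]) (r K : R) : 0 <= r ->
  cintegrable (segm r) F -> (forall x, - r <= x <= r -> cabs (F x) <= K) ->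
  cabs (cintegral (segm r) F) <= 4 * K * r.
Proof.
move=> r0 iF H.
have := cabs_cintegral_le (measurable_segm r) iF (integrable_cst_segm r K).
have -> : \int[mu]_(x in segm r) (cst K) x = K * fine (mu (segm r)).
  exact: Rintegral_cst.
rewrite /segm lebesgue_measure_itv /= lte_fin.
case: ifPn => [_|]; last first.
  rewrite -leNgt => hr; have -> : r = 0 by lra.
  by rewrite !mulr0 => h; apply: h => x /segmE; move: (H x); rewrite (_ : r = 0) //; lra.
rewrite -EFinB /= opprK => h; apply: (le_trans (h _)); last first.
  by rewrite le_eqVlt; apply/orP; left; apply/eqP; ring.
by move=> x /segmE; exact: H.
Qed.

Lemma cintegral_segm_cder (F F' : R -> R[i]) (r : R) : 0 < r ->
  (forall x, cder F x (F' x)) -> ccont F' ->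
  cintegral (segm r) F' = F r - F (- r).
Proof.
move=> r0 dF [c1 c2]; have [d1 d2] := cder_cont dF.
have aux (h h' : R -> R) : (forall x : R, is_derive x 1 h (h' x)) -> continuous h ->
    continuous h' -> \int[mu]_(x in segm r) h' x = h r - h (- r).
  move=> dh ch ch'; rewrite /Rintegral (@continuous_FTC2 _ _ h) //; first by lra.
  - exact: continuous_subspaceT.
  - split.
    + by move=> x _; exact: (@ex_derive _ _ _ _ _ _ _ (dh x)).
    + by apply: cvg_at_right_filter; exact: ch.
    + by apply: cvg_at_left_filter; exact: ch.
  - by move=> x _; rewrite derive1E; exact: (@derive_val _ _ _ _ _ _ _ (dh x)).
apply: complex_eq; rewrite !ReImE /=.
  by apply: (aux (fun x => complex.Re (F x))) => // x; have [] := dF x.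
by apply: (aux (fun x => complex.Im (F x))) => // x; have [] := dF x.
Qed.

Lemma lipschitz_continuous (F : R -> R[i]) (x e c : R) : 0 < e ->
  (forall z, `|z - x| < e -> cabs (F z - F x) <= c * `|z - x|) ->
  {for x, continuous (fun y => complex.Re (F y))} /\
  {for x, continuous (fun y => complex.Im (F y))}.
Proof.
move=> e0 H.
have K (eps : R) : 0 < eps -> exists2 d : R, 0 < d & forall z, `|z - x| < d -> cabs (F z - F x) < eps.
  move=> eps0; have c0 : 0 < `|c| + 1 by have := normr_ge0 c; lra.
  exists (Num.min e (eps / (`|c| + 1))).
    by rewrite lt_min e0 divr_gt0.
  move=> z; rewrite lt_min => /andP[h1]; rewrite ltr_pdivlMr // => h2.
  apply: le_lt_trans (H z h1) _; have := ler_norm c; have := normr_ge0 (z - x); nra.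
split; apply/cvgrPdist_lt => eps eps0; have [d d0 Hd] := K _ eps0;
  exists d => //= z /=; rewrite distrC => /(Hd z); apply: le_lt_trans.
  by have := Re_le_cabs (F z - F x); rewrite !ReImE distrC.
by have := Im_le_cabs (F z - F x); rewrite !ReImE distrC.
Qed.

(** Exhaustion of the line by compact intervals. *)
Lemma cintegral_segm_cvg (F : R -> R[i]) (K r : R) : 0 <= r ->
  cmeasurable setT F -> (forall x, cabs (F x) <= K * w x) ->
  cabs (cintegral setT F - cintegral (segm r) F) <= 4 * K * (atan (- r) + pi / 2).
Proof.
move=> r0 mF bF.
have iF : cintegrable setT F by apply: (cintegrable_w (K := K)).
have split_Ny (h : R -> R) : mu.-integrable setT (EFin \o h) ->
    \int[mu]_(s in Ny r) h s = \int[mu]_(s in Ny (- r)) h s + \int[mu]_(s in segm r) h s.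
  move=> ih; have ir : mu.-integrable (Ny r) (EFin \o h) by apply: integrableS ih.
  have := @Rintegral_itvB _ h -oo%O (BRight r) (- r) ir.
  rewrite bnd_simp => /(_ isT); rewrite bnd_simp => /(_ _) hh.
  have le : - r <= r by lra.
  move: (hh le); rewrite Rintegral_itv_obnd_cbnd; last by apply: integrableS ih.
  by move=> <-; rewrite addrC subrK.
have e : cintegral (Ny r) F = cintegral (Ny (- r)) F + cintegral (segm r) F.
  by case: iF => i1 i2; apply: complex_eq; rewrite ReImE /=; exact: split_Ny.
rewrite (cintegral_split r iF) e.
rewrite (_ : _ - _ = cintegral (Ny (- r)) F + cintegral (cy r) F); last by ring.
have iN x : cintegrable (Ny x) F by exact: cintegrableS iF.
have ic : cintegrable (cy r) F by exact: cintegrableS iF.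
have ic' : cintegrable (Ny (- r)) (fun x => F (- x)).
  by apply: (cintegrable_reflect (D := cy r)) => //; exact: opp_preimage_cy.
have <- : cintegral (Ny (- r)) (fun x => F (- x)) = cintegral (cy r) F.
  by apply: cintegral_reflect => //; exact: opp_preimage_cy.
apply: le_trans (cabs_leD _ _) _.
have h1 := cabs_cintegral_Ny (iN (- r)) (fun s _ => bF s).
have h2 : cabs (cintegral (Ny (- r)) (fun x => F (- x))) <= 2 * K * (atan (- r) + pi / 2).
  by apply: cabs_cintegral_Ny => // s _; rewrite -w_opp; exact: bF.
lra.
Qed.

End CompactInterval.
#[global] Hint Resolve measurable_segm : core.

Section HalfPlane.
Context {R : realType}.
Notation mu := (@lebesgue_measure R).
Variables (g : R[i] -> R[i]) (Z : seq R[i]) (rho Cd : R).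
Hypothesis decay : forall l, upper R l -> rho <= cabs l -> cabs (g l) <= Cd / cabs l ^+ 2.
Hypothesis bnd : forall l, upper R l -> exists2 e : R, 0 < e & exists c : R,
  forall m, upper R m -> cabs (m - l) < e -> cabs (g m) <= c.
Hypothesis loc : forall l, upper R l -> l \notin Z ->
  exists2 e : R, 0 < e & exists c : R, dd_bounded (near_upper l e) c g.
Hypothesis rho0 : 0 < rho.

(** The complex derivative of g, as a definite description. *)
Let gp l : R[i] := xget 0 [set d | has_der g l d].

Lemma gp_eq l d : upper R l -> has_der g l d -> gp l = d.
Proof.
move=> hl hd; have hgp : has_der g l (gp l).
  exact: (@xgetPex _ 0 [set d | has_der g l d] (ex_intro _ d hd)).
exact: has_der_unique hl hgp hd.
Qed.

(** The last bound adds the expansions of g m at l' and of g l' at m. *)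
Lemma gp_loc l : upper R l -> l \notin Z -> exists2 e : R, 0 < e & exists2 c : R, 0 <= c &
  forall l' m, near_upper l e l' -> near_upper l e m ->
  [/\ cabs (g m - g l' - gp l' * (m - l')) <= c * cabs (m - l') ^+ 2,
      cabs (g m - g l') <= c * cabs (m - l') &
      cabs (gp m - gp l') <= 2 * c * cabs (m - l')].
Proof.
move=> hl lZ; have [e e0 [c hc]] := loc hl lZ.
exists e => //.
have c0 : 0 <= c.
  case: hc => h _ _; apply: le_trans (cabs_ge0 _) (h l _).
  by split => //; rewrite subrr cabs0.
exists c => // l' m hl' hm.
have E a b : near_upper l e a -> near_upper l e b ->
    cabs (g b - g a - gp a * (b - a)) <= c * cabs (b - a) ^+ 2.
  move=> ha hb; have [d hd1 hd2] := dd_bounded_has_der hc ha.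
  by rewrite (gp_eq (proj1 ha) hd1); exact: hd2.
split; [exact: E|by case: hc => _ h _; exact: h|].
have [->|ml] := eqVneq m l'; first by rewrite !subrr cabs0 mulr0.
have p0 : 0 < cabs (m - l') by rewrite cabs_gt0 subr_eq0.
rewrite -(ler_pM2r p0) -cabsM.
have h1 := E _ _ hl' hm; have h2 := E _ _ hm hl'.
rewrite (cabsB l' m) (cabsB (g l' - g m)) in h2.
rewrite (_ : _ * _ = (g m - g l' - gp l' * (m - l')) - (gp m * (l' - m) - (g l' - g m))); last by ring.
apply: le_trans (cabs_leB _ _) _.
set X := cabs (m - l') in h1 h2 *.
rewrite (_ : 2 * c * X * X = c * X ^+ 2 + c * X ^+ 2); last by ring.
exact: lerD.
Qed.

Definition line (x y : R) : R[i] := Complex x y.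

Lemma line_upper x y : 0 <= y -> upper R (line x y). Proof. by []. Qed.

Lemma line_dist x y x' y' : cabs (line x y - line x' y') <= `|x - x'| + `|y - y'|.
Proof. exact: cabs_le_ReIm (line x y - line x' y'). Qed.

Lemma line_subx x x' y : line x y - line x' y = (x - x')%:C.
Proof. by apply: complex_eq => /=; rewrite ?subrr. Qed.

Lemma line_suby x y y' : line x y - line x y' = 'i%C * (y - y')%:C.
Proof. by apply: complex_eq => /=; ring. Qed.

Let heights := map (@complex.Im R) Z.
Let feet := map (@complex.Re R) Z.

Lemma off_heights x y : y \notin heights -> line x y \notin Z.
Proof. by apply: contraNN => h; apply/mapP; exists (line x y). Qed.

Lemma off_feet x y : x \notin feet -> line x y \notin Z.
Proof. by apply: contraNN => h; apply/mapP; exists (line x y). Qed.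

Lemma g_line_cder x y : 0 <= y -> y \notin heights ->
  cder (fun x => g (line x y)) x (gp (line x y)).
Proof.
move=> y0 yh; have [e e0 [c c0 H]] := gp_loc (line_upper x y0) (off_heights x yh).
apply: (cder_quadratic (c := c) e0) => z zx.
have n1 : near_upper (line x y) e (line x y) by split => //; rewrite subrr cabs0.
have n2 : near_upper (line x y) e (line z y) by split => //; rewrite line_subx cabs_real.
have [h _ _] := H _ _ n1 n2.
by move: h; rewrite line_subx cabs_real real_normK ?num_real // mulrC.
Qed.

Lemma gp_line_cont y : 0 <= y -> y \notin heights -> ccont (fun x => gp (line x y)).
Proof.
move=> y0 yh; split => x; have [e e0 [c c0 H]] := gp_loc (line_upper x y0) (off_heights x yh);
  have [] := @lipschitz_continuous _ (fun x => gp (line x y)) x e (2 * c) e0 _ => // z zx;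
  have n1 : near_upper (line x y) e (line x y) by [split => //; rewrite subrr cabs0];
  have n2 : near_upper (line x y) e (line z y) by [split => //; rewrite line_subx cabs_real];
  by have [_ _] := H _ _ n1 n2; rewrite line_subx cabs_real.
Qed.

(** Local bounds made uniform by compactness of [-r, r]; the radius e and the
    bound 1 / e are tied so that [tube] applies. *)
Lemma strip_bound r y0 : 0 <= y0 -> exists2 e : R, 0 < e & exists c : R,
  forall x y, - r <= x <= r -> 0 <= y -> `|y - y0| < e -> cabs (g (line x y)) <= c.
Proof.
move=> y00.
have [||e e0 He] := @tube R (fun e x => forall y, 0 <= y -> `|y - y0| < e -> cabs (g (line x y)) <= e^-1) (- r) r.
- move=> e e' x e0 ee H y yy ye; apply: le_trans (H y yy (lt_le_trans ye ee)) _.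
  by rewrite lef_pV2 ?posrE // (lt_le_trans e0).
- move=> x _; have [e e0 [c H]] := bnd (line_upper x y00).
  have c0 : 0 < `|c| + 1 by have := normr_ge0 c; lra.
  exists (Num.min (e / 2) (`|c| + 1)^-1); first by rewrite lt_min invr_gt0 c0 andbT divr_gt0.
  move=> x'; rewrite lt_min => /andP[h1 _] y yy; rewrite lt_min => /andP[h2 _].
  apply: (@le_trans _ _ c).
    by apply: H => //; apply: le_lt_trans (line_dist _ _ _ _) _; lra.
  apply: (@le_trans _ _ (`|c| + 1)); first by have := ler_norm c; lra.
  rewrite -[leLHS]invrK lef_pV2 ?posrE ?invr_gt0 // ?ge_min ?lexx ?orbT //.
  by rewrite lt_min invr_gt0 c0 andbT divr_gt0.
- by exists e => //; exists e^-1 => x y xr yy ye; exact: He.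
Qed.

Lemma strip_der r y0 : 0 <= y0 -> y0 \notin heights -> exists2 e : R, 0 < e & exists c : R,
  forall x y, - r <= x <= r -> 0 <= y -> `|y - y0| < e ->
  cabs (g (line x y) - g (line x y0) - (y - y0)%:C * ('i%C * gp (line x y0))) <= c * (y - y0) ^+ 2.
Proof.
move=> y00 yh.
have [||e e0 He] := @tube R (fun e x => forall y, 0 <= y -> `|y - y0| < e ->
  cabs (g (line x y) - g (line x y0) - (y - y0)%:C * ('i%C * gp (line x y0))) <= e^-1 * (y - y0) ^+ 2) (- r) r.
- move=> e e' x e0 ee H y yy ye; apply: le_trans (H y yy (lt_le_trans ye ee)) _.
  by rewrite ler_wpM2r ?sqr_ge0 // lef_pV2 ?posrE // (lt_le_trans e0).
- move=> x _; have [e e0 [c c0 H]] := gp_loc (line_upper x y00) (off_heights x yh).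
  have c1 : 0 < c + 1 by lra.
  exists (Num.min (e / 2) (c + 1)^-1); first by rewrite lt_min invr_gt0 c1 andbT divr_gt0.
  move=> x'; rewrite lt_min => /andP[h1 _] y yy; rewrite lt_min => /andP[h2 _].
  have n1 : near_upper (line x y0) e (line x' y0).
    by split => //; apply: le_lt_trans (line_dist _ _ _ _) _; rewrite subrr normr0; lra.
  have n2 : near_upper (line x y0) e (line x' y).
    by split => //; apply: le_lt_trans (line_dist _ _ _ _) _; lra.
  have [h _ _] := H _ _ n1 n2; move: h.
  rewrite line_suby cabsM cabs_i mul1r cabs_real real_normK ?num_real //.
  rewrite (_ : gp _ * _ = (y - y0)%:C * ('i%C * gp (line x' y0))); last by ring.
  move/le_trans; apply; rewrite ler_wpM2r ?sqr_ge0 //.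
  apply: (@le_trans _ _ (c + 1)); first lra.
  rewrite -[leLHS]invrK lef_pV2 ?posrE ?invr_gt0 // ?ge_min ?lexx ?orbT //.
  by rewrite lt_min invr_gt0 c1 andbT divr_gt0.
- by exists e => //; exists e^-1 => x y xr yy ye; exact: He.
Qed.

Lemma g_line_continuous_x (y x : R) : 0 <= y -> x \notin feet ->
  {for x, continuous (fun x => complex.Re (g (line x y)))} /\
  {for x, continuous (fun x => complex.Im (g (line x y)))}.
Proof.
move=> y0 xf; have [e e0 [c c0 H]] := gp_loc (line_upper x y0) (off_feet y xf).
apply: (@lipschitz_continuous _ (fun x => g (line x y)) x e c e0) => z zx.
have n1 : near_upper (line x y) e (line x y) by split => //; rewrite subrr cabs0.
have n2 : near_upper (line x y) e (line z y) by split => //; rewrite line_subx cabs_real.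
by have [_ + _] := H _ _ n1 n2; rewrite line_subx cabs_real.
Qed.

Lemma g_line_continuous_y (y x : R) : x \notin feet ->
  {for y, continuous (fun y => complex.Re (g (line x `|y|)))} /\
  {for y, continuous (fun y => complex.Im (g (line x `|y|)))}.
Proof.
move=> xf; have [e e0 [c c0 H]] := gp_loc (line_upper x (normr_ge0 y)) (off_feet `|y| xf).
apply: (@lipschitz_continuous _ (fun y => g (line x `|y|)) y e c e0) => z zy.
have d : cabs (line x `|z| - line x `|y|) <= `|z - y|.
  by rewrite line_suby cabsM cabs_i mul1r cabs_real ler_dist_dist.
have n1 : near_upper (line x `|y|) e (line x `|y|).
  by split; [exact: line_upper|rewrite subrr cabs0].
have n2 : near_upper (line x `|y|) e (line x `|z|).
  by split; [exact: line_upper|exact: le_lt_trans d zy].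
have [_ h _] := H _ _ n1 n2; apply: le_trans h _.
by rewrite ler_wpM2l.
Qed.

Lemma g_line_measurable y : 0 <= y -> cmeasurable setT (fun x => g (line x y)).
Proof.
by move=> y0; apply: (cmeasurable_except (s := feet)) => x xf; exact: g_line_continuous_x.
Qed.

Lemma g_line_integrable r y : 0 <= y -> cintegrable (segm r) (fun x => g (line x y)).
Proof.
move=> y0; have [e e0 [c H]] := strip_bound r y0.
have [m1 m2] := g_line_measurable y0.
apply: (cintegrable_dom (phi := cst c)) => //.
- by split; apply: measurable_funTS.
- exact: integrable_cst_segm.
- by move=> x /segmE xr; apply: H => //; rewrite subrr normr0.
Qed.

(** The absolute value makes the integral a function on the whole line, continuous
    at height 0 as well. *)
Let J (r y : R) := cintegral (segm r) (fun x => g (line x `|y|)).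

Lemma ae_off_feet (P : R -> Prop) : (forall x, x \notin feet -> P x) ->
  {ae mu, forall x, P x}.
Proof.
move=> H; exists [set` feet]; split.
- by have [] := measurable_seq feet.
- by apply: countable_lebesgue_measure0; apply: finite_set_countable; exact: finite_seq.
- by move=> x /= nP; apply: contrapT => /negP xf; apply: nP; exact: H.
Qed.

(** Dominated convergence: the integrand is continuous in y for x off the real
    parts of the singularities. *)
Lemma J_cont r : ccont (J r).
Proof.
suff aux y0 : {for y0, continuous (fun y => complex.Re (J r y))} /\
              {for y0, continuous (fun y => complex.Im (J r y))}.
  by split => y; have [] := aux y.
have [e e0 [c H]] := strip_bound r (normr_ge0 y0).
have yI : y0 \in `]y0 - e, y0 + e[%classic.
  by rewrite inE /= in_itv /=; apply/andP; split; lra.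
have near_y y : `]y0 - e, y0 + e[%classic y -> `| `|y| - `|y0| | < e.
  rewrite /= in_itv /= => /andP[h1 h2]; apply: le_lt_trans (ler_dist_dist y y0) _.
  by rewrite ltr_norml; apply/andP; split; lra.
have bd x y : segm r x -> `]y0 - e, y0 + e[%classic y -> cabs (g (line x `|y|)) <= c.
  by move=> /segmE xr /near_y ye; exact: H.
split.
- apply: (@continuity_under_integral R _ _ mu (fun y x => complex.Re (g (line x `|y|)))
    (segm r) (measurable_segm r) (y0 - e) (y0 + e) _ _ (cst c) (integrable_cst_segm r c) _ y0 yI).
  + by move=> y _; have [] := g_line_integrable r (normr_ge0 y).
  + by apply: ae_off_feet => x xf _ y _; have [] := g_line_continuous_y y xf.
  + move=> y yI'; apply: aeW => x xr; apply: le_trans (Re_le_cabs _) _; exact: bd.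
- apply: (@continuity_under_integral R _ _ mu (fun y x => complex.Im (g (line x `|y|)))
    (segm r) (measurable_segm r) (y0 - e) (y0 + e) _ _ (cst c) (integrable_cst_segm r c) _ y0 yI).
  + by move=> y _; have [] := g_line_integrable r (normr_ge0 y).
  + by apply: ae_off_feet => x xf _ y _; have [] := g_line_continuous_y y xf.
  + move=> y yI'; apply: aeW => x xr; apply: le_trans (Im_le_cabs _) _; exact: bd.
Qed.

(** The Cauchy-Riemann equation turns the derivative in y into i times a
    derivative in x, whose integral is given by the end points. *)
Lemma J_cder (r y0 : R) : 0 < r -> 0 < y0 -> y0 \notin heights ->
  cder (J r) y0 ('i%C * (g (line r y0) - g (line (- r) y0))).
Proof.
move=> r0 y00 yh; have y0' := ltW y00.
have [e e0 [c H]] := strip_der r y0' yh.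
have cgp := gp_line_cont y0' yh.
have E := cintegral_segm_cder r0 (fun x => g_line_cder x y0' yh) cgp.
have igp : cintegrable (segm r) (fun x => gp (line x y0)).
  have [c1 c2] := cgp.
  by split; apply: continuous_compact_integrable; (try exact: segment_compact);
    apply: continuous_subspaceT.
apply: (@cder_quadratic _ _ _ (4 * c * r) (Num.min e y0)); first by rewrite lt_min e0.
move=> y; rewrite lt_min => /andP[ye yy].
have yp : 0 <= y by move: yy; rewrite ltr_norml => /andP[h _]; lra.
rewrite /J (ger0_norm yp) (ger0_norm y0') -E.
have i1 := g_line_integrable r yp; have i2 := g_line_integrable r y0'.
rewrite -cintegralZ // -cintegralZ //; last exact: cintegrableZ.
have i3 := cintegrableZ (y - y0)%:C (measurable_segm r) (cintegrableZ 'i%C (measurable_segm r) igp).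
rewrite -cintegralB // -cintegralB //; last exact: cintegrableB.
rewrite (_ : 4 * c * r * (y - y0) ^+ 2 = 4 * (c * (y - y0) ^+ 2) * r); last by ring.
apply: cabs_cintegral_segm; first exact: ltW.
- by apply: cintegrableB => //; exact: cintegrableB.
- by move=> x xr; exact: H.
Qed.

(** The integral over [-r, r] changes by O(1/r) between heights 0 and r, and is
    itself O(1/r) at height r. *)
Lemma segm_integral_small r : rho <= r ->
  cabs (cintegral (segm r) (fun x => g (line x 0))) <= 8 * Cd / r.
Proof.
move=> rr; have r0 : 0 < r by exact: lt_le_trans rr.
have Cd0 : 0 <= Cd.
  have := decay (line_upper rho (lexx 0)); rewrite /line complexr0 cabs_real.
  move=> /(_ (ler_norm _)) /(le_trans (cabs_ge0 _)).
  by rewrite pmulr_lge0 // invr_gt0 exprn_gt0 // gtr0_norm.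
pose K := Cd / r ^+ 2.
have far l : upper R l -> r <= cabs l -> cabs (g l) <= K.
  move=> hl lr; apply: le_trans (decay hl (le_trans rr lr)) _.
  rewrite /K ler_wpM2l // lef_pV2 ?posrE ?exprn_gt0 //; last exact: lt_le_trans lr.
  by rewrite lerXn2r ?nnegrE ?cabs_ge0 // ltW.
have side y : 0 <= y -> cabs (g (line r y)) <= K /\ cabs (g (line (- r) y)) <= K.
  move=> y0; split; apply: far => //.
    by apply: le_trans (Re_le_cabs (line r y)); exact: ler_norm.
  by apply: le_trans (Re_le_cabs (line (- r) y)); rewrite /= normrN; exact: ler_norm.
have top : cabs (J r r) <= 4 * K * r.
  apply: cabs_cintegral_segm; [exact: ltW|exact: g_line_integrable|].
  move=> x _; apply: far; first exact: line_upper.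
  apply: le_trans (Im_le_cabs _) => /=; rewrite normr_id; exact: ler_norm.
have [c1 c2] := J_cont r.
have dJ (y : R) : 0 < y < r -> y \notin heights ->
    let d := 'i%C * (g (line r y) - g (line (- r) y)) in
    [/\ is_derive y 1 (fun y => complex.Re (J r y)) (complex.Re d),
        is_derive y 1 (fun y => complex.Im (J r y)) (complex.Im d) & cabs d <= 2 * K].
  move=> /andP[y0 yr] yh d; have [d1 d2] := J_cder r0 y0 yh; split => //.
  rewrite cabsM cabs_i mul1r; have [h1 h2] := side y (ltW y0).
  by apply: le_trans (cabs_leB _ _) _; lra.
have m1 := @mean_value_except _ _ (2 * K) 0 r heights c1 _ (ltW r0).
have m2 := @mean_value_except _ _ (2 * K) 0 r heights c2 _ (ltW r0).
have h1 : `|complex.Re (J r r) - complex.Re (J r 0)| <= 2 * K * (r - 0).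
  apply: m1 => y yI yh; have [d1 _ dK] := dJ y yI yh.
  by exists (complex.Re ('i%C * (g (line r y) - g (line (- r) y)))) => //; exact: le_trans (Re_le_cabs _) dK.
have h2 : `|complex.Im (J r r) - complex.Im (J r 0)| <= 2 * K * (r - 0).
  apply: m2 => y yI yh; have [_ d2 dK] := dJ y yI yh.
  by exists (complex.Im ('i%C * (g (line r y) - g (line (- r) y)))) => //; exact: le_trans (Im_le_cabs _) dK.
have h3 := cabs_le_ReIm (J r r - J r 0); rewrite !ReImE in h3.
have -> : cintegral (segm r) (fun x => g (line x 0)) = J r r - (J r r - J r 0).
  by rewrite subKr /J normr0.
apply: le_trans (cabs_leB _ _) _.
have -> : 8 * Cd / r = 8 * K * r by rewrite /K; field; rewrite gt_eqF.
lra.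
Qed.

Lemma g_real_decay : exists K, forall x : R, cabs (g x%:C) <= K * w x.
Proof.
have [e e0 [c H]] := strip_bound (rho + 1) (lexx 0).
have Cd0 : 0 <= Cd.
  have := decay (line_upper rho (lexx 0)); rewrite /line complexr0 cabs_real.
  move=> /(_ (ler_norm _)) /(le_trans (cabs_ge0 _)).
  by rewrite pmulr_lge0 // invr_gt0 exprn_gt0 // gtr0_norm.
pose B := 1 + (rho + 1) ^+ 2.
exists (`|c| * B + 2 * Cd) => x.
have w0 := w_gt0 x; have c0 := normr_ge0 c.
have B0 : 0 <= B by rewrite addr_ge0 // sqr_ge0.
have cB : 0 <= `|c| * B by exact: mulr_ge0.
have [xr|xr] := leP `|x| (rho + 1).
  have h : cabs (g x%:C) <= `|c|.
    apply: le_trans (ler_norm c); rewrite -complexr0; apply: H => //.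
      by rewrite -ler_norml.
    by rewrite subrr normr0.
  apply: le_trans h _; rewrite mulrDl; apply: (@le_trans _ _ (`|c| * B * w x)).
    rewrite -mulrA -[leLHS]mulr1 ler_wpM2l // /w ler_pdivlMr ?mul1r; last first.
      by have := sqr_ge0 x; lra.
    rewrite /B lerD2l -(real_normK (num_real x)) lerXn2r ?nnegrE //; have := rho0; lra.
  by rewrite lerDl; exact: mulr_ge0 (mulr_ge0 (ler0n R 2) Cd0) (ltW w0).
have hx : cabs (g x%:C) <= Cd / `|x| ^+ 2.
  rewrite -(cabs_real x); apply: decay; first by rewrite /upper /=.
  by rewrite cabs_real; lra.
apply: le_trans hx _; rewrite mulrDl; apply: (@le_trans _ _ (2 * Cd * w x)).
  rewrite (real_normK (num_real x)).
  have x1 : 1 < x ^+ 2.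
    by rewrite -(real_normK (num_real x)) expr2; have := rho0; nra.
  rewrite (_ : 2 * Cd * w x = Cd * (2 * w x)); last by ring.
  rewrite ler_wpM2l // /w -[leLHS]mul1r ler_pdivrMr; last lra.
  by rewrite mulrAC ler_pdivlMr; lra.
by rewrite lerDr; exact: mulr_ge0 cB (ltW w0).
Qed.

Lemma g_real_measurable : cmeasurable setT (fun x => g x%:C).
Proof. exact: (g_line_measurable (lexx 0)). Qed.

(** Cauchy's theorem on the closed upper half-plane for a function with
    quadratic decay, differentiable off a finite set of bounded singularities.
    The integral over [-r, r] at height y is continuous in y, and its derivative
    is the difference of the boundary values, except at the heights of the
    singularities. *)
Lemma half_plane_cauchy :
  cintegrable setT (fun x => g x%:C) /\ cintegral setT (fun x => g x%:C) = 0.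
Proof.
have [K HK] := g_real_decay; have mg := g_real_measurable.
have ig : cintegrable setT (fun x => g x%:C) by apply: (cintegrable_w (K := K)).
split => //; apply/eqP; rewrite -cabs_eq0 eq_le cabs_ge0 andbT.
apply/ler_addgt0Pr => e e0; rewrite add0r.
have K0 : 0 <= K by have := le_trans (cabs_ge0 _) (HK 0); rewrite pmulr_lge0 // w_gt0.
have d0 : 0 < e / 2 / (4 * K + 1) by rewrite divr_gt0 //; lra.
have [X HX] := atan_add_small d0.
have Cd0 : 0 <= Cd.
  have := decay (line_upper rho (lexx 0)); rewrite /line complexr0 cabs_real.
  move=> /(_ (ler_norm _)) /(le_trans (cabs_ge0 _)).
  by rewrite pmulr_lge0 // invr_gt0 exprn_gt0 // gtr0_norm.
pose r := rho + `|X| + 16 * Cd / e.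
have q0 : 0 <= 16 * Cd / e by rewrite divr_ge0 // ?mulr_ge0 // ltW.
have rr : rho <= r by rewrite /r; have := normr_ge0 X; lra.
have r0 : 0 < r by exact: lt_le_trans rr.
have h1 := segm_integral_small rr.
have h2 := cintegral_segm_cvg (ltW r0) mg HK.
have h3 : atan (- r) + pi / 2 < e / 2 / (4 * K + 1).
  by apply: HX; rewrite /r; have := ler_norm (- X); rewrite normrN; have := rho0; lra.
have h4 : 8 * Cd / r <= e / 2.
  have : 16 * Cd / e <= r by rewrite /r; have := normr_ge0 X; have := rho0; lra.
  rewrite !ler_pdivrMr //; lra.
have h5 : 4 * K * (atan (- r) + pi / 2) <= e / 2.
  have a0 := atan_add_ge0 (- r).
  apply: (@le_trans _ _ ((4 * K + 1) * (e / 2 / (4 * K + 1)))).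
    by apply: ler_pM => //; [lra|lra|exact: ltW].
  by rewrite mulrC divfK //; lra.
rewrite -(subrK (cintegral (segm r) (fun x => g x%:C)) (cintegral setT _)).
apply: le_trans (cabs_leD _ _) _.
have h6 : cabs (cintegral (segm r) (fun x => g x%:C)) <= 8 * Cd / r by exact: h1.
lra.
Qed.

End HalfPlane.

(** * Residues of a quotient in the upper half-plane *)

Section LocalRegularity.
Context {R : realType}.
Implicit Types (l : R[i]) (F G : R[i] -> R[i]).

Definition dd_near l F : Prop :=
  exists2 e : R, 0 < e & exists c : R, dd_bounded (near_upper l e) c F.

Definition bounded_near l F : Prop := exists2 e : R, 0 < e & exists c : R,
  forall m, upper R m -> cabs (m - l) < e -> cabs (F m) <= c.

Lemma near_upperS l (e e' : R) : e' <= e -> near_upper l e' `<=` near_upper l e.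
Proof. by move=> ee z [h1 h2]; split => //; exact: lt_le_trans h2 ee. Qed.

Lemma dd_near_bounded l F : dd_near l F -> bounded_near l F.
Proof. by move=> [e e0 [c [h _ _]]]; exists e => //; exists c => m hm ml; exact: h. Qed.

Lemma dd_bounded_near l c F : dd_bounded (upper R) c F -> dd_near l F.
Proof.
move=> h; exists 1 => //; exists c; apply: dd_boundedS h => z [] //.
Qed.

Lemma dd_near_cst l (a : R[i]) : dd_near l (fun=> a).
Proof. by exists 1 => //; exists (cabs a); exact: dd_bounded_cst. Qed.

Lemma dd_nearD l F G : dd_near l F -> dd_near l G -> dd_near l (fun z => F z + G z).
Proof.
move=> [e e0 [c h]] [e' e0' [c' h']]; exists (Num.min e e'); first by rewrite lt_min e0.
exists (c + c'); apply: dd_boundedD.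
  by apply: dd_boundedS h; apply: near_upperS; rewrite ge_min lexx.
by apply: dd_boundedS h'; apply: near_upperS; rewrite ge_min lexx orbT.
Qed.

Lemma dd_nearM l F G : dd_near l F -> dd_near l G -> dd_near l (fun z => F z * G z).
Proof.
move=> [e e0 [c h]] [e' e0' [c' h']]; exists (Num.min e e'); first by rewrite lt_min e0.
exists (3 * (c * c')); apply: dd_boundedM.
  by apply: dd_boundedS h; apply: near_upperS; rewrite ge_min lexx.
by apply: dd_boundedS h'; apply: near_upperS; rewrite ge_min lexx orbT.
Qed.

Lemma dd_near_eq l F G : (forall z, F z = G z) -> dd_near l F -> dd_near l G.
Proof. by move=> /funext ->. Qed.

Lemma dd_nearB l F G : dd_near l F -> dd_near l G -> dd_near l (fun z => F z - G z).
Proof.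
move=> hF hG; apply: (dd_near_eq (F := fun z => F z + (-1) * G z)).
  by move=> z; rewrite mulN1r.
by apply: dd_nearD => //; apply: dd_nearM => //; exact: dd_near_cst.
Qed.

Lemma dd_near_id l : dd_near l (fun z => z).
Proof.
exists 1 => //; exists (cabs l + 1); have l0 := cabs_ge0 l.
split=> [z [_ h]|z z' _ _|z z' z'' _ _ _].
- by rewrite -(subrK l z); apply: le_trans (cabs_leD _ _) _; lra.
- rewrite -[leLHS]mul1r ler_wpM2r ?cabs_ge0 //; lra.
- rewrite /dd2 mulrC subrr cabs0 mulr_ge0 ?prod3_ge0 //; lra.
Qed.

Lemma dd_nearV l F : upper R l -> F l != 0 -> dd_near l F -> dd_near l (fun z => (F z)^-1).
Proof.
move=> hl Fl [e e0 [c hc]]; have p0 : 0 < cabs (F l) by rewrite cabs_gt0.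
have c0 : 0 <= c.
  case: hc => h _ _; apply: le_trans (cabs_ge0 _) (h l _).
  by split => //; rewrite subrr cabs0.
pose k := Num.min (cabs (F l) / 2) 1; have k0 : 0 < k by rewrite lt_min ltr01 divr_gt0.
have k2 : k <= cabs (F l) / 2 by rewrite ge_min lexx.
exists (Num.min e (k / (c + 1))); first by rewrite lt_min e0 divr_gt0 //; lra.
exists (2 * (c + 1) ^+ 2 / k ^+ 3); apply: dd_boundedV => //.
- by rewrite ge_min lexx orbT.
- lra.
- move=> z [hz]; rewrite lt_min => /andP[ze]; rewrite ltr_pdivlMr; last lra.
  move=> zk; case: hc => _ h _.
  have := h l z (conj hl _) (conj hz ze); rewrite subrr cabs0 => /(_ e0) h1.
  have := cabs_geB (F l) (F l - F z); rewrite subKr (cabsB (F l)) => h2.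
  have := cabs_ge0 (z - l); nra.
- apply: (dd_bounded_le (c := c)); first lra.
  by apply: dd_boundedS hc; apply: near_upperS; rewrite ge_min lexx.
Qed.

Lemma dd_near_sum l (n : nat) (F : 'I_n -> R[i] -> R[i]) : (forall j, dd_near l (F j)) ->
  dd_near l (fun z => \sum_(j < n) F j z).
Proof.
elim: n F => [|n IH] F hF.
  by apply: dd_near_eq (dd_near_cst l 0) => z; rewrite big_ord0.
apply: dd_near_eq (dd_nearD (IH _ (fun j => hF (widen_ord (leqnSn n) j))) (hF ord_max)).
by move=> z; rewrite big_ord_recr.
Qed.

Lemma bounded_nearD l F G : bounded_near l F -> bounded_near l G ->
  bounded_near l (fun z => F z + G z).
Proof.
move=> [e e0 [c h]] [e' e0' [c' h']]; exists (Num.min e e'); first by rewrite lt_min e0.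
exists (c + c') => m hm; rewrite lt_min => /andP[h1 h2].
by apply: le_trans (cabs_leD _ _) _; apply: lerD; [exact: h|exact: h'].
Qed.

Lemma bounded_near_eq l F G : (forall z, F z = G z) -> bounded_near l F -> bounded_near l G.
Proof. by move=> /funext ->. Qed.

(** Subtracting the principal part at a simple zero of the denominator leaves a
    bounded function. *)
Lemma bounded_near_pole (l al : R[i]) (N a : R[i] -> R[i]) cN :
  upper R l -> dd_bounded (upper R) cN N -> a l = 0 -> has_der a l al -> al != 0 ->
  bounded_near l (fun z => N z / a z - (N l / al) / (z - l)).
Proof.
move=> hl [_ hN _] al0 [e e0 [c hc]] aln.
have p0 : 0 < cabs al by rewrite cabs_gt0.
pose c' := `|c| + 1; have c0 : 0 < c' by rewrite /c'; have := normr_ge0 c; lra.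
have cc : c <= c' by rewrite /c'; have := ler_norm c; lra.
have cN0 : 0 <= cN.
  have hl1 : upper R (l + 'i%C * (1 : R)%:C) by exact: upper_addi.
  have := le_trans (cabs_ge0 _) (hN _ _ hl hl1).
  by rewrite addrAC subrr add0r cabsM cabs_i cabs_real normr1 !mulr1.
exists (Num.min e (cabs al / (2 * c'))).
  by rewrite lt_min e0 divr_gt0 // mulr_gt0.
exists ((cN + cabs (N l / al) * c') * (2 / cabs al)) => z hz.
rewrite lt_min => /andP[ze]; rewrite ltr_pdivlMr ?mulr_gt0 // => zc.
have [->|zl] := eqVneq z l.
  rewrite al0 subrr !invr0 !mulr0 subrr cabs0 mulr_ge0 ?divr_ge0 ?cabs_ge0 //.
  by rewrite addr_ge0 // mulr_ge0 ?cabs_ge0 // ltW.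
set d := z - l in ze zc *; have dn : d != 0 by rewrite subr_eq0.
have d0 : 0 < cabs d by rewrite cabs_gt0.
have hE := hc z hz ze; rewrite -/d al0 subr0 in hE.
have hE' : cabs (a z - al * d) <= c' * cabs d ^+ 2.
  by apply: le_trans hE _; rewrite ler_wpM2r // exprn_ge0 // cabs_ge0.
have ha : cabs al * cabs d / 2 <= cabs (a z).
  have := cabs_geB (al * d) (al * d - a z); rewrite subKr cabsM (cabsB (al * d)) => h.
  have : c' * cabs d ^+ 2 <= cabs al * cabs d / 2 by rewrite expr2; nra.
  lra.
have az0 : a z != 0.
  by rewrite -cabs_gt0; apply: lt_le_trans ha; rewrite divr_gt0 // mulr_gt0.
have -> : N z / a z - N l / al / d = ((N z - N l) * d - N l / al * (a z - al * d)) / (a z * d).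
  by field; rewrite az0 aln dn.
rewrite cabsM cabsV cabsM ler_pdivrMr ?mulr_gt0 //; last by rewrite cabs_gt0.
apply: (@le_trans _ _ ((cN + cabs (N l / al) * c') * cabs d ^+ 2)).
  apply: le_trans (cabs_leB _ _) _; rewrite !cabsM mulrDl; apply: lerD.
    by rewrite expr2 mulrA ler_wpM2r ?cabs_ge0 // /d hN.
  by rewrite -[leRHS]mulrA ler_wpM2l ?mulr_ge0 ?cabs_ge0 // cabsV invr_ge0 cabs_ge0.
rewrite -[leRHS]mulrA ler_wpM2l //.
  by rewrite addr_ge0 // mulr_ge0 ?cabs_ge0 // ltW.
have : cabs al * cabs d / 2 * cabs d <= cabs (a z) * cabs d by rewrite ler_wpM2r // ltW.
rewrite (_ : 2 / cabs al * _ = 2 * (cabs (a z) * cabs d) / cabs al); last by ring.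
by rewrite ler_pdivlMr // expr2; lra.
Qed.

Lemma cabs_add_i l : upper R l -> cabs l <= cabs (l + 'i%C) /\ 1 <= cabs (l + 'i%C).
Proof.
rewrite /upper /= => hl.
have h : cabs (l + 'i%C) ^+ 2 = cabs l ^+ 2 + 2 * complex.Im l + 1.
  by rewrite !sqr_cabs !ReImE /=; ring.
have := cabs_ge0 (l + 'i%C); have := cabs_ge0 l => h1 h2.
have h3 : cabs l ^+ 2 <= cabs (l + 'i%C) ^+ 2 by rewrite h; lra.
have h4 : 1 ^+ 2 <= cabs (l + 'i%C) ^+ 2 by rewrite h; have := sqr_ge0 (cabs l); lra.
by move: h3 h4; rewrite !ler_pXn2r ?nnegrE.
Qed.

End LocalRegularity.
Section ResidueIntegral.
Context {R : realType}.
Notation mu := (@lebesgue_measure R).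

Lemma cabs_sub_pole (z l : R[i]) : 2 * cabs z <= cabs l -> cabs l / 2 <= cabs (l - z).
Proof. by move=> h; have := cabs_geB l z; lra. Qed.

Lemma sub_pole_neq0 (z l : R[i]) (b : R) : 0 < b -> b <= cabs (l - z) -> l - z != 0.
Proof. by move=> b0 h; rewrite -cabs_gt0; exact: lt_le_trans h. Qed.

Lemma Rintegral_w : \int[mu]_x w x = pi :> R.
Proof.
have iw := @integrable_w R; rewrite (Rintegral_split 0 iw) Rintegral_w_Ny atan0 add0r.
have ic : mu.-integrable (cy 0) (EFin \o @w R) by apply: integrableS iw.
have := Rintegral_reflect (D := cy 0) (D' := Ny 0) _ _ _ ic.
have -> : \int[mu]_(x in Ny 0) w (- x) = \int[mu]_(x in Ny 0) @w R x.
  by apply: eq_Rintegral => x _; rewrite w_opp.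
rewrite Rintegral_w_Ny atan0 add0r => h.
rewrite -h //; first by field.
by rewrite opp_preimage_cy oppr0.
Qed.

(** The kernel equals 2 i / (x ^ 2 + 1). *)
Lemma integral_cauchy_kernel :
  cintegrable setT (fun x : R => (x%:C - 'i%C)^-1 - (x%:C + 'i%C)^-1) /\
  cintegral setT (fun x : R => (x%:C - 'i%C)^-1 - (x%:C + 'i%C)^-1) = (2 * pi)%:C * 'i%C.
Proof.
have e (x : R) : 2 * 'i%C * (w x)%:C = (x%:C - 'i%C)^-1 - (x%:C + 'i%C)^-1.
  have n1 : x%:C - 'i%C != 0 by rewrite eq_complex /= sub0r oppr_eq0 oner_eq0 andbF.
  have n2 : x%:C + 'i%C != 0 by rewrite eq_complex /= add0r oner_eq0 andbF.
  have P : (x%:C - 'i%C) * (x%:C + 'i%C) = 1 + x%:C ^+ 2.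
    by rewrite expr2; apply: complex_eq; rewrite !ReImE /=; ring.
  rewrite /w fmorphV rmorphD rmorph1 rmorphXn /= -P.
  by field; rewrite n1 n2.
have iw : cintegrable setT (fun x : R => (w x)%:C).
  by split; [exact: integrable_w|exact: integrable0].
split.
  by apply: eq_cintegrable (cintegrableZ (2 * 'i%C) _ iw) => // x _; exact: e.
rewrite -(eq_cintegral (fun x _ => e x)) cintegralZ //.
have -> : cintegral setT (fun x : R => (w x)%:C) = pi%:C.
  by apply: complex_eq; rewrite /= ?Rintegral_w // /Rintegral integral0.
by rewrite rmorphM rmorph_nat /=; ring.
Qed.

(** Both poles lie below the real line and the difference is O(1 / x ^ 2). *)
Lemma integral_upper_poles (z : R[i]) : 0 < complex.Im z ->
  cintegrable setT (fun x : R => (x%:C + z)^-1 - (x%:C + 'i%C)^-1) /\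
  cintegral setT (fun x : R => (x%:C + z)^-1 - (x%:C + 'i%C)^-1) = 0.
Proof.
move=> hz.
have nz l : upper R l -> l + z != 0.
  move=> hl; apply/eqP => /(congr1 (@complex.Im R)); rewrite ReImE /= => e.
  by move: hl; rewrite /upper /=; lra.
have ni l : upper R l -> l + 'i%C != 0.
  by move=> /cabs_add_i [_ h]; rewrite -cabs_gt0; exact: lt_le_trans h.
pose g l := (l + z)^-1 - (l + 'i%C)^-1.
have loc l : upper R l -> dd_near l g.
  move=> hl; apply: dd_nearB; apply: dd_nearV => //; try exact: nz; try exact: ni;
    by apply: dd_nearD (dd_near_id l) (dd_near_cst l _).
apply: (@half_plane_cauchy _ g [::] (2 * cabs z + 1) (2 * (cabs z + 1))).
- move=> l hl lz; have cz := cabs_ge0 z.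
  have h1 : cabs l / 2 <= cabs (l + z).
    by rewrite -[z]opprK; apply: cabs_sub_pole; rewrite cabsN; lra.
  have [h2 h3] := cabs_add_i hl; have l0 : 0 < cabs l by lra.
  have -> : g l = ('i%C - z) / ((l + z) * (l + 'i%C)).
    by rewrite /g; field; rewrite nz // ni.
  have z1 : 0 < cabs (l + z) by lra.
  have z2 : 0 < cabs (l + 'i%C) by lra.
  rewrite cabsM cabsV cabsM ler_pdivrMr ?mulr_gt0 // mulrAC ler_pdivlMr ?exprn_gt0 //.
  have h4 : cabs ('i%C - z) <= cabs z + 1.
    by apply: le_trans (cabs_leB _ _) _; rewrite cabs_i addrC.
  have h5 : cabs l ^+ 2 / 2 <= cabs (l + z) * cabs (l + 'i%C).
    rewrite expr2 mulrAC; apply: ler_pM => //; lra.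
  have h6 := cabs_ge0 ('i%C - z).
  have := ler_pM h6 _ h4 h5; have := exprn_ge0 2 (ltW l0) => h7.
  move=> /(_ _); have h8 : 0 <= cabs l ^+ 2 / 2 by lra.
  by move=> /(_ h8); lra.
- by move=> l hl; apply: dd_near_bounded; exact: loc.
- by move=> l hl _; exact: loc.
- by have := cabs_ge0 z; lra.
Qed.

(** After the reflection x |-> - x the pole z lies below the real line, so that only
    the term of [integral_cauchy_kernel] contributes. *)
Lemma integral_pole (z : R[i]) : 0 < complex.Im z ->
  cintegrable setT (fun x : R => (x%:C - z)^-1 - (x%:C + 'i%C)^-1) /\
  cintegral setT (fun x : R => (x%:C - z)^-1 - (x%:C + 'i%C)^-1) = (2 * pi)%:C * 'i%C.
Proof.
move=> hz; have [i1 e1] := integral_upper_poles hz; have [i2 e2] := integral_cauchy_kernel.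
have pT : (-%R : R -> R) @^-1` setT = setT by exact: preimage_setT.
have i3 := cintegrable_reflect (D := setT) (D' := setT) measurableT pT i1.
have e3 := cintegral_reflect (D := setT) (D' := setT) measurableT measurableT pT i1.
have i4 := cintegrableN measurableT i3.
have e4 := cintegralN measurableT i3.
have E (x : R) : - (((- x)%:C + z)^-1 - ((- x)%:C + 'i%C)^-1) +
   ((x%:C - 'i%C)^-1 - (x%:C + 'i%C)^-1) = (x%:C - z)^-1 - (x%:C + 'i%C)^-1.
  have e5 c : - x%:C + c = - (x%:C - c) by ring.
  by rewrite rmorphN /= !e5 !invrN; ring.
split.
  by apply: eq_cintegrable (cintegrableD measurableT i4 i2) => // x _; exact: E.
rewrite -(eq_cintegral (fun x _ => E x)) cintegralD // e4 e3 e1 oppr0 add0r.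
exact: e2.
Qed.

Variables (N a : R[i] -> R[i]) (cN ca : R) (n : nat) (z al : 'I_n -> R[i]) (h : R[i]) (rho C : R).
Hypotheses (hN : dd_bounded (upper R) cN N) (ha : dd_bounded (upper R) ca a).
Hypothesis zpos : forall j, 0 < complex.Im (z j).
Hypothesis zinj : injective z.
Hypothesis az : forall j, a (z j) = 0.
Hypothesis a_neq0 : forall l, upper R l -> (forall j, l <> z j) -> a l != 0.
Hypothesis a_der : forall j, has_der a (z j) (al j).
Hypothesis al_neq0 : forall j, al j != 0.
Hypothesis rho0 : 0 < rho.
Hypothesis large : forall l, upper R l -> rho <= cabs l ->
  cabs (l ^+ 2 * (N l / a l) - l * h) <= C.

Let res j : R[i] := N (z j) / al j.
Let pole j (l : R[i]) : R[i] := (l - z j)^-1 - (l + 'i%C)^-1.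
Let g l : R[i] := N l / a l - \sum_(j < n) res j * pole j l - h / (l + 'i%C).

Let ni l : upper R l -> l + 'i%C != 0.
Proof.
by move=> /cabs_add_i [_ hh]; rewrite -cabs_gt0; exact: lt_le_trans hh.
Qed.

Let near_i l : upper R l -> dd_near l (fun l => (l + 'i%C)^-1).
Proof.
move=> hl; apply: dd_nearV => //; first exact: ni.
exact: dd_nearD (dd_near_id l) (dd_near_cst l _).
Qed.

Let near_pole j l : upper R l -> l <> z j -> dd_near l (fun l => (l - z j)^-1).
Proof.
move=> hl lz; apply: dd_nearV => //; first by rewrite subr_eq0; apply/eqP.
exact: dd_nearB (dd_near_id l) (dd_near_cst l _).
Qed.

Let bounded_near_sum_except k l (F : 'I_n -> R[i] -> R[i]) :
  (forall j, j != k -> dd_near l (F j)) ->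
  dd_near l (fun l => \sum_(j < n | j != k) F j l).
Proof.
move=> hF; apply: (dd_near_eq (F := fun l => \sum_(j < n) (if j != k then F j l else 0))).
  by move=> m; rewrite -big_mkcond.
by apply: dd_near_sum => j; have := hF j; case: (j != k) => [/(_ isT) //|_]; exact: dd_near_cst.
Qed.

Let Z : seq R[i] := [seq z j | j <- enum 'I_n].

Let notinZ l : l \notin Z -> forall j, l <> z j.
Proof.
by move=> h1 j lz; move/negP: h1; apply; apply/mapP; exists j; rewrite ?mem_enum.
Qed.

Let g_loc l : upper R l -> l \notin Z -> dd_near l g.
Proof.
move=> hl /notinZ lz; apply: dd_nearB; last first.
  by apply: dd_nearM (dd_near_cst _ _) (near_i hl).
apply: dd_nearB.
  apply: dd_nearM (dd_bounded_near l hN) _.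
  by apply: dd_nearV => //; [exact: a_neq0|exact: dd_bounded_near ha].
apply: dd_near_sum => j; apply: dd_nearM (dd_near_cst _ _) _.
by apply: dd_nearB; [exact: near_pole|exact: near_i].
Qed.

Let g_bnd l : upper R l -> bounded_near l g.
Proof.
move=> hl; have [lz|] := boolP (l \in Z); last first.
  by move=> lz; apply: dd_near_bounded; exact: g_loc.
have [k _ ->] := mapP lz.
have hk : upper R (z k) by rewrite /upper /= ltW.
have zz j : j != k -> z k <> z j by move=> jk /zinj kj; rewrite kj eqxx in jk.
have b1 := bounded_near_pole hk hN (az k) (a_der k) (al_neq0 k).
have b2 : dd_near (z k) (fun l => res k * (l + 'i%C)^-1 -
    \sum_(j < n | j != k) res j * pole j l - h / (l + 'i%C)).
  apply: dd_nearB; last by apply: dd_nearM (dd_near_cst _ _) (near_i hk).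
  apply: dd_nearB; first by apply: dd_nearM (dd_near_cst _ _) (near_i hk).
  apply: bounded_near_sum_except => j jk; apply: dd_nearM (dd_near_cst _ _) _.
  by apply: dd_nearB; [apply: near_pole => //; exact: zz|exact: near_i].
apply: bounded_near_eq (bounded_nearD b1 (dd_near_bounded b2)) => l' /=.
rewrite /g [in RHS](bigD1 k) //= -/(res k) /pole; ring.
Qed.

Let poleE j l : upper R l -> l - z j != 0 ->
  pole j l = (z j + 'i%C) / ((l - z j) * (l + 'i%C)).
Proof. by move=> hl lz; rewrite /pole; field; rewrite lz ni. Qed.

Let Rz : R := \sum_(j < n) 2 * cabs (z j).
Let Cp : R := \sum_(j < n) cabs (res j) * (2 * cabs (z j + 'i%C)).

Let Rz_ge j : 2 * cabs (z j) <= Rz.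
Proof.
rewrite /Rz (bigD1 j) //= lerDl sumr_ge0 // => i _.
by rewrite mulr_ge0 ?cabs_ge0.
Qed.

Let cabs_sum (m : nat) (F : 'I_m -> R[i]) : cabs (\sum_(j < m) F j) <= \sum_(j < m) cabs (F j).
Proof.
elim: m F => [|m IH] F; first by rewrite !big_ord0 cabs0.
rewrite !big_ord_recr /=; apply: le_trans (cabs_leD _ _) _.
by rewrite lerD2r.
Qed.

Let g_decay l : upper R l -> rho + Rz + 1 <= cabs l ->
  cabs (g l) <= (C + Cp + cabs h) / cabs l ^+ 2.
Proof.
move=> hl lr.
have Rz0 : 0 <= Rz by rewrite sumr_ge0 // => i _; rewrite mulr_ge0 ?cabs_ge0.
have l0 : 0 < cabs l by have := rho0; lra.
have [i1 i2] := cabs_add_i hl; have i0 : 0 < cabs (l + 'i%C) by lra.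
have dist j : cabs l / 2 <= cabs (l - z j).
  by apply: cabs_sub_pole; have := Rz_ge j; have := rho0; lra.
have nzj j : l - z j != 0 by apply: (sub_pole_neq0 (b := cabs l / 2)) => //; lra.
have hp j : cabs (l ^+ 2 * pole j l) <= 2 * cabs (z j + 'i%C).
  rewrite poleE // mulrA cabsM cabsV !cabsM -expr2.
  have d0 : 0 < cabs (l - z j) by rewrite cabs_gt0.
  rewrite ler_pdivrMr ?mulr_gt0 //.
  have : cabs l ^+ 2 / 2 <= cabs (l - z j) * cabs (l + 'i%C).
    by rewrite expr2 mulrAC; apply: ler_pM => //; lra.
  have := cabs_ge0 (z j + 'i%C); nra.
rewrite ler_pdivlMr ?exprn_gt0 // mulrC expr2 -!cabsM -expr2.
have -> : l ^+ 2 * g l = (l ^+ 2 * (N l / a l) - l * h)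
    - \sum_(j < n) res j * (l ^+ 2 * pole j l) + h * (l * 'i%C / (l + 'i%C)).
  rewrite /g !mulrBr mulr_sumr.
  under [X in _ - X - _]eq_bigr => j _ do rewrite mulrCA.
  by set y := N l / a l; field; rewrite ni.
apply: le_trans (cabs_leD _ _) _; apply: lerD; last first.
  rewrite cabsM -[leRHS]mulr1 ler_wpM2l ?cabs_ge0 // cabsM cabsV cabsM cabs_i mulr1.
  by rewrite ler_pdivrMr // mul1r.
apply: le_trans (cabs_leB _ _) _; apply: lerD; first by apply: large => //; lra.
apply: le_trans (cabs_sum _) _; rewrite /Cp ler_sum // => j _.
by rewrite cabsM ler_wpM2l ?cabs_ge0.
Qed.

(** The difference with the rational function having the same principal parts
    and the same leading term at infinity has vanishing integral. *)
Lemma residue_integral :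
  cintegrable setT (fun x : R => N x%:C / a x%:C - h / (x%:C + 'i%C)) /\
  cintegral setT (fun x : R => N x%:C / a x%:C - h / (x%:C + 'i%C)) =
    (2 * pi)%:C * 'i%C * \sum_(j < n) N (z j) / al j.
Proof.
have Rz0 : 0 <= Rz by rewrite sumr_ge0 // => i _; rewrite mulr_ge0 ?cabs_ge0.
have r0 : 0 < rho + Rz + 1 by have := rho0; lra.
have [ig eg] := @half_plane_cauchy _ g Z (rho + Rz + 1) (C + Cp + cabs h) g_decay g_bnd g_loc r0.
have ip j : cintegrable setT (fun x : R => res j * pole j x%:C).
  by apply: cintegrableZ => //; have [] := integral_pole (zpos j).
have is_ := cintegrable_sum measurableT ip.
have E (x : R) : g x%:C + \sum_(j < n) res j * pole j x%:C =
    N x%:C / a x%:C - h / (x%:C + 'i%C) by rewrite /g; ring.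
split.
  by apply: eq_cintegrable (cintegrableD measurableT ig is_) => // x _; exact: E.
rewrite -(eq_cintegral (fun x _ => E x)) cintegralD // eg add0r cintegral_sum //.
rewrite mulr_sumr; apply: eq_bigr => j _.
have [i1 e1] := integral_pole (zpos j).
by rewrite cintegralZ // e1 mulrC.
Qed.

End ResidueIntegral.

(** * Solutions of the linear system and their Wronskians *)

Section LinearSystem.
Context {R : realType}.
Implicit Types (lam : R[i]).

(** [y false] and [y true] are the two entries of a solution of
    y' = (- i lam sigma3 + Q) y. *)
Definition solves (q p : R -> R[i]) lam (y : bool -> R -> R[i]) : Prop :=
  forall x, cder (y false) x (- ('i%C * lam) * y false x + q x * y true x) /\
            cder (y true) x ('i%C * lam * y true x + p x * y false x).

Definition wronskian (y z : bool -> R -> R[i]) (x : R) : R[i] :=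
  y false x * z true x - y true x * z false x.

Definition flip (y : bool -> R -> R[i]) : bool -> R -> R[i] := fun k => y (~~ k).

Lemma wronskian_flip y z x : wronskian (flip y) (flip z) x = - wronskian y z x.
Proof. by rewrite /wronskian /flip /=; ring. Qed.

Lemma solves_flip q p lam y : solves p q (- lam) y -> solves q p lam (flip y).
Proof.
move=> H x; have [h1 h2] := H x; rewrite /flip /=; split.
  by apply: cder_eq h2 _; ring.
by apply: cder_eq h1 _; ring.
Qed.

Lemma wronskian_cst q p lam y z : solves q p lam y -> solves q p lam z ->
  forall x x', wronskian y z x = wronskian y z x'.
Proof.
move=> hy hz; apply: cder0_cst => x; have [y1 y2] := hy x; have [z1 z2] := hz x.
by apply: cder_eq (cderB (cderM y1 z2) (cderM y2 z1)) _; ring.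
Qed.

(** Uniqueness for the Cauchy problem, by comparing |y| ^ 2 with exponentials. *)
Lemma solves_zero q p lam y (B x0 : R) : (forall x, cabs (q x) <= B) ->
  (forall x, cabs (p x) <= B) -> solves q p lam y ->
  y false x0 = 0 -> y true x0 = 0 -> forall x k, y k x = 0.
Proof.
move=> bq bp hy y10 y20.
have B0 : 0 <= B by exact: le_trans (cabs_ge0 _) (bq 0).
pose r1 x := complex.Re (y false x); pose i1 x := complex.Im (y false x).
pose r2 x := complex.Re (y true x); pose i2 x := complex.Im (y true x).
pose phi x : R := r1 x * r1 x + i1 x * i1 x + (r2 x * r2 x + i2 x * i2 x).
pose K : R := 2 * cabs ('i%C * lam) + 2 * B.
pose d1 x := - ('i%C * lam) * y false x + q x * y true x.
pose d2 x := 'i%C * lam * y true x + p x * y false x.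
pose dphi x : R := 2 * (r1 x * complex.Re (d1 x) + i1 x * complex.Im (d1 x) +
  (r2 x * complex.Re (d2 x) + i2 x * complex.Im (d2 x))).
have phiE x : phi x = cabs (y false x) ^+ 2 + cabs (y true x) ^+ 2.
  by rewrite !sqr_cabs /phi /r1 /i1 /r2 /i2 !expr2.
have phi0 x : 0 <= phi x by rewrite phiE addr_ge0 // sqr_ge0.
have hphi (x : R) : is_derive x 1 phi (dphi x).
  have [[a1 a2] [a3 a4]] := hy x.
  rewrite (_ : phi = r1 * r1 + i1 * i1 + (r2 * r2 + i2 * i2)); last exact/funext.
  apply: is_derive_eq (is_deriveD (is_deriveD (is_deriveM a1 a1) (is_deriveM a2 a2))
    (is_deriveD (is_deriveM a3 a3) (is_deriveM a4 a4))) _.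
  rewrite /dphi /d1 /d2 /r1 /i1 /r2 /i2 /GRing.scale /=; ring.
have inner (u v : R[i]) : `|complex.Re u * complex.Re v + complex.Im u * complex.Im v| <= cabs u * cabs v.
  rewrite -ler_sqr ?nnegrE ?mulr_ge0 ?cabs_ge0 // real_normK ?num_real //.
  rewrite exprMn !sqr_cabs; set a := complex.Re u; set b := complex.Im u.
  set c := complex.Re v; set d := complex.Im v.
  by have := sqr_ge0 (a * d - b * c); nra.
have bd x : `|dphi x| <= K * phi x.
  rewrite /dphi normrM ger0_norm // phiE.
  have h1 := inner (y false x) (d1 x); have h2 := inner (y true x) (d2 x).
  have e1 : cabs (d1 x) <= cabs ('i%C * lam) * cabs (y false x) + B * cabs (y true x).
    apply: le_trans (cabs_leD _ _) _; rewrite !cabsM cabsN cabsM lerD2l.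
    by rewrite ler_wpM2r ?cabs_ge0.
  have e2 : cabs (d2 x) <= cabs ('i%C * lam) * cabs (y true x) + B * cabs (y false x).
    apply: le_trans (cabs_leD _ _) _; rewrite !cabsM lerD2l.
    by rewrite ler_wpM2r ?cabs_ge0.
  have h3 := ler_normD (r1 x * complex.Re (d1 x) + i1 x * complex.Im (d1 x))
    (r2 x * complex.Re (d2 x) + i2 x * complex.Im (d2 x)).
  have g1 := ler_wpM2l (cabs_ge0 (y false x)) e1.
  have g2 := ler_wpM2l (cabs_ge0 (y true x)) e2.
  have g3 := ler_wpM2l B0 (sqr_ge0 (cabs (y false x) - cabs (y true x))).
  rewrite /K; nra.
have expd (c x : R) : is_derive x 1 (fun t => expR (c * t) * phi t)
    (expR (c * x) * (c * phi x + dphi x)).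
  have hl : is_derive x 1 (fun t : R => c * t) c.
    apply: is_derive_eq (is_deriveZ c (is_derive_id x 1)) _.
    by rewrite /GRing.scale /= mulr1.
  have he : is_derive x 1 (fun t : R => expR (c * t)) (expR (c * x) * c).
    exact: (is_derive1_comp (is_derive_expR (c * x)) hl).
  apply: is_derive_eq (is_deriveM he (hphi x)) _.
  by rewrite /GRing.scale /=; ring.
have cont (c : R) : continuous (fun t => expR (c * t) * phi t).
  move=> x; apply: differentiable_continuous; apply/derivable1_diffP.
  exact: (@ex_derive _ _ _ _ _ _ _ (expd c x)).
have px0 : phi x0 = 0 by rewrite phiE y10 y20 cabs0 expr0n /= addr0.
have zero x : phi x = 0.
  apply/eqP; rewrite eq_le phi0 andbT.
  have [xx|xx] := leP x0 x.
    have [c _ e] := MVT_segment xx (fun t _ => expd (- K) t) (continuous_subspaceT (cont (- K))).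
    have h : 0 <= x - x0 by rewrite subr_ge0.
    move: e; rewrite px0 mulr0 subr0 => e.
    have : expR (- K * x) * phi x <= 0.
      rewrite e; apply: mulr_le0_ge0 => //; apply: mulr_ge0_le0; first exact: expR_ge0.
      by have := bd c; rewrite ler_norml => /andP[_]; lra.
    by rewrite pmulr_rle0 // expR_gt0.
  have [c _ e] := MVT_segment (ltW xx) (fun t _ => expd K t) (continuous_subspaceT (cont K)).
  have h : 0 <= x0 - x by rewrite subr_ge0 ltW.
  move: e; rewrite px0 mulr0 sub0r => e.
  have : expR (K * x) * phi x <= 0.
    rewrite -oppr_ge0 e; apply: mulr_ge0 => //; apply: mulr_ge0; first exact: expR_ge0.
    by have := bd c; rewrite ler_norml => /andP[]; lra.
  by rewrite pmulr_rle0 // expR_gt0.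
move=> x k; have := zero x; rewrite phiE => /eqP.
rewrite paddr_eq0 ?sqr_ge0 // !sqrf_eq0 !cabs_eq0 => /andP[/eqP h1 /eqP h2].
by case: k.
Qed.

Lemma cder_osc_line lam (x : R) : cder (fun t => osc t lam) x ('i%C * lam * osc x lam).
Proof.
rewrite oscE (_ : (fun t => _) = fun t : R => cexp ('i%C * lam * t%:C)); last first.
  by apply/funext => t; rewrite oscE.
exact: cder_cexp_lin.
Qed.

Lemma cder_reflect (f : R -> R[i]) (x : R) d : cder f (- x) d -> cder (fun t => f (- t)) x (- d).
Proof.
move=> h; have := cder_comp_real (is_deriveN (is_derive_id x (1 : R))) h.
by move=> h'; apply: cder_eq h' _; rewrite rmorphN /= rmorph1 mulN1r.
Qed.

End LinearSystem.

(** * Left and right solutions and the Green operator *)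

Section LeftRight.
Context {R : realType}.
Implicit Types (lam : R[i]).

(** The potentials seen after the reflection x -> - x exchanging the two
    entries; it maps the left solution to the right one. *)
Definition refl (g : R -> R[i]) : R -> R[i] := fun x => - g (- x).

Definition left (q p : R -> R[i]) lam (k : bool) (x : R) : R[i] :=
  if k then (jost q p lam).2 x else (jost q p lam).1 x.
Definition right (q p : R -> R[i]) lam (k : bool) (x : R) : R[i] :=
  left (refl p) (refl q) lam (~~ k) (- x).

Definition mleft q p lam k x : R[i] := osc (- x) lam * left q p lam k x.
Definition mright q p lam k x : R[i] := osc x lam * right q p lam k x.

(** The coefficient a for the potentials q and p; exchanging the potentials and
    changing the sign of lam gives A. *)
Definition scat q p lam : R[i] := wronskian (left q p lam) (right q p lam) 0.

Definition pairing (y f : bool -> R -> R[i]) (s : R) : R[i] :=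
  y false s * f true s - y true s * f false s.

Definition green_right (q p : R -> R[i]) (f : bool -> R -> R[i]) (x : R) lam : R[i] :=
  - green_left (refl p) (refl q) (fun s => f true (- s)) (fun s => f false (- s)) (- x) lam.

(** Variation of constants: the bounded solution r of
    (d/dx + i lam sigma3 - Q) r = f is this numerator divided by [scat]. *)
Definition green_num q p (f : bool -> R -> R[i]) (k : bool) (x : R) lam : R[i] :=
  right q p lam k x * green_left q p (f false) (f true) x lam +
  left q p lam k x * green_right q p f x lam.

Lemma refl_c1_decays g g' : c1_decays g g' -> c1_decays (refl g) (fun x => g' (- x)).
Proof.
move=> /c1_decays_reflect /(c1_decaysZ (-1)).
rewrite (_ : (fun x => -1 * g (- x)) = refl g); last by apply/funext => x; rewrite mulN1r.
rewrite (_ : (fun x => -1 * - g' (- x)) = fun x => g' (- x)) //.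
by apply/funext => x; rewrite mulrNN mul1r.
Qed.

Lemma source_reflect (g : R -> R[i]) : source g -> source (fun x => g (- x)).
Proof.
move=> [cg [M hM]]; split.
  by apply: ccont_comp cg _ => x; apply: cvgN; exact: cvg_id.
by exists M => s; rewrite -w_opp; exact: hM.
Qed.

Section Potential.
Variables q q' p p' : R -> R[i].
Hypotheses (hq : c1_decays q q') (hp : c1_decays p p').

Let hqr := refl_c1_decays hq.
Let hpr := refl_c1_decays hp.

Lemma mleft_solves lam : upper R lam -> solves q p lam (mleft q p lam).
Proof.
move=> hl x; have [h1 h2] := jost_cder hq hp x hl.
have ho := cder_reflect (cder_osc_line lam (- x)).
split.
  by apply: cder_eq (cderM ho h1) _; rewrite /mleft /left /=; ring.
by apply: cder_eq (cderM ho h2) _; rewrite /mleft /left /=; ring.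
Qed.

Lemma mright_solves lam : upper R lam -> solves q p lam (mright q p lam).
Proof.
move=> hl x; have [h1 h2] := jost_cder hpr hqr (- x) hl.
have ho := cder_osc_line lam x.
split.
  apply: cder_eq (cderM ho (cder_reflect h2)) _.
  by rewrite /mright /right /left /refl /= opprK; ring.
apply: cder_eq (cderM ho (cder_reflect h1)) _.
by rewrite /mright /right /left /refl /= opprK; ring.
Qed.

Lemma osc_cancel (x : R) lam : osc (- x) lam * osc x lam = 1.
Proof. by rewrite -oscD addNr osc0. Qed.

Lemma scatE lam x : upper R lam ->
  wronskian (left q p lam) (right q p lam) x = scat q p lam.
Proof.
move=> hl; have e y : wronskian (left q p lam) (right q p lam) y =
    wronskian (mleft q p lam) (mright q p lam) y.
  rewrite /wronskian /mleft /mright -[LHS]mul1r -(osc_cancel y lam); ring.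
rewrite /scat !e; exact: wronskian_cst (mleft_solves hl) (mright_solves hl) _ _.
Qed.

Lemma scat_wronskian lam x : upper R lam ->
  wronskian (mleft q p lam) (mright q p lam) x = scat q p lam.
Proof.
move=> hl; rewrite -(scatE x hl) /wronskian /mleft /mright.
rewrite -[RHS]mul1r -(osc_cancel x lam); ring.
Qed.

Lemma left_bounded : exists2 B, 0 <= B & forall lam, upper R lam ->
  forall k x, cabs (left q p lam k x) <= B /\ cabs (right q p lam k x) <= B.
Proof.
have [B B0 h] := jost_bounded hq hp; have [B' B0' h'] := jost_bounded hpr hqr.
exists (B + B'); first exact: addr_ge0.
move=> lam hl k x; have [a1 a2] := h _ hl x; have [a3 a4] := h' _ hl (- x).
by rewrite /right /left; case: k => /=; split; lra.
Qed.

Lemma left_dd k x : exists c, dd_bounded (upper R) c (fun lam => left q p lam k x).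
Proof.
have [c _ /(_ x (lexx x)) [h1 h2]] := jost_dd hq hp x; exists c.
by case: k.
Qed.

Lemma right_dd k x : exists c, dd_bounded (upper R) c (fun lam => right q p lam k x).
Proof.
have [c _ /(_ _ (lexx (- x))) [h1 h2]] := jost_dd hpr hqr (- x); exists c.
by case: k.
Qed.

Lemma scat_dd : exists c, dd_bounded (upper R) c (scat q p).
Proof.
have [c1 h1] := left_dd false 0; have [c2 h2] := right_dd true 0.
have [c3 h3] := left_dd true 0; have [c4 h4] := right_dd false 0.
by eexists; exact: dd_boundedB (dd_boundedM h1 h2) (dd_boundedM h3 h4).
Qed.

(** The solutions tend to their constant normalizations, so that the coefficient
    tends to 1 at infinity. *)
Lemma scat_large : exists2 rho : R, 0 < rho & forall lam, upper R lam ->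
  rho <= cabs lam -> 1 / 2 <= cabs (scat q p lam).
Proof.
have [K hK] := jost_large hq hp; have [K' hK'] := jost_large hpr hqr.
have [B B0 hB] := left_bounded.
pose T := `|K| * B + `|K'| + `|K| * B.
have T0 : 0 <= T by rewrite !addr_ge0 // mulr_ge0.
exists (2 * T + 1); first lra.
move=> lam hl lamT; have l0 : 0 < cabs lam by lra.
have [a1 a2] := hK _ hl 0; have [a3 a4] := hK' _ hl (- 0).
have nK := ler_norm K; have nK' := ler_norm K'.
have [_ b1] := hB _ hl true 0; have [_ b2] := hB _ hl false 0.
pose u := left q p lam false 0; pose v := left q p lam true 0.
pose z := right q p lam true 0; pose w := right q p lam false 0.
have E : scat q p lam = 1 + ((u - 1) * z + (z - 1) - v * w).
  by rewrite /scat /wronskian -/u -/v -/z -/w; ring.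
have h : cabs lam * cabs ((u - 1) * z + (z - 1) - v * w) <= T.
  apply: le_trans (ler_wpM2l (cabs_ge0 _) (cabs_leB _ _)) _; rewrite mulrDr; apply: lerD.
    apply: le_trans (ler_wpM2l (cabs_ge0 _) (cabs_leD _ _)) _; rewrite mulrDr; apply: lerD.
      rewrite cabsM mulrA; apply: ler_pM; rewrite ?mulr_ge0 ?cabs_ge0 //.
      exact: le_trans a2 nK.
    exact: le_trans a4 nK'.
  rewrite cabsM mulrA; apply: ler_pM; rewrite ?mulr_ge0 ?cabs_ge0 //.
  exact: le_trans a1 nK.
rewrite E; set d := _ - v * w in h *.
have := cabs_geB 1 (- d); rewrite cabs1 opprK cabsN => h1.
have d0 := cabs_ge0 d; nra.
Qed.

Lemma green_left_pairing f x lam : upper R lam -> source (f false) -> source (f true) ->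
  cintegrable (Ny x) (pairing (mleft q p lam) f) /\
  green_left q p (f false) (f true) x lam =
    osc x lam * cintegral (Ny x) (pairing (mleft q p lam) f).
Proof.
move=> hl s1 s2; have i := green_left_integrable hq hp x hl s1 s2.
have e s : osc (x - s) lam * ((jost q p lam).1 s * f true s - (jost q p lam).2 s * f false s)
    = osc x lam * pairing (mleft q p lam) f s.
  by rewrite oscD /pairing /mleft /left; ring.
have i' : cintegrable (Ny x) (pairing (mleft q p lam) f).
  have := cintegrableZ (osc x lam)^-1 (measurable_Ny x) i.
  by apply: eq_cintegrable => // s _; rewrite e mulKf // osc_neq0.
split => //; rewrite -cintegralZ //; apply: eq_cintegral => s _; exact: e.
Qed.

End Potential.

Section Potential2.
Variables q q' p p' : R -> R[i].
Hypotheses (hq : c1_decays q q') (hp : c1_decays p p').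

Let hqr := refl_c1_decays hq.
Let hpr := refl_c1_decays hp.

Lemma green_right_pairing f x lam : upper R lam -> source (f false) -> source (f true) ->
  cintegrable (cy x) (pairing (mright q p lam) f) /\
  green_right q p f x lam =
    osc (- x) lam * cintegral (cy x) (pairing (mright q p lam) f).
Proof.
move=> hl s1 s2.
pose fr (k : bool) s := f (~~ k) (- s).
have [i e] := green_left_pairing hpr hqr (f := fr) (- x) hl (source_reflect s2) (source_reflect s1).
have mE s : pairing (mleft (refl p) (refl q) lam) fr (- s) = - pairing (mright q p lam) f s.
  by rewrite /pairing /mleft /mright /right /fr /= !opprK; ring.
have pre : (-%R : R -> R) @^-1` (Ny (- x)) = cy x by rewrite opp_preimage_Ny opprK.
have i2 := cintegrable_reflect (D := Ny (- x)) (D' := cy x) (measurable_Ny _) pre i.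
have e2 := cintegral_reflect (D := Ny (- x)) (D' := cy x) (measurable_Ny _) (measurable_cy _) pre i.
have i3 : cintegrable (cy x) (pairing (mright q p lam) f).
  by apply: eq_cintegrable (cintegrableN _ i2) => // s _; rewrite mE opprK.
split => //; rewrite /green_right e -e2 (eq_cintegral (fun s _ => mE s)) cintegralN //.
by rewrite mulrN opprK.
Qed.

Lemma green_numE f k x lam : upper R lam -> source (f false) -> source (f true) ->
  green_num q p f k x lam =
    mright q p lam k x * cintegral (Ny x) (pairing (mleft q p lam) f) +
    mleft q p lam k x * cintegral (cy x) (pairing (mright q p lam) f).
Proof.
move=> hl s1 s2; have [_ e1] := green_left_pairing hq hp x hl s1 s2.
have [_ e2] := green_right_pairing x hl s1 s2.
by rewrite /green_num e1 e2 /mright /mleft; ring.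
Qed.

Lemma green_num_dd f k x : source (f false) -> source (f true) ->
  exists c, dd_bounded (upper R) c (green_num q p f k x).
Proof.
move=> s1 s2; have [c1 h1] := right_dd hq hp k x; have [c2 h2] := left_dd hq hp k x.
have [c3 h3] := green_left_dd hq hp x s1 s2.
have [c4 h4] := green_left_dd hpr hqr (- x) (source_reflect s2) (source_reflect s1).
by eexists; exact: dd_boundedD (dd_boundedM h1 h3) (dd_boundedM h2 (dd_boundedN h4)).
Qed.

Definition lin_source (c : R[i]) (f g : bool -> R -> R[i]) : bool -> R -> R[i] :=
  fun k s => c * f k s - g k s.

Lemma green_num_lin c f g k x lam : upper R lam ->
  source (f false) -> source (f true) -> source (g false) -> source (g true) ->
  green_num q p (lin_source c f g) k x lam =
    c * green_num q p f k x lam - green_num q p g k x lam.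
Proof.
move=> hl sf1 sf2 sg1 sg2.
have e1 := green_left_lin hq hp c x hl sf1 sf2 sg1 sg2.
have e2 := green_left_lin hpr hqr c (- x) hl (source_reflect sf2) (source_reflect sf1)
  (source_reflect sg2) (source_reflect sg1).
rewrite /green_num /green_right /lin_source e1 e2; ring.
Qed.

(** (d/dx + i lam sigma3 - Q) g *)
Definition system_op lam (g g' : bool -> R -> R[i]) : bool -> R -> R[i] := fun k s =>
  if k then g' true s - 'i%C * lam * g true s - p s * g false s
  else g' false s + 'i%C * lam * g false s - q s * g true s.

(** The two half-line integrals of a total derivative contribute the values at x
    paired with both solutions, which combine into the Wronskian. *)
Lemma green_num_parts g g' k x lam : upper R lam ->
  c1_decays (g false) (g' false) -> c1_decays (g true) (g' true) ->
  green_num q p (system_op lam g g') k x lam = scat q p lam * g k x.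
Proof.
move=> hl h1 h2.
have e1 := green_left_parts hq hp x hl h1 h2.
pose G k s := - g (~~ k) (- s); pose G' k s := g' (~~ k) (- s).
have e2 := green_left_parts hpr hqr (- x) hl (refl_c1_decays h2) (refl_c1_decays h1).
have e3 : green_right q p (system_op lam g g') x lam =
    right q p lam true x * g false x - right q p lam false x * g true x.
  rewrite /green_right.
  rewrite (_ : green_left _ _ _ _ _ _ = (jost (refl p) (refl q) lam).1 (- x) * refl (g false) (- x) -
     (jost (refl p) (refl q) lam).2 (- x) * refl (g true) (- x)).
    by rewrite /refl !opprK /right /left /=; ring.
  rewrite -e2; apply: eq_cintegral => s _; congr (_ * (_ * _ - _ * _)).
      by rewrite /system_op /refl; ring.
    by rewrite /system_op /refl; ring.
rewrite /green_num e3 (_ : green_left _ _ _ _ _ _ = left q p lam false x * g true x - left q p lam true x * g false x); last first.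
  exact: e1.
by rewrite -(scatE hq hp x hl) /wronskian; case: k; ring.
Qed.

End Potential2.
End LeftRight.

(** * Expansion at infinity, residues and jump of the resolvent *)

Section Expansion.
Context {R : realType}.
Implicit Types (lam : R[i]).
Variables q q' p p' : R -> R[i].
Hypotheses (hq : c1_decays q q') (hp : c1_decays p p').

(** The diagonal of - i sigma3. *)
Definition lead_sign (k : bool) : R[i] := if k then 'i%C else - 'i%C.

(** If h = - i sigma3 f, then (d/dx + i lam sigma3 - Q) h = lam f - f2 with
    f2 = Q h - h' independent of lam. *)
Definition next_source (f f' : bool -> R -> R[i]) : bool -> R -> R[i] := fun k s =>
  if k then - 'i%C * (p s * f false s + f' true s)
  else 'i%C * (q s * f true s + f' false s).

Definition next_source' (f f' f'' : bool -> R -> R[i]) : bool -> R -> R[i] := fun k s =>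
  if k then - 'i%C * (p' s * f false s + p s * f' false s + f'' true s)
  else 'i%C * (q' s * f true s + q s * f' true s + f'' false s).

Lemma next_source_c1 f f' f'' k : (forall k, c1_decays (f k) (f' k)) ->
  (forall k, c1_decays (f' k) (f'' k)) ->
  c1_decays (next_source f f' k) (next_source' f f' f'' k).
Proof.
move=> h1 h2; case: k; apply: c1_decaysZ; apply: c1_decaysD => //; exact: c1_decaysM.
Qed.

Lemma sourceD (g h : R -> R[i]) : source g -> source h -> source (fun s => g s + h s).
Proof.
move=> [cg [M hM]] [ch [N hN]]; split; first exact: ccontD.
by exists (M + N); exact: decaysD.
Qed.

Lemma sourceZ (c : R[i]) (g : R -> R[i]) : source g -> source (fun s => c * g s).
Proof.
move=> [cg [M hM]]; split; first by apply: ccontM => //; exact: ccont_cst.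
by exists (cabs c * M); exact: decaysMl.
Qed.

Lemma next_source_source f f' k : (forall k, c1_decays (f k) (f' k)) ->
  source (next_source f f' k).
Proof.
move=> h; have [_ s1] := c1_decays_source (h false); have [_ s2] := c1_decays_source (h true).
have [t1 _] := c1_decays_source (c1_decaysM hp (h false)).
have [t2 _] := c1_decays_source (c1_decaysM hq (h true)).
by case: k; apply: sourceZ; exact: sourceD.
Qed.

(** Applying the Green operator to (d/dx + i lam sigma3 - Q) (- i sigma3 f), which is
    lam f minus the source of [next_source]. *)
Lemma green_num_expand f f' k x lam : upper R lam ->
  (forall k, c1_decays (f k) (f' k)) ->
  lam * green_num q p f k x lam =
    scat q p lam * (lead_sign k * f k x) + green_num q p (next_source f f') k x lam.
Proof.
move=> hl hf.
have [s1 _] := c1_decays_source (hf false); have [s2 _] := c1_decays_source (hf true).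
have [n1 n2] := (next_source_source false hf, next_source_source true hf).
have hh j : c1_decays (fun s => lead_sign j * f j s) (fun s => lead_sign j * f' j s).
  exact: c1_decaysZ.
have := @green_num_parts _ q q' p p' hq hp (fun j s => lead_sign j * f j s)
  (fun j s => lead_sign j * f' j s) k x lam hl (hh false) (hh true).
have -> : system_op q p lam (fun j s => lead_sign j * f j s) (fun j s => lead_sign j * f' j s) =
    lin_source lam f (next_source f f').
  have i2 : 'i%C * 'i%C = -1 :> R[i] by rewrite -expr2 sqr_i.
  apply/funext => j; apply/funext => s; rewrite /system_op /lin_source /next_source /lead_sign.
  case: j.
    rewrite (_ : 'i%C * lam * ('i%C * f true s) = 'i%C * 'i%C * lam * f true s); last by ring.
    by rewrite i2; ring.
  rewrite (_ : 'i%C * lam * (- 'i%C * f false s) = - ('i%C * 'i%C) * lam * f false s); last by ring.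
  by rewrite i2; ring.
rewrite (green_num_lin hq hp) // => <-; ring.
Qed.

(** Two uses of [green_num_expand]: the numerator of the remaining source is bounded
    and [scat] is bounded below. *)
Lemma green_num_large f f' f'' k x : (forall k, c1_decays (f k) (f' k)) ->
  (forall k, c1_decays (f' k) (f'' k)) ->
  exists2 rho : R, 0 < rho & exists C : R, forall lam, upper R lam ->
  rho <= cabs lam ->
  cabs (lam ^+ 2 * (green_num q p f k x lam / scat q p lam) - lam * (lead_sign k * f k x)) <= C.
Proof.
move=> h1 h2; have [rho rho0 hs] := scat_large hq hp.
pose f2 := next_source f f'; pose f2' := next_source' f f' f''.
have h3 j : c1_decays (f2 j) (f2' j) by exact: next_source_c1.
have [c hc] := green_num_dd hq hp k x (next_source_source false h3) (next_source_source true h3).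
exists rho => //; exists (cabs (lead_sign k * f2 k x) + `|c| * 2).
move=> lam hl lr; have a2 := hs _ hl lr.
have a0 : scat q p lam != 0 by rewrite -cabs_gt0; lra.
have e1 := green_num_expand k x hl h1; have e2 := green_num_expand k x hl h3.
have -> : lam ^+ 2 * (green_num q p f k x lam / scat q p lam) - lam * (lead_sign k * f k x) =
   lead_sign k * f2 k x + green_num q p (next_source f2 f2') k x lam / scat q p lam.
  rewrite expr2 -mulrA (mulrA lam (green_num _ _ _ _ _ _)) e1 -/f2.
  rewrite (_ : lam * _ = lam * (lead_sign k * f k x) + lam * green_num q p f2 k x lam / scat q p lam); last by field.
  by rewrite e2; field.
apply: le_trans (cabs_leD _ _) _; rewrite lerD2l cabsM cabsV.
have [hb _ _] := hc; apply: ler_pM; rewrite ?cabs_ge0 ?invr_ge0 ?cabs_ge0 //.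
  exact: le_trans (hb _ hl) (ler_norm c).
rewrite -[2]invrK lef_pV2 ?posrE ?invr_gt0 //; lra.
Qed.

(** A zero Wronskian makes the two solutions proportional at one point, and
    uniqueness for the Cauchy problem propagates this. *)
Lemma zero_proportional z : upper R z -> scat q p z = 0 ->
  exists b, forall k x, mleft q p z k x = b * mright q p z k x.
Proof.
move=> hz az.
have [K hK] := jost_limit (refl_c1_decays hp) (refl_c1_decays hq).
have KX : 0 < 2 * (`|K| + 1) by have := normr_ge0 K; lra.
have [|X HX] := @atan_add_small R ((2 * (`|K| + 1))^-1); first by rewrite invr_gt0.
have r0 : right q p z true (- X) != 0.
  have [h _] := hK _ hz X; have hX := HX _ (lexx X); have a0 := atan_add_ge0 X.
  apply/eqP => e; move: h.
  have -> : (jost (refl p) (refl q) z).1 X = 0 by move: e; rewrite /right /left /= opprK.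
  rewrite sub0r cabsN cabs1 => h.
  have {}hX : (atan X + pi / 2) * (2 * (`|K| + 1)) < 1 by rewrite -ltr_pdivlMr // div1r.
  by have := ler_norm K; nra.
have m0 : mright q p z true (- X) != 0 by rewrite /mright mulf_neq0 // osc_neq0.
pose b := mleft q p z true (- X) / mright q p z true (- X).
have [_ _ [M dq] _] := hq; have [_ _ [N dp] _] := hp.
have hy : solves q p z (fun k x => mleft q p z k x - b * mright q p z k x).
  move=> x; have [l1 l2] := mleft_solves hq hp hz x.
  have [s1 s2] := mright_solves hq hp hz x; split.
    by apply: cder_eq (cderB l1 (cderM (cder_cst b x) s1)) _; ring.
  by apply: cder_eq (cderB l2 (cderM (cder_cst b x) s2)) _; ring.
exists b => k x; apply/eqP; rewrite -subr_eq0; apply/eqP; move: x k.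
apply: (solves_zero (B := Num.max M N) (x0 := - X) _ _ hy).
- by move=> x; rewrite le_max (decays_bounded dq x).
- by move=> x; rewrite le_max (decays_bounded dp x) orbT.
- have w0 := scat_wronskian hq hp (- X) hz; rewrite az /wronskian in w0.
  apply/eqP; rewrite -(mulIr_eq0 _ (mulIf m0)) mulrBl; apply/eqP.
  by rewrite /b -[RHS]w0; field.
- by rewrite /b divfK // subrr.
Qed.

Lemma source_w (g : R -> R[i]) : source g -> exists2 M, 0 <= M & forall s, cabs (g s) <= M * w s.
Proof.
move=> [_ [M hM]]; exists M; first exact: decays_ge0 hM.
by move=> s; exact: decays_w.
Qed.

Lemma pairing_integrable_real f (y : bool -> R -> R[i]) (B : R) :
  (forall k, ccont (y k)) -> (forall k x, cabs (y k x) <= B) ->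
  source (f false) -> source (f true) -> cintegrable setT (pairing y f).
Proof.
move=> cy bB s1 s2; have [M1 M10 h1] := source_w s1; have [M2 M20 h2] := source_w s2.
have [[c1 _] [c2 _]] := (s1, s2).
apply: (@cintegrable_w _ _ _ (B * M2 + B * M1)) => //.
  by apply: ccont_cmeasurable => //; apply: ccontB; exact: ccontM.
move=> s _; apply: le_trans (cabs_leB _ _) _; rewrite !cabsM mulrDl -!mulrA.
by apply: lerD; apply: ler_pM; rewrite ?cabs_ge0.
Qed.

Lemma mleft_ccont lam k : upper R lam -> ccont (mleft q p lam k).
Proof.
move=> hl; have h := mleft_solves hq hp hl.
by case: k; apply: cder_cont => x; have [h1 h2] := h x; [exact: h2|exact: h1].
Qed.

Lemma pairing_integrable_line f (t : R) : source (f false) -> source (f true) ->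
  cintegrable setT (pairing (mleft q p t%:C) f).
Proof.
have ht : upper R t%:C by rewrite /upper /=.
have [B B0 hB] := left_bounded hq hp.
apply: (@pairing_integrable_real _ _ B) => [k|k x]; first exact: mleft_ccont.
by rewrite cabsM osc_real mul1r; have [] := hB _ ht k x.
Qed.

(** Being proportional to a right solution, the left solution is bounded at both
    ends. *)
Lemma pairing_integrable_zero f z : upper R z -> scat q p z = 0 ->
  source (f false) -> source (f true) ->
  cintegrable setT (pairing (mleft q p z) f).
Proof.
move=> hz az; have [b hb] := zero_proportional hz az.
have [B B0 hB] := left_bounded hq hp.
apply: (@pairing_integrable_real _ _ (B + cabs b * B)) => [k|k x]; first exact: mleft_ccont.
have b0 : 0 <= cabs b * B by rewrite mulr_ge0 ?cabs_ge0.
have [hL hR] := hB _ hz k x.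
have [x0|x0] := leP x 0.
  apply: (@le_trans _ _ B); last by rewrite lerDl.
  rewrite /mleft cabsM -[leRHS]mul1r; apply: ler_pM; rewrite ?cabs_ge0 //.
  by rewrite cabs_osc // oppr_ge0.
apply: (@le_trans _ _ (cabs b * B)); last by rewrite lerDr.
rewrite hb cabsM ler_wpM2l ?cabs_ge0 // /mright cabsM -[leRHS]mul1r.
apply: ler_pM; rewrite ?cabs_ge0 // cabs_osc //; exact: ltW.
Qed.

(** The two half-line integrals of [green_numE] join into one, as the solutions are
    proportional. *)
Lemma green_num_zero f k x z : upper R z -> scat q p z = 0 ->
  source (f false) -> source (f true) ->
  green_num q p f k x z = mright q p z k x * cintegral setT (pairing (mleft q p z) f).
Proof.
move=> hz az s1 s2; have i := pairing_integrable_zero hz az s1 s2.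
have [b hb] := zero_proportional hz az.
rewrite (green_numE hq hp) // (cintegral_split x i) mulrDr; congr (_ + _).
have [i2 _] := green_right_pairing hq hp x hz s1 s2.
have -> : cintegral (cy x) (pairing (mleft q p z) f) = b * cintegral (cy x) (pairing (mright q p z) f).
  by rewrite -cintegralZ //; apply: eq_cintegral => s _; rewrite /pairing !hb; ring.
by rewrite hb; ring.
Qed.

(** The residues at the zeros of [scat] are products of a right solution and of
    the pairing of a left solution with the source; lead_sign k * f k x / lam is the
    leading term at infinity. *)
Lemma upper_contribution f f' f'' (n : nat) (z al : 'I_n -> R[i]) k x :
  (forall k, c1_decays (f k) (f' k)) -> (forall k, c1_decays (f' k) (f'' k)) ->
  (forall j, 0 < complex.Im (z j)) -> injective z ->
  (forall j, scat q p (z j) = 0) ->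
  (forall l, upper R l -> (forall j, l <> z j) -> scat q p l != 0) ->
  (forall j, has_der (scat q p) (z j) (al j)) -> (forall j, al j != 0) ->
  cintegrable setT (fun t : R => green_num q p f k x t%:C / scat q p t%:C -
     lead_sign k * f k x / (t%:C + 'i%C)) /\
  cintegral setT (fun t : R => green_num q p f k x t%:C / scat q p t%:C -
     lead_sign k * f k x / (t%:C + 'i%C)) =
   (2 * pi)%:C * 'i%C * \sum_(j < n) (al j)^-1 * cintegral setT (pairing (mleft q p (z j)) f)
      * mright q p (z j) k x.
Proof.
move=> h1 h2 zpos zinj az an ad a0.
have [s1 _] := c1_decays_source (h1 false); have [s2 _] := c1_decays_source (h1 true).
have [cN hN] := green_num_dd hq hp k x s1 s2; have [ca ha] := scat_dd hq hp.
have [rho rho0 [C hl]] := green_num_large k x h1 h2.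
have [i e] := residue_integral hN ha zpos zinj az an ad a0 rho0 hl.
split => //; rewrite e; congr (_ * _); apply: eq_bigr => j _.
rewrite green_num_zero //; last by rewrite /upper /= ltW.
by ring.
Qed.

End Expansion.

Section Jump.
Context {R : realType}.

Section Propagator.
Variables (q p : R -> R[i]) (lam : R[i]) (y z y' z' : bool -> R -> R[i]) (a b : R[i]).
Hypotheses (sy : solves q p lam y) (sz : solves q p lam z).
Hypotheses (sy' : solves q p lam y') (sz' : solves q p lam z').
Hypotheses (a0 : a != 0) (b0 : b != 0).
Hypothesis ha : forall x, wronskian y z x = a.
Hypothesis hb : forall x, wronskian y' z' x = b.

(** Both sides are the propagator from s to x of the linear system, written in
    two different bases of solutions. *)
Lemma propagator_basis f k x s :
  a^-1 * (y k x * pairing z f s - z k x * pairing y f s) =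
  b^-1 * (y' k x * pairing z' f s - z' k x * pairing y' f s).
Proof.
pose al := wronskian y' z x; pose be := wronskian y y' x.
pose ga := wronskian z' z x; pose de := wronskian y z' x.
have ey j r : y' j r = (al * y j r + be * z j r) / a.
  rewrite /al /be (wronskian_cst sy' sz x r) (wronskian_cst sy sy' x r) -(ha r).
  have : wronskian y z r != 0 by rewrite ha.
  by rewrite /wronskian; case: j => w0; field.
have ez j r : z' j r = (ga * y j r + de * z j r) / a.
  rewrite /ga /de (wronskian_cst sz' sz x r) (wronskian_cst sy sz' x r) -(ha r).
  have : wronskian y z r != 0 by rewrite ha.
  by rewrite /wronskian; case: j => w0; field.
have hab : al * de - be * ga = a * b.
  have : wronskian y' z' s = (al * de - be * ga) / a ^+ 2 * wronskian y z s.
    by rewrite /wronskian !ey !ez; field.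
  by rewrite hb ha => ->; field.
have -> : y' k x * pairing z' f s - z' k x * pairing y' f s =
    (al * de - be * ga) / a ^+ 2 * (y k x * pairing z f s - z k x * pairing y f s).
  by rewrite /pairing !ey !ez; field.
by rewrite hab; field; rewrite a0 b0.
Qed.

Lemma propagator_integral f k x :
  cintegrable (cy x) (pairing y f) -> cintegrable (cy x) (pairing z f) ->
  cintegrable (cy x) (pairing y' f) -> cintegrable (cy x) (pairing z' f) ->
  a^-1 * (y k x * cintegral (cy x) (pairing z f) - z k x * cintegral (cy x) (pairing y f)) =
  b^-1 * (y' k x * cintegral (cy x) (pairing z' f) - z' k x * cintegral (cy x) (pairing y' f)).
Proof.
move=> iy iz iy' iz'.
have m := measurable_cy x.
have jy := cintegrableZ (z k x) m iy; have jz := cintegrableZ (y k x) m iz.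
have jy' := cintegrableZ (z' k x) m iy'; have jz' := cintegrableZ (y' k x) m iz'.
rewrite -!cintegralZ // -!cintegralB // -!cintegralZ //; try exact: cintegrableB.
by apply: eq_cintegral => s _; exact: propagator_basis.
Qed.

End Propagator.

Lemma jump_algebra (a b I1 I2 A1 A2 B1 B2 m1 m2 n1 n2 : R[i]) :
  a^-1 * (m1 * A2 - m2 * A1) = b^-1 * (n1 * B2 - n2 * B1) ->
  (m2 * I1 + m1 * A2) / a - (n2 * I2 + n1 * B2) / b =
  a^-1 * (I1 + A1) * m2 - b^-1 * (I2 + B1) * n2.
Proof.
move=> E; apply: subr0_eq.
transitivity (a^-1 * (m1 * A2 - m2 * A1) - b^-1 * (n1 * B2 - n2 * B1)); first by ring.
by rewrite E subrr.
Qed.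

Variables q q' p p' : R -> R[i].
Hypotheses (hq : c1_decays q q') (hp : c1_decays p p').

(** The lower half-plane objects are those of the upper half-plane for the
    exchanged potentials at the opposite spectral parameter.  On the real line
    the two resolvents differ by a solution of the homogeneous system, read off
    from the behaviour at +oo. *)
Lemma jump_identity (f : bool -> R -> R[i]) (lam lam' : R[i]) k x :
  upper R lam -> upper R lam' -> lam' = - lam ->
  source (f false) -> source (f true) ->
  cintegrable setT (pairing (mleft q p lam) f) ->
  cintegrable setT (pairing (mleft p q lam') (flip f)) ->
  scat q p lam != 0 -> scat p q lam' != 0 ->
  green_num q p f k x lam / scat q p lam -
  green_num p q (flip f) (~~ k) x lam' / scat p q lam' =
  (scat q p lam)^-1 * cintegral setT (pairing (mleft q p lam) f) * mright q p lam k x -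
  (scat p q lam')^-1 * cintegral setT (pairing (mleft p q lam') (flip f)) * mright p q lam' (~~ k) x.
Proof.
move=> hl hl' el s1 s2 i1 i2 a0 b0.
have [j1 _] := green_right_pairing hq hp x hl s1 s2.
have [j2 _] := green_right_pairing hp hq (f := flip f) x hl' s2 s1.
rewrite (green_numE hq hp k x hl s1 s2) (green_numE hp hq (f := flip f) (~~ k) x hl' s2 s1).
rewrite (cintegral_split x i1) (cintegral_split x i2).
have c1 : cintegrable (cy x) (pairing (mleft q p lam) f) by exact: cintegrableS i1.
have c2 : cintegrable (cy x) (pairing (mleft p q lam') (flip f)) by exact: cintegrableS i2.
apply: jump_algebra.
have sL : solves q p lam (flip (mleft p q lam')).
  by apply: solves_flip; rewrite -el; exact: (mleft_solves hp hq).
have sM : solves q p lam (flip (mright p q lam')).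
  by apply: solves_flip; rewrite -el; exact: (mright_solves hp hq).
have b0' : - scat p q lam' != 0 by rewrite oppr_eq0.
have hb y : wronskian (flip (mleft p q lam')) (flip (mright p q lam')) y = - scat p q lam'.
  by rewrite wronskian_flip (scat_wronskian hp hq).
have pf y (h : bool -> R -> R[i]) s : pairing (flip y) h s = - pairing y (flip h) s.
  by rewrite /pairing /flip /=; ring.
have k1 : cintegrable (cy x) (pairing (flip (mleft p q lam')) f).
  by apply: eq_cintegrable (cintegrableN _ c2) => // s _; rewrite pf.
have k2 : cintegrable (cy x) (pairing (flip (mright p q lam')) f).
  by apply: eq_cintegrable (cintegrableN _ j2) => // s _; rewrite pf.
have := propagator_integral (mleft_solves hq hp hl) (mright_solves hq hp hl) sL sM a0 b0'
  (fun y => scat_wronskian hq hp y hl) hb k c1 j1 k1 k2.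
have -> : cintegral (cy x) (pairing (flip (mleft p q lam')) f) =
    - cintegral (cy x) (pairing (mleft p q lam') (flip f)).
  by rewrite -cintegralN //; apply: eq_cintegral => s _; rewrite pf.
have -> : cintegral (cy x) (pairing (flip (mright p q lam')) f) =
    - cintegral (cy x) (pairing (mright p q lam') (flip f)).
  by rewrite -cintegralN //; apply: eq_cintegral => s _; rewrite pf.
by move=> ->; rewrite invrN /flip; ring.
Qed.

End Jump.

(** * Schwartz functions and the Jost functions of the statement *)

Section Schwartz.
Context {R : realType}.

Lemma schwartzR_derive (h : R -> R) n (x : R) : schwartzR h ->
  is_derive x 1 (derive1n n h) (derive1n n.+1 h x).
Proof.
move=> [hd _]; apply: DeriveDef; first exact: hd.
by rewrite derive1nS derive1E.
Qed.

(** (1 + x ^ 2) ^ 2 = 1 + 2 x ^ 2 + x ^ 4. *)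
Lemma schwartzR_decays (h : R -> R) n : schwartzR h ->
  exists M, forall x, `|derive1n n h x| <= M * w x ^+ 2.
Proof.
move=> [_ hb]; have [M0 h0] := hb 0%N n; have [M2 h2] := hb 2 n; have [M4 h4] := hb 4 n.
exists (M0 + 2 * M2 + M4) => x.
rewrite /w exprVn ler_pdivlMr; last by rewrite exprn_gt0 //; have := sqr_ge0 x; lra.
have := h0 x; have := h2 x; have := h4 x; set y0 : R := derive1n n h x; rewrite !(normrM _ y0).
have e4 : `|x ^+ 4| = x ^+ 2 ^+ 2 by rewrite -[in RHS]exprM ger0_norm // (exprM x 2 2) sqr_ge0.
have e2 : `|x ^+ 2| = x ^+ 2 by rewrite ger0_norm // sqr_ge0.
rewrite e4 e2 expr0 normr1 mul1r; set y := `|_|; set z := x ^+ 2.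
by rewrite !expr2; nra.
Qed.

Definition cder_n (g : R -> R[i]) (n : nat) : R -> R[i] := fun x =>
  Complex (derive1n n (fun x => complex.Re (g x)) x) (derive1n n (fun x => complex.Im (g x)) x).

Lemma cder_n0 (g : R -> R[i]) : cder_n g 0 = g.
Proof. by apply/funext => x; rewrite /cder_n /=; case: (g x). Qed.

Lemma schwartzC_c1_decays (g : R -> R[i]) n : schwartzC g -> c1_decays (cder_n g n) (cder_n g n.+1).
Proof.
move=> [h1 h2].
have d m x : cder (cder_n g m) x (cder_n g m.+1 x).
  by split; exact: schwartzR_derive.
have b m : exists M, decays (cder_n g m) M.
  have [M1 b1] := schwartzR_decays m h1; have [M2 b2] := schwartzR_decays m h2.
  exists (M1 + M2) => x; apply: le_trans (cabs_le_ReIm _) _.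
  by rewrite mulrDl; apply: lerD; [exact: b1|exact: b2].
split; [exact: d|exact: cder_cont (d n.+1)|exact: b|exact: b].
Qed.

Lemma cabs_conj (z : R[i]) : cabs z^*%C = cabs z.
Proof. by case: z => a b; rewrite !cabs_sqrt /= sqrrN. Qed.

Lemma c1_decays_conj (f f' : R -> R[i]) : c1_decays f f' ->
  c1_decays (fun x => (f x)^*%C) (fun x => (f' x)^*%C).
Proof.
have ReJ (z : R[i]) : complex.Re z^*%C = complex.Re z by case: z.
have ImJ (z : R[i]) : complex.Im z^*%C = - complex.Im z by case: z.
have eR (h : R -> R[i]) : (fun x => complex.Re (h x)^*%C) = fun x => complex.Re (h x).
  by apply/funext => x; rewrite ReJ.
have eI (h : R -> R[i]) : (fun x => complex.Im (h x)^*%C) = - (fun x => complex.Im (h x)).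
  by apply/funext => x; rewrite ImJ.
move=> [d [c1 c2] [M b] [M' b']]; split.
- move=> x; have [d1 d2] := d x; split; first by rewrite eR ReJ.
  by rewrite eI ImJ; exact: is_deriveN.
- split => x; first by rewrite eR; exact: c1.
  by rewrite eI; apply: cvgN; exact: c2.
- by exists M => x; rewrite cabs_conj.
- by exists M' => x; rewrite cabs_conj.
Qed.

End Schwartz.

(** The two entries of a vector integral equation of the statement are a pair of
    scalar Volterra equations; an equation integrated over [x, +oo[ becomes one
    over ]-oo, - x] by the reflection x |-> - x. *)
Section Bridge.
Context {R : realType}.
Variables (tau : R) (q : R -> R[i]).

Lemma sum_ord2 (F : 'I_2 -> R[i]) : \sum_k F k = F 0 + F 1.
Proof.
by rewrite big_ord_recl big_ord_recl big_ord0 addr0; congr (_ + F _); exact: val_inj.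
Qed.

Definition conj_potential : R -> R[i] := fun x => tau%:C * (q x)^*%C.

Lemma Qmx_entries (s : R) (r : 'cV[R[i]]_2) a b :
  (diag2 a b *m Qmx tau q s *m r) 0 0 = q s * (a * r 1 0) /\
  (diag2 a b *m Qmx tau q s *m r) 1 0 = conj_potential s * (b * r 0 0).
Proof.
have Q0 (k : 'I_2) : Qmx tau q s 0 k = row2 0 (q s) 0 k.
  rewrite /Qmx (_ : (0 : 'I_2) = lshift 1 (0 : 'I_1)); last exact: val_inj.
  by rewrite (col_mxEu (row2 0 (q s))).
have Q1 (k : 'I_2) : Qmx tau q s 1 k = row2 (conj_potential s) 0 0 k.
  rewrite /Qmx (_ : (1 : 'I_2) = rshift 1 (0 : 'I_1)); last exact: val_inj.
  by rewrite (col_mxEd (row2 0 (q s))).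
rewrite -mulmxA /diag2 mul_diag_mx !mxE !sum_ord2 !Q0 !Q1 !mxE /=.
by split; ring.
Qed.

Variables (i j : 'I_2) (ker : R -> 'M[R[i]]_2) (e : 'cV[R[i]]_2).
Variables (Q1 Q2 : R -> R[i]) (mu : R[i]).
Hypotheses (ij : forall k : 'I_2, k = i \/ k = j) (ei : e i 0 = 1) (ej : e j 0 = 0).
Hypothesis ki : forall y s (r : 'cV[R[i]]_2),
  (ker y *m Qmx tau q s *m r) i 0 = Q1 s * r j 0.

Lemma boundedV_entries (r : R -> 'cV[R[i]]_2) : boundedV r <->
  exists B : R, forall x, cabs (r x i 0) <= B /\ cabs (r x j 0) <= B.
Proof.
split=> [[M hM]|[B hB]].
  by exists M => x; split; have := hM x; [move=> /(_ i)|move=> /(_ j)]; rewrite cabsE lecR.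
exists B => x k; rewrite cabsE lecR; have [b1 b2] := hB x.
by have [->|->] := ij k.
Qed.

Lemma col_entries (u v : 'cV[R[i]]_2) : u i 0 = v i 0 -> u j 0 = v j 0 -> u = v.
Proof.
by move=> h1 h2; apply/matrixP => k l; rewrite ord1; have [->|->] := ij k.
Qed.

Lemma jost_left_entries (r : R -> 'cV[R[i]]_2) :
  (forall y s (r : 'cV[R[i]]_2), (ker y *m Qmx tau q s *m r) j 0 =
     Q2 s * (osc (2 * y) mu * r i 0)) ->
  jost_left tau q e ker r <-> left_jost Q1 Q2 mu (fun x => r x i 0) (fun x => r x j 0).
Proof.
move=> kj.
have Ei x : (fun s => (ker (x - s) *m Qmx tau q s *m r s) i 0) = fun s => Q1 s * r s j 0.
  by apply/funext => s; rewrite ki.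
have Ej x : (fun s => (ker (x - s) *m Qmx tau q s *m r s) j 0) =
    fun s => Q2 s * (osc (2 * (x - s)) mu * r s i 0).
  by apply/funext => s; rewrite kj.
split=> [[/boundedV_entries b h]|[b h]]; split.
- exact: b.
- move=> x; have [I /= E] := h x.
  have E' k : r x k 0 = e k 0 + cintegral (Ny x) (fun s => (ker (x - s) *m Qmx tau q s *m r s) k 0).
    by rewrite {1}E !mxE.
  by split; [move: (I i)|move: (I j)|move: (E' i)|move: (E' j)]; rewrite ?Ei ?Ej ?ei ?ej.
- exact/boundedV_entries.
move=> x /=; have [i1 i2 E1 E2] := h x; split.
  by move=> k; have [->|->] := ij k; rewrite ?Ei ?Ej.
by apply: col_entries; rewrite !mxE ?Ei ?Ej ?ei ?ej.
Qed.

Lemma jost_right_entries (r : R -> 'cV[R[i]]_2) :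
  (forall y s (r : 'cV[R[i]]_2), (ker y *m Qmx tau q s *m r) j 0 =
     Q2 s * (osc (2 * - y) mu * r i 0)) ->
  jost_right tau q e ker r <->
  left_jost (refl Q1) (refl Q2) mu (fun x => r (- x) i 0) (fun x => r (- x) j 0).
Proof.
move=> kj.
pose Fi s := Q1 s * r s j 0; pose Fj x s := Q2 s * (osc (2 * - (x - s)) mu * r s i 0).
have Ei x : (fun s => (ker (x - s) *m Qmx tau q s *m r s) i 0) = Fi.
  by apply/funext => s; rewrite ki.
have Ej x : (fun s => (ker (x - s) *m Qmx tau q s *m r s) j 0) = Fj x.
  by apply/funext => s; rewrite kj.
have Ri : (fun s => refl Q1 s * r (- s) j 0) = (fun s => - Fi (- s)).
  by apply/funext => s; rewrite /refl /Fi mulNr.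
have Rj x : (fun s => refl Q2 s * (osc (2 * (x - s)) mu * r (- s) i 0)) =
    (fun s => - Fj (- x) (- s)).
  apply/funext => s; rewrite /refl /Fj mulNr; congr (- (_ * (osc (2 * _) _ * _))); ring.
have down x (F : R -> R[i]) : cintegrable (cy (- x)) F -> cintegrable (Ny x) (fun s => - F (- s)) /\
    cintegral (Ny x) (fun s => - F (- s)) = - cintegral (cy (- x)) F.
  move=> I.
  have P : (-%R : R -> R) @^-1` (cy (- x)) = Ny x by rewrite opp_preimage_cy opprK.
  have J := cintegrable_reflect (D := cy (- x)) (D' := Ny x) (measurable_cy _) P I.
  split; first exact: cintegrableN (measurable_Ny x) J.
  rewrite (cintegralN (measurable_Ny x) J).
  by rewrite (cintegral_reflect (measurable_cy _) (measurable_Ny _) P I).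
have up x (F : R -> R[i]) : cintegrable (Ny x) (fun s => - F (- s)) -> cintegrable (cy (- x)) F.
  move=> I.
  have P : (-%R : R -> R) @^-1` (Ny x) = cy (- x) by exact: opp_preimage_Ny.
  have := cintegrable_reflect (D := Ny x) (D' := cy (- x)) (measurable_Ny _) P
    (cintegrableN (measurable_Ny x) I).
  by apply: eq_cintegrable; [exact: measurable_cy|move=> s _; rewrite !opprK].
split=> [[/boundedV_entries [B b] h]|[[B b] h]]; split.
- by exists B => x; exact: b.
- move=> x; have [I /= E] := h (- x).
  have E' k : r (- x) k 0 = e k 0 - cintegral (cy (- x))
      (fun s => (ker (- x - s) *m Qmx tau q s *m r s) k 0).
    by rewrite {1}E !mxE.
  have [I1 e1] : cintegrable (Ny x) (fun s => - Fi (- s)) /\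
      cintegral (Ny x) (fun s => - Fi (- s)) = - cintegral (cy (- x)) Fi.
    by apply: down; rewrite -(Ei (- x)); exact: I.
  have [I2 e2] : cintegrable (Ny x) (fun s => - Fj (- x) (- s)) /\
      cintegral (Ny x) (fun s => - Fj (- x) (- s)) = - cintegral (cy (- x)) (Fj (- x)).
    by apply: down; rewrite -(Ej (- x)); exact: I.
  split; rewrite ?Ri ?Rj //.
    by rewrite e1 E' ei Ei.
  by rewrite e2 E' ej Ej.
- by apply/boundedV_entries; exists B => x; rewrite -(opprK x); exact: b.
move=> x /=; have [I1 I2 E1 E2] := h (- x).
rewrite Ri in I1 E1; rewrite Rj opprK in I2 E2.
have J1 := up _ _ I1; have J2 := up _ _ I2.
have [_ e1] := down _ _ J1; have [_ e2] := down _ _ J2.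
rewrite opprK in J1 J2 e1 e2 E1 E2; split.
  by move=> k; have [->|->] := ij k; rewrite ?Ei ?Ej.
by apply: col_entries; rewrite !mxE ?Ei ?Ej ?ei ?ej; [rewrite -e1|rewrite -e2].
Qed.

End Bridge.

Section JostEntries.
Context {R : realType}.
Variables (tau : R) (q q' p' : R -> R[i]).

Let p := conj_potential tau q.

Hypotheses (hq : c1_decays q q') (hp : c1_decays p p').

Section Generic.
Variables (i j : 'I_2) (ker : R -> 'M[R[i]]_2) (e : 'cV[R[i]]_2).
Variables (Q1 Q1' Q2 Q2' : R -> R[i]) (mu : R[i]).
Hypotheses (h1 : c1_decays Q1 Q1') (h2 : c1_decays Q2 Q2') (hmu : upper R mu).
Hypotheses (ij : forall k : 'I_2, k = i \/ k = j) (ji : j != i).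
Hypotheses (ei : e i 0 = 1) (ej : e j 0 = 0).
Hypothesis ki : forall y s (r : 'cV[R[i]]_2),
  (ker y *m Qmx tau q s *m r) i 0 = Q1 s * r j 0.

(** The definite description is met, because [jost] provides a solution of the vector
    equation, and its entries are then given by uniqueness. *)
Lemma xget_jost_left :
  (forall y s (r : 'cV[R[i]]_2), (ker y *m Qmx tau q s *m r) j 0 =
     Q2 s * (osc (2 * y) mu * r i 0)) ->
  let r := xget (fun=> 0) [set r | jost_left tau q e ker r] in
  forall x, r x i 0 = (jost Q1 Q2 mu).1 x /\ r x j 0 = (jost Q1 Q2 mu).2 x.
Proof.
move=> kj r x.
have E r1 := jost_left_entries ij ei ej ki r1 kj.
have [J _ _] := jostP h1 h2 hmu.
pose r0 y : 'cV[R[i]]_2 :=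
  \col_k (if k == i then (jost Q1 Q2 mu).1 y else (jost Q1 Q2 mu).2 y).
have J0 : jost_left tau q e ker r0.
  apply/E; rewrite (_ : (fun y => r0 y i 0) = (jost Q1 Q2 mu).1); last first.
    by apply/funext => y; rewrite mxE eqxx.
  rewrite (_ : (fun y => r0 y j 0) = (jost Q1 Q2 mu).2) //.
  by apply/funext => y; rewrite mxE (negbTE ji).
have /E Jr := xgetPex (fun=> 0) (P := [set r | jost_left tau q e ker r]) (ex_intro _ r0 J0).
by rewrite (jost_unique h1 h2 hmu Jr).
Qed.

Lemma xget_jost_right :
  (forall y s (r : 'cV[R[i]]_2), (ker y *m Qmx tau q s *m r) j 0 =
     Q2 s * (osc (2 * - y) mu * r i 0)) ->
  let r := xget (fun=> 0) [set r | jost_right tau q e ker r] in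
  forall x, r x i 0 = (jost (refl Q1) (refl Q2) mu).1 (- x) /\
            r x j 0 = (jost (refl Q1) (refl Q2) mu).2 (- x).
Proof.
move=> kj r x.
have E r1 := jost_right_entries ij ei ej ki r1 kj.
have [g1 g2] := (refl_c1_decays h1, refl_c1_decays h2).
have [J _ _] := jostP g1 g2 hmu.
pose J1 := (jost (refl Q1) (refl Q2) mu).1; pose J2 := (jost (refl Q1) (refl Q2) mu).2.
pose r0 y : 'cV[R[i]]_2 := \col_k (if k == i then J1 (- y) else J2 (- y)).
have J0 : jost_right tau q e ker r0.
  apply/E; rewrite (_ : (fun y => r0 (- y) i 0) = J1); last first.
    by apply/funext => y; rewrite mxE eqxx opprK.
  rewrite (_ : (fun y => r0 (- y) j 0) = J2) //.
  by apply/funext => y; rewrite mxE (negbTE ji) opprK.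
have /E Jr := xgetPex (fun=> 0) (P := [set r | jost_right tau q e ker r]) (ex_intro _ r0 J0).
by rewrite (jost_unique g1 g2 hmu Jr) /= opprK.
Qed.

End Generic.

Definition idx (k : bool) : 'I_2 := if k then 1 else 0.

Let two01 (k : 'I_2) : k = 0 \/ k = 1.
Proof. by case: k => [[|[|//]] h]; [left|right]; exact: val_inj. Qed.

Let two10 (k : 'I_2) : k = 1 \/ k = 0.
Proof. by case: (two01 k); [right|left]. Qed.

Lemma r1m_entries lam k x : upper R lam -> r1m tau q lam x (idx k) 0 = left q p lam k x.
Proof.
move=> hl.
have [] := @xget_jost_left 0 1 (ker1 lam) (e1 R) q q' p p' lam hq hp hl two01 isT _ _ _ _ x.
- by rewrite !mxE.
- by rewrite !mxE.
- by move=> y s r; have [-> _] := Qmx_entries tau q s r 1 (cexp (2 * 'i%C * lam * y%:C)); rewrite mul1r.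
- move=> y s r; have [_ ->] := Qmx_entries tau q s r 1 (cexp (2 * 'i%C * lam * y%:C)).
  rewrite oscE rmorphM /= rmorph_nat; congr (_ * (cexp _ * _)); ring.
by rewrite -/(r1m tau q lam) => h1 h2; case: k.
Qed.

Lemma r1p_entries lam k x : upper R (- lam) ->
  r1p tau q lam x (idx k) 0 = left p q (- lam) (~~ k) x.
Proof.
move=> hl.
have [] := @xget_jost_left 1 0 (ker2 lam) (e2 R) p p' q q' (- lam) hp hq hl two10 isT _ _ _ _ x.
- by rewrite !mxE.
- by rewrite !mxE.
- by move=> y s r; have [_ ->] := Qmx_entries tau q s r (cexp (- (2 * 'i%C * lam * y%:C))) 1; rewrite mul1r.
- move=> y s r; have [-> _] := Qmx_entries tau q s r (cexp (- (2 * 'i%C * lam * y%:C))) 1.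
  rewrite oscE rmorphM /= rmorph_nat; congr (_ * (cexp _ * _)); ring.
by rewrite -/(r1p tau q lam) => h1 h2; case: k.
Qed.

Lemma r2p_entries lam k x : upper R lam ->
  r2p tau q lam x (idx k) 0 = right q p lam k x.
Proof.
move=> hl.
have [] := @xget_jost_right 1 0 (ker2 lam) (e2 R) p p' q q' lam hp hq hl two10 isT _ _ _ _ x.
- by rewrite !mxE.
- by rewrite !mxE.
- by move=> y s r; have [_ ->] := Qmx_entries tau q s r (cexp (- (2 * 'i%C * lam * y%:C))) 1; rewrite mul1r.
- move=> y s r; have [-> _] := Qmx_entries tau q s r (cexp (- (2 * 'i%C * lam * y%:C))) 1.
  rewrite oscE rmorphM /= rmorph_nat rmorphN /=; congr (_ * (cexp _ * _)); ring.
by rewrite -/(r2p tau q lam) => h1 h2; case: k.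
Qed.

Lemma r2m_entries lam k x : upper R (- lam) ->
  r2m tau q lam x (idx k) 0 = right p q (- lam) (~~ k) x.
Proof.
move=> hl.
have [] := @xget_jost_right 0 1 (ker1 lam) (e1 R) q q' p p' (- lam) hq hp hl two01 isT _ _ _ _ x.
- by rewrite !mxE.
- by rewrite !mxE.
- by move=> y s r; have [-> _] := Qmx_entries tau q s r 1 (cexp (2 * 'i%C * lam * y%:C)); rewrite mul1r.
- move=> y s r; have [_ ->] := Qmx_entries tau q s r 1 (cexp (2 * 'i%C * lam * y%:C)).
  rewrite oscE rmorphM /= rmorph_nat rmorphN /=; congr (_ * (cexp _ * _)); ring.
by rewrite -/(r2m tau q lam) => h1 h2; case: k.
Qed.

Lemma m1m_entries lam k x : upper R lam -> m1m tau q x lam (idx k) 0 = mleft q p lam k x.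
Proof.
move=> hl; rewrite mxE r1m_entries // /mleft oscE rmorphN /=.
by congr (cexp _ * _); ring.
Qed.

Lemma m2p_entries lam k x : upper R lam -> m2p tau q x lam (idx k) 0 = mright q p lam k x.
Proof. by move=> hl; rewrite mxE r2p_entries // /mright oscE. Qed.

Lemma m1p_entries lam k x : upper R (- lam) ->
  m1p tau q x lam (idx k) 0 = mleft p q (- lam) (~~ k) x.
Proof.
move=> hl; rewrite mxE r1p_entries // /mleft oscE rmorphN /=.
by congr (cexp _ * _); ring.
Qed.

Lemma m2m_entries lam k x : upper R (- lam) ->
  m2m tau q x lam (idx k) 0 = mright p q (- lam) (~~ k) x.
Proof.
move=> hl; rewrite mxE r2m_entries // /mright oscE.
by congr (cexp _ * _); ring.
Qed.

Lemma det_ord2 (A : 'M[R[i]]_2) : \det A = A 0 0 * A 1 1 - A 0 1 * A 1 0.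
Proof.
rewrite (expand_det_row _ 0) sum_ord2 /cofactor !det_mx11 !mxE /=.
rewrite (_ : lift 0 0 = 1 :> 'I_2); last exact: val_inj.
rewrite (_ : lift 1 0 = 0 :> 'I_2); last exact: val_inj.
by rewrite addn0 addn1 /= expr0 expr1; ring.
Qed.

Lemma det2E (u v : 'cV[R[i]]_2) : det2 u v = u 0 0 * v 1 0 - u 1 0 * v 0 0.
Proof.
have L k : (row_mx u v : 'M[R[i]]_2) k 0 = u k 0.
  rewrite (_ : (0 : 'I_2) = lshift 1 (0 : 'I_1)); last exact: val_inj.
  exact: (row_mxEl u v k 0).
have Rt k : (row_mx u v : 'M[R[i]]_2) k 1 = v k 0.
  rewrite (_ : (1 : 'I_2) = rshift 1 (0 : 'I_1)); last exact: val_inj.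
  exact: (row_mxEr u v k 0).
by rewrite /det2 det_ord2 !L !Rt; ring.
Qed.

Lemma scat_a_scat lam : upper R lam -> scat_a tau q lam = scat q p lam.
Proof.
move=> hl; rewrite /scat_a det2E.
have e1 : m1m tau q 0 lam 0 0 = _ := m1m_entries false 0 hl.
have e2 : m1m tau q 0 lam 1 0 = _ := m1m_entries true 0 hl.
have e3 : m2p tau q 0 lam 0 0 = _ := m2p_entries false 0 hl.
have e4 : m2p tau q 0 lam 1 0 = _ := m2p_entries true 0 hl.
by rewrite e1 e2 e3 e4; exact: (scat_wronskian hq hp 0 hl).
Qed.

Lemma scat_A_scat lam : upper R (- lam) -> scat_A tau q lam = scat p q (- lam).
Proof.
move=> hl; rewrite /scat_A det2E -(scat_wronskian hp hq 0 hl) /wronskian.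
have e1 : m2m tau q 0 lam 0 0 = _ := m2m_entries false 0 hl.
have e2 : m2m tau q 0 lam 1 0 = _ := m2m_entries true 0 hl.
have e3 : m1p tau q 0 lam 0 0 = _ := m1p_entries false 0 hl.
have e4 : m1p tau q 0 lam 1 0 = _ := m1p_entries true 0 hl.
by rewrite e1 e2 e3 e4 /=; ring.
Qed.

Variable f : R -> 'cV[R[i]]_2.

Definition entries (k : bool) (s : R) : R[i] := f s (idx k) 0.

Let row2_mul a b (v : 'cV[R[i]]_2) : (row2 a b *m v) 0 0 = a * v 0 0 + b * v 1 0.
Proof.
by rewrite mxE sum_ord2 !mxE.
Qed.

Lemma pair_p_pairing lam : upper R lam -> pair_p tau q f lam = pairing (mleft q p lam) entries.
Proof.
move=> hl; apply/funext => s; rewrite /pair_p row2_mul.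
have e1 : m1m tau q s lam 0 0 = _ := m1m_entries false s hl.
have e2 : m1m tau q s lam 1 0 = _ := m1m_entries true s hl.
by rewrite e1 e2 /pairing /entries /=; ring.
Qed.

Lemma pair_m_pairing lam : upper R (- lam) ->
  pair_m tau q f lam = pairing (mleft p q (- lam)) (flip entries).
Proof.
move=> hl; apply/funext => s; rewrite /pair_m row2_mul.
have e1 : m1p tau q s lam 0 0 = _ := m1p_entries false s hl.
have e2 : m1p tau q s lam 1 0 = _ := m1p_entries true s hl.
by rewrite e1 e2 /pairing /entries /flip /=; ring.
Qed.

End JostEntries.

(** * Reconstruction of the source *)

Lemma derive1_quadratic (K : numFieldType) (g : K -> K) (z d e c : K) : 0 < e -> 0 <= c ->
  (forall m, `|m - z| < e -> `|g m - g z - d * (m - z)| <= c * `|m - z| ^+ 2) ->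
  derive1 g z = d.
Proof.
move=> e0 c0 h; rewrite /derive1; apply: cvg_lim; first exact: norm_hausdorff.
apply/cvgrPdist_lt => /= eps eps0.
have c1 : 0 < c + 1 by rewrite ltr_wpDl.
near=> m.
have m0 : m != 0 by near: m; exact: nbhs_dnbhs_neq.
have me : `|m| < e by near: m; exact: dnbhs0_lt.
have mc : `|m| < eps / (c + 1) by near: m; apply: dnbhs0_lt; rewrite divr_gt0.
have := h (m + z); rewrite addrK => /(_ me) hm.
have -> : d - m^-1 *: (g (m + z) - g z) = - (m^-1 * (g (m + z) - g z - d * m)).
  by rewrite /GRing.scale /=; field.
rewrite normrN normrM normfV mulrC ltr_pdivrMr ?normr_gt0 //.
apply: le_lt_trans hm _; rewrite expr2 mulrA ltr_pM2r ?normr_gt0 //.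
apply: (@le_lt_trans _ _ ((c + 1) * `|m|)); first by rewrite ler_wpM2r // lerDl.
by rewrite mulrC -ltr_pdivlMr.
Unshelve. all: by end_near. Qed.

(** The derivatives of a and A are taken at interior points of half-planes, where
    expansions restricted to the half-plane suffice. *)
Lemma cderive_quadratic (R : realType) (g : R[i] -> R[i]) (z d : R[i]) (e c : R) : 0 < e ->
  (forall m, cabs (m - z) < e -> cabs (g m - g z - d * (m - z)) <= c * cabs (m - z) ^+ 2) ->
  cderive g z = d.
Proof.
move=> e0 h; apply: (@derive1_quadratic _ g z d e%:C `|c|%:C); rewrite ?ltcR ?lecR //.
move=> m; rewrite !cabsE ltcR -rmorphXn -rmorphM lecR => /h hm.
by apply: le_trans hm _; rewrite ler_wpM2r ?sqr_ge0 ?ler_norm.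
Qed.

Section LineIntegral.
Context {R : realType}.
Variables q q' p p' : R -> R[i].
Hypotheses (hq : c1_decays q q') (hp : c1_decays p p').

(** z lists all the zeros of [scat q p] in the closed upper half-plane, none of them
    real, and al the derivatives there. *)
Definition simple_upper_zeros (q p : R -> R[i]) (n : nat) (z al : 'I_n -> R[i]) : Prop :=
  [/\ injective z, forall j, 0 < complex.Im (z j) /\ scat q p (z j) = 0,
      forall l, upper R l -> (forall j, l <> z j) -> scat q p l != 0,
      forall j, has_der (scat q p) (z j) (al j) & forall j, al j != 0].

Definition residue_sum (q p : R -> R[i]) (f : bool -> R -> R[i]) (n : nat)
    (z al : 'I_n -> R[i]) (k : bool) (x : R) : R[i] :=
  \sum_(j < n) (al j)^-1 * cintegral setT (pairing (mleft q p (z j)) f) * mright q p (z j) k x.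

Definition line_term (q p : R -> R[i]) (f : bool -> R -> R[i]) (l : R[i]) (k : bool) (x : R) : R[i] :=
  (scat q p l)^-1 * cintegral setT (pairing (mleft q p l) f) * mright q p l k x.

Let leading_split (A B s F a b : R[i]) :
  A - B = A - s * F * a - (B - - s * F * - b) - s * F * (b - a).
Proof. by ring. Qed.

(** By [jump_identity] the integrand is the difference of two resolvents.  Each of
    them, corrected by its leading term at infinity, is integrated by residues; the
    two corrections differ by a multiple of 1 / (t - i) - 1 / (t + i), whose integral
    produces the value of the source. *)
Lemma line_integral (f f' f'' : bool -> R -> R[i]) (n : nat) (z al z' al' : 'I_n -> R[i]) k x :
  (forall k, c1_decays (f k) (f' k)) -> (forall k, c1_decays (f' k) (f'' k)) ->
  simple_upper_zeros q p z al -> simple_upper_zeros p q z' al' ->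
  cintegrable setT (fun t : R => line_term q p f t%:C k x -
    line_term p q (flip f) (- t%:C) (~~ k) x) /\
  cintegral setT (fun t : R => line_term q p f t%:C k x -
    line_term p q (flip f) (- t%:C) (~~ k) x) =
  (2 * pi)%:C * 'i%C * (residue_sum q p f z al k x -
     residue_sum p q (flip f) z' al' (~~ k) x - lead_sign k * f k x).
Proof.
move=> h1 h2 [zi z0 zn zd za] [zi' z0' zn' zd' za'].
have [s1 _] := c1_decays_source (h1 false); have [s2 _] := c1_decays_source (h1 true).
have h1' j : c1_decays (flip f j) (flip f' j) by exact: h1.
have h2' j : c1_decays (flip f' j) (flip f'' j) by exact: h2.
have [i1 e1] := upper_contribution hq hp k x h1 h2 (fun j => (z0 j).1) zi (fun j => (z0 j).2) zn zd za.
have [i2 e2] := upper_contribution hp hq (~~ k) x h1' h2' (fun j => (z0' j).1) zi'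
  (fun j => (z0' j).2) zn' zd' za'.
have pT : (-%R : R -> R) @^-1` setT = setT by exact: preimage_setT.
have i3 := cintegrable_reflect (D := setT) (D' := setT) measurableT pT i2.
have e3 := cintegral_reflect (D := setT) (D' := setT) measurableT measurableT pT i2.
have [i4 e4] := @integral_cauchy_kernel R.
have i5 := cintegrableZ (lead_sign k * f k x) measurableT i4.
have i6 := cintegrableB measurableT i1 i3.
have e6 := cintegralB measurableT (cintegrableB measurableT i1 i3) i5.
rewrite (cintegralB measurableT i1 i3) (cintegralZ _ measurableT i4) e1 e3 e2 e4 in e6.
have E (t : R) : line_term q p f t%:C k x - line_term p q (flip f) (- t%:C) (~~ k) x =
    green_num q p f k x t%:C / scat q p t%:C - lead_sign k * f k x / (t%:C + 'i%C) -
    (green_num p q (flip f) (~~ k) x (- t)%:C / scat p q (- t)%:C -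
      lead_sign (~~ k) * flip f (~~ k) x / ((- t)%:C + 'i%C)) -
    lead_sign k * f k x * ((t%:C - 'i%C)^-1 - (t%:C + 'i%C)^-1).
  have ht : upper R t%:C by rewrite /upper /=.
  have ht' : upper R (- t)%:C by rewrite /upper /=.
  have n0 : scat q p t%:C != 0.
    by apply: zn => // j; have [zj _] := z0 j; move=> tz; move: zj; rewrite -tz ltxx.
  have n0' : scat p q (- t)%:C != 0.
    by apply: zn' => // j; have [zj _] := z0' j; move=> tz; move: zj; rewrite -tz ltxx.
  have J := jump_identity hq hp (lam := t%:C) (lam' := (- t)%:C) k x ht ht' (rmorphN _ t) s1 s2
    (pairing_integrable_line hq hp t s1 s2)
    (pairing_integrable_line hp hq (- t) (f := flip f) s2 s1) n0 n0'.
  rewrite /line_term -rmorphN -J /flip negbK.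
  have -> : lead_sign (~~ k) = - lead_sign k :> R[i] by case: (k); rewrite /lead_sign /= ?opprK.
  have -> : ((- t)%:C + 'i%C)^-1 = - (t%:C - 'i%C)^-1 by rewrite rmorphN /= -invrN opprB addrC.
  exact: leading_split.
split.
  by apply: eq_cintegrable (cintegrableB measurableT i6 i5) => // t _; rewrite E.
under eq_cintegral do rewrite E.
by rewrite e6 /residue_sum; ring.
Qed.

End LineIntegral.

Lemma reconstruction_algebra (R : realType) (c sg s y X Y : R[i]) :
  c != 0 -> sg * 'i%C * s = 1 ->
  y = sg * (- c^-1 * (c * 'i%C * (X - Y - s * y)) + 'i%C * X + 'i%C * - Y).
Proof.
move=> c0 e; transitivity (sg * 'i%C * s * y); first by rewrite e mul1r.
by field.
Qed.

Theorem mainTheorem3 (R : realType) (tau : R) (q : R -> R[i])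
    (f : R -> 'cV[R[i]]_2) (n : nat) (zp zm : 'I_n -> R[i])
    (htau : tau = 1 \/ tau = -1)
    (hq : schwartzC q) (hf : schwartzV f)
    (ha : forall lam : R, scat_a tau q lam%:C != 0)
    (hA : forall lam : R, scat_A tau q lam%:C != 0)
    (hzp : simple_zeros [set z | 0 < complex.Im z] (scat_a tau q) zp)
    (hzm : simple_zeros [set z | complex.Im z < 0] (scat_A tau q) zm) :
  (forall lam : R, cintegrable setT (pair_p tau q f lam%:C) /\
                   cintegrable setT (pair_m tau q f lam%:C)) /\
  (forall j : 'I_n, cintegrable setT (pair_p tau q f (zp j)) /\
                    cintegrable setT (pair_m tau q f (zm j))) /\
  (forall x : R,
     vintegrable setT (spectral_integrand tau q f x) /\
     f x = - ((2 * pi)^-1)%:C *: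
             (sigma3 R *m vintegral setT (spectral_integrand tau q f x))
           + 'i%C *: (sigma3 R *m \sum_(j < n) w_p tau q f (zp j) x)
           + 'i%C *: (sigma3 R *m \sum_(j < n) w_m tau q f (zm j) x)).
Proof.
have cq := schwartzC_c1_decays 0 hq; rewrite cder_n0 in cq.
pose p := conj_potential tau q.
have cp : c1_decays p _ := c1_decaysZ tau%:C (c1_decays_conj cq).
set F := entries f.
pose Fn m k := cder_n (F k) m.
have h1 k : c1_decays (F k) (Fn 1 k).
  by have := schwartzC_c1_decays 0 (hf (idx k)); rewrite cder_n0.
have h2 k : c1_decays (Fn 1 k) (Fn 2 k) by exact: schwartzC_c1_decays 1 (hf (idx k)).
have [s1 _] := c1_decays_source (h1 false); have [s2 _] := c1_decays_source (h1 true).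
have up_real (t : R) : upper R t%:C by rewrite /upper /=.
have up_realN (t : R) : upper R (- t%:C) by rewrite /upper /= oppr0.
have [zpi zpr zpd] := hzp; have [zmi zmr zmd] := hzm.
have zp0 j : 0 < complex.Im (zp j) /\ scat_a tau q (zp j) = 0.
  by have : [set z | 0 < complex.Im z /\ scat_a tau q z = 0] (zp j) by rewrite zpr; exists j.
have zm0 j : complex.Im (zm j) < 0 /\ scat_A tau q (zm j) = 0.
  by have : [set z | complex.Im z < 0 /\ scat_A tau q z = 0] (zm j) by rewrite zmr; exists j.
have upp j : upper R (zp j) by have [h _] := zp0 j; exact: ltW.
have upm j : upper R (- zm j).
  by have [h _] := zm0 j; rewrite /upper /= ReImE oppr_ge0 ltW.
have [c1 D1] := scat_dd cq cp; have [c2 D2] := scat_dd cp cq.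
have nearS (g : R[i] -> R[i]) c l : dd_bounded (upper R) c g -> upper R l ->
    exists2 d, has_der g l d &
      forall m, upper R m -> cabs (m - l) < 1 -> cabs (g m - g l - d * (m - l)) <= c * cabs (m - l) ^+ 2.
  move=> Dg hl.
  have Dn : dd_bounded (near_upper l 1) c g by apply: dd_boundedS Dg => z [].
  have nl : near_upper l 1 l by split; rewrite ?subrr ?cabs0.
  have [d hd hd'] := dd_bounded_has_der Dn nl.
  by exists d => // m hm1 hm2; apply: hd'.
(* On an open disk inside the half-plane the derivative of the statement is the one
   of [has_der]. *)
have der_a j : has_der (scat q p) (zp j) (cderive (scat_a tau q) (zp j)).
  have [d hd hd'] := nearS _ _ _ D1 (upp j).
  have [z0 _] := zp0 j.
  rewrite (_ : cderive _ _ = d) //.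
  apply: (@cderive_quadratic _ _ _ _ (Num.min 1 (complex.Im (zp j))) c1).
    by rewrite lt_min ltr01.
  move=> m; rewrite lt_min => /andP [m1 m2].
  have um : upper R m.
    by rewrite /upper /=; have := Im_le_cabs (m - zp j); rewrite ReImE ler_norml; lra.
  by rewrite !(scat_a_scat cq cp) //; exact: hd'.
have der_A j : has_der (scat p q) (- zm j) (- cderive (scat_A tau q) (zm j)).
  have [d hd hd'] := nearS _ _ _ D2 (upm j).
  have [z0 _] := zm0 j.
  rewrite (_ : cderive _ _ = - d) ?opprK //.
  apply: (@cderive_quadratic _ _ _ _ (Num.min 1 (- complex.Im (zm j))) c2).
    by rewrite lt_min ltr01 oppr_gt0.
  move=> m; rewrite lt_min => /andP [m1 m2].
  have um : upper R (- m).
    by rewrite /upper /= ReImE; have := Im_le_cabs (m - zm j); rewrite ReImE ler_norml; lra.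
  have em : - m - - zm j = - (m - zm j) by ring.
  rewrite !(scat_A_scat cq cp) //; have := hd' _ um; rewrite em cabsN => /(_ m1).
  by rewrite mulrN mulNr.
have Zp : simple_upper_zeros q p zp (fun j => cderive (scat_a tau q) (zp j)).
  split => //.
  - by move=> j; have [? h] := zp0 j; rewrite -(scat_a_scat cq cp).
  move=> l hl nz; rewrite -(scat_a_scat cq cp hl); apply/negP => /eqP l0.
  have [li|li] := eqVneq (complex.Im l) 0.
    have := ha (complex.Re l); rewrite (_ : (complex.Re l)%:C = l) ?l0 ?eqxx //.
    by apply: complex_eq => /=; rewrite ?li.
  have : [set z | 0 < complex.Im z /\ scat_a tau q z = 0] l by split => //; rewrite lt_def li.
  by rewrite zpr => -[j _ /esym]; exact: nz.
have Zm : simple_upper_zeros p q (fun j => - zm j) (fun j => - cderive (scat_A tau q) (zm j)).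
  split => //.
  - by move=> i j /oppr_inj /zmi.
  - move=> j; have [zi h] := zm0 j; split; first by rewrite ReImE oppr_gt0.
    by rewrite -(scat_A_scat cq cp).
  - move=> l hl nz; apply/negP => /eqP l0.
    have ul : upper R (- - l) by rewrite opprK.
    have l0' : scat_A tau q (- l) = 0 by rewrite (scat_A_scat cq cp ul) opprK.
    have [li|li] := eqVneq (complex.Im l) 0.
      have := hA (complex.Re (- l)); rewrite (_ : (complex.Re (- l))%:C = - l) ?l0' ?eqxx //.
      by apply: complex_eq => //=; rewrite ReImE li oppr0.
    have : [set z | complex.Im z < 0 /\ scat_A tau q z = 0] (- l).
      by split => //; rewrite /= ReImE oppr_lt0 lt_def li.
    by rewrite zmr => -[j _ e]; apply: (nz j); rewrite e opprK.
  by move=> j; rewrite oppr_eq0; exact: zmd.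
have c_line t : cintegrable setT (pair_p tau q f t%:C).
  rewrite (pair_p_pairing cq cp _ (up_real t)).
  exact: (pairing_integrable_line cq cp t (f := F) s1 s2).
split; first split.
- exact: c_line.
- rewrite (pair_m_pairing cq cp _ (up_realN lam)) -rmorphN.
  exact: (pairing_integrable_line cp cq (- lam) (f := flip F) s2 s1).
split.
  move=> j; have [_ ez] := zp0 j; have [_ ez'] := zm0 j; split.
    rewrite (pair_p_pairing cq cp) //; apply: (pairing_integrable_zero cq cp) => //.
    by rewrite -(scat_a_scat cq cp).
  rewrite (pair_m_pairing cq cp) //; apply: (pairing_integrable_zero cp cq) => //.
  by rewrite -(scat_A_scat cq cp).
move=> x.
have idxE (i : 'I_2) : exists k, i = idx k.
  by case: i => [[|[|//]] h]; [exists false|exists true]; exact: val_inj.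
have S k t : spectral_integrand tau q f x t (idx k) 0 =
    line_term q p F t%:C k x - line_term p q (flip F) (- t%:C) (~~ k) x.
  have cp_E : c_p tau q f t = (scat q p t%:C)^-1 * cintegral setT (pairing (mleft q p t%:C) F).
    by rewrite /c_p (scat_a_scat cq cp (up_real t)) (pair_p_pairing cq cp f (up_real t)).
  have cm_E : c_m tau q f t =
      - (scat p q (- t%:C))^-1 * cintegral setT (pairing (mleft p q (- t%:C)) (flip F)).
    by rewrite /c_m (scat_A_scat cq cp (up_realN t)) (pair_m_pairing cq cp f (up_realN t)).
  transitivity (c_p tau q f t * m2p tau q x t%:C (idx k) 0 +
    c_m tau q f t * m2m tau q x t%:C (idx k) 0); first by rewrite mxE; congr (_ + _); rewrite mxE.
  rewrite /line_term -!mulNr -cp_E -cm_E.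
  by congr (_ * _ + _ * _); [exact: (m2p_entries cq cp k x (up_real t))|exact: (m2m_entries cq cp k x (up_realN t))].
have L k := line_integral cq cp k x h1 h2 Zp Zm.
split.
  move=> i; have [k ->] := idxE i; have [I _] := L k.
  by apply: eq_cintegrable I => // t _; rewrite S.
have Wp k : (\sum_(j < n) w_p tau q f (zp j) x) (idx k) 0 =
    residue_sum q p F zp (fun j => cderive (scat_a tau q) (zp j)) k x.
  rewrite summxE; apply: eq_bigr => j _.
  by rewrite mxE (m2p_entries cq cp k x (upp j)) (pair_p_pairing cq cp f (upp j)).
(* The derivative of lam |-> scat p q (- lam) is minus that of scat p q. *)
have Wm k : (\sum_(j < n) w_m tau q f (zm j) x) (idx k) 0 =
    - residue_sum p q (flip F) (fun j => - zm j) (fun j => - cderive (scat_A tau q) (zm j)) (~~ k) x.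
  rewrite summxE -sumrN; apply: eq_bigr => j _.
  rewrite mxE (m2m_entries cq cp k x (upm j)) (pair_m_pairing cq cp f (upm j)).
  by rewrite invrN !mulNr opprK.
apply/matrixP => i o; rewrite ord1 {o}; have [k ->] := idxE i.
pose sg : R[i] := if k then - 1 else 1.
have entryE a (V1 V2 V3 : 'cV[R[i]]_2) v1 v2 v3 : V1 (idx k) 0 = v1 -> V2 (idx k) 0 = v2 ->
    V3 (idx k) 0 = v3 -> (a *: (sigma3 R *m V1) + 'i%C *: (sigma3 R *m V2) +
      'i%C *: (sigma3 R *m V3)) (idx k) 0 = sg * (a * v1 + 'i%C * v2 + 'i%C * v3).
  by rewrite /sigma3 /diag2 !mul_diag_mx !mxE /sg; case: (k) => /= -> -> ->; ring.
have I : (vintegral setT (spectral_integrand tau q f x)) (idx k) 0 =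
    cintegral setT (fun t : R => line_term q p F t%:C k x -
      line_term p q (flip F) (- t%:C) (~~ k) x).
  by rewrite mxE; apply: eq_cintegral => t _; rewrite S.
have [_ E] := L k; rewrite E in I.
rewrite (entryE _ _ _ _ _ _ _ I (Wp k) (Wm k)) -/(entries f k x) -/F.
have pi0 : (2 * pi : R)%:C != 0 :> R[i].
  by rewrite -(rmorph0 (real_complex R)) (inj_eq (@complexI R)) mulf_neq0 ?pnatr_eq0 // gt_eqF // pi_gt0.
rewrite rmorphV /=; last by rewrite unitfE mulf_neq0 ?pnatr_eq0 // gt_eqF // pi_gt0.
(* sigma3 undoes the diagonal matrix - i sigma3 of the leading term. *)
have sl : sg * 'i%C * lead_sign k = 1.
  have ii : 'i%C * 'i%C = -1 :> R[i] by rewrite -expr2 sqr_i.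
  by rewrite /sg /lead_sign; case: (k); rewrite ?mulN1r ?mul1r ?mulNr ?mulrN ii opprK.
exact: (reconstruction_algebra _ _ _ pi0 sl).
Qed.
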